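(* Let $T>0$. The integral kernel $K_T$ may be written as $$K_T(x)=\frac{1}{\sqrt{2\pi T|x|}}+K_{\frac32}(x)+K_\omega(x),$$ where $K_{\frac32}$ belongs to the Hölder class $C^{\frac32}(\mathbb{R})$, this class being optimal (the exponent $\frac32$ cannot be replaced by a larger one), and $K_\omega$ is real-analytic. The singularity of $K_T$ thus has the characterization $$\lim_{x\to 0}\sqrt{|x|}\,K_T(x)=\frac{1}{\sqrt{2\pi T}}.$$ Moreover, for every $\delta<\delta^*$ there is a constant $C$ (depending on $T$ and $\delta$) such that $$|K_T(x)|\leq C e^{-\delta|x|}\qquad\text{for } |x|>1.$$ As a consequence, $K_T\in L^1(\mathbb{R})$.
   Context: For $T>0$ let $l_T(\xi)=\left(\frac{\xi}{(1+T\xi^2)\tanh(\xi)}\right)^{1/2}$ for $\xi\in\mathbb{R}\setminus\{0\}$, $l_T(0)=1$. The Fourier transform is $\hat f(\xi)=\int_{\mathbb{R}} f(x)e^{-ix\xi}\,dx$, and $K_T=\mathcal{F}^{-1}(l_T)$ (in the sense of tempered distributions). The two remainder terms are $$K_{\frac32}=\mathcal{F}^{-1}\left(\sqrt{\tfrac{|\xi|}{1+T\xi^2}}-\tfrac{1}{\sqrt{T|\xi|}}\right),\qquad K_\omega=\mathcal{F}^{-1}\left(l_T(\xi)-\sqrt{\tfrac{|\xi|}{1+T\xi^2}}\right).$$ For non-integer $s>0$, $C^s(\mathbb{R})$ is the standard inhomogeneous Hölder space. The number $\delta^*$ is $$\delta^*=\begin{cases}\min\{\frac{1}{\sqrt T},\frac{\pi}{2}\},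 & T\neq 4/\pi^2,\\ \pi, & T=4/\pi^2.\end{cases}$$ *)

(* Defs.v *)
From HB Require Import structures.
From mathcomp Require Import all_boot all_order all_algebra.
From mathcomp Require Import all_classical all_reals all_analysis.
From mathcomp Require Import complex.
Set Implicit Arguments.
Unset Strict Implicit.
Unset Printing Implicit Defensive.
Import Order.TTheory GRing.Theory Num.Theory.
Import numFieldNormedType.Exports.

Local Open Scope classical_set_scope.
Local Open Scope ring_scope.
Local Open Scope complex_scope.

Section Defs.
Variable R : realType.
Implicit Types (f : R -> R) (T xi x s : R).

Local Notation mu := (@lebesgue_measure R).

Definition Cintegrable (F : R -> R[i]) : Prop :=
  mu.-integrable [set: R] (EFin \o (fun x => complex.Re (F x))) /\
  mu.-integrable [set: R] (EFin \o (fun x => complex.Im (F x))).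

Definition Cintegral (F : R -> R[i]) : R[i] :=
  (\int[mu]_(x in [set: R]) complex.Re (F x)) +i*
  (\int[mu]_(x in [set: R]) complex.Im (F x)).

(* The factor [cos (x * xi) -i* sin (x * xi)] is e^{- i x xi}. *)
Definition fourier (F : R -> R[i]) (xi : R) : R[i] :=
  Cintegral (fun x => F x * (cos (x * xi) -i* sin (x * xi))).

Definition real_schwartz f : Prop :=
  (forall n x, derivable (derive1n n f) x 1) /\
  (forall m n : nat, exists C : R, forall x, `|x ^+ m * derive1n n f x| <= C).

Definition schwartz (phi : R -> R[i]) : Prop :=
  real_schwartz (fun x => complex.Re (phi x)) /\
  real_schwartz (fun x => complex.Im (phi x)).

(* The tempered distribution given by the function [F]; the pairing is
   bilinear (no conjugation). *)
Definition tempered_fun (F : R -> R[i]) : Prop :=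
  forall phi, schwartz phi -> Cintegrable (fun x => F x * phi x).

Definition pairing (F phi : R -> R[i]) : R[i] :=
  Cintegral (fun x => F x * phi x).

(* [K] is the inverse Fourier transform of [l] in the sense of tempered
   distributions: its distributional transform, phi |-> <K, fourier phi>,
   is [l].  This determines [K] up to a null set. *)
Definition inverse_fourier_is (l K : R -> R[i]) : Prop :=
  [/\ tempered_fun l, tempered_fun K &
      forall phi, schwartz phi -> pairing K (fourier phi) = pairing l phi].

Definition tanh x : R := (expR x - expR (- x)) / (expR x + expR (- x)).

Definition l_T T xi : R :=
  if xi == 0 then 1
  else Num.sqrt (xi / ((1 + T * xi ^+ 2) * tanh xi)).

Definition sqrt_symbol T xi : R := Num.sqrt (`|xi| / (1 + T * xi ^+ 2)).

(* At [xi = 0], a null set, the inverse below is [0] by convention. *)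
Definition symbol_32 T xi : R :=
  sqrt_symbol T xi - (Num.sqrt (T * `|xi|))^-1.

Definition symbol_omega T xi : R := l_T T xi - sqrt_symbol T xi.

(* The inhomogeneous Hoelder space C^s(R), meaningful for non-integer s > 0:
   with s = k + a, k a natural number and 0 < a < 1, all derivatives up to
   order k are bounded and the k-th one is globally a-Hoelder. *)
Definition hoelder_space s f : Prop :=
  let k := Num.truncn s in
  [/\ forall j x, (j < k)%N -> derivable (derive1n j f) x 1,
      exists M : R, forall j x, (j <= k)%N -> `|derive1n j f x| <= M &
      exists M : R, forall x y,
        `|derive1n k f x - derive1n k f y| <= M * `|x - y| `^ (s - k%:R)].

Definition real_analytic f : Prop :=
  forall x0 : R, exists (a : nat -> R) (r : R), 0 < r /\
    forall x, `|x - x0| < r -> pseries a (x - x0) @ \oo --> f x.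

Definition delta_star T : R :=
  if T == 4 / pi ^+ 2 then pi else Num.min (1 / Num.sqrt T) (pi / 2).

End Defs.

(* Main.v *)
(* Everything is even, so [K] is the half-line cosine transform of [l_T] divided by [pi], and a
   pairing with a Schwartz function reduces, by Fourier inversion (Abel summation) for
   [U y = u y + u (- y)], to an integral over the half line.  Split
   [l_T = (T xi)^(-1/2) + symbol_32 + symbol_omega]; the first term transforms into
   [(2 pi T |x|)^(-1/2)] as the limit of its Abel regularisations.

   Since [symbol_32 = O(xi^(-5/2))] at infinity, [K_32] has a 1/2-Hoelder derivative.  The exponent
   is optimal because [symbol_32] is negative and at least of order [xi^(-5/2)], which bounds the
   Laplace transform of [K_32'] at [p] from below by [c p^(-3/2)], whereas a Hoelder exponent
   [a > 1/2] of the derivative would bound it above by [C p^(-1-a)].  [K_omega] is analytic because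
   [symbol_omega = O(xi^(-1/2) e^(-xi))].

   For the decay, [l_T' = - N l_T], where [N] is the sine transform of
   [k y = e^(-y / sqrt T) - 1 / (e^(pi y / 2) + 1)] by the partial fractions of [1 / sinh].
   Moreover [|k y| <= e^(- delta_star y)]; when [T = 4 / pi^2] the two exponentials of [k] cancel to
   leading order, hence the larger [delta_star].  Transforming the equation gives
   [x K x = 1/2 \int_0^oo k y (K (x - y) - K (x + y)) dy], and, for large [|x|], the factor [x] makes
   the right-hand side a contraction for the sup norm with weight [e^(delta |x|)].  To work with
   absolutely convergent integrals this is done for the transform of [l_T xi e^(- e xi)], uniformly
   in [e], with the weight truncated at height [e^(delta n)]. *)

Require Import Defs.
From HB Require Import structures.
From mathcomp Require Import all_boot all_order all_algebra.
From mathcomp Require Import all_classical all_reals all_analysis.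
From mathcomp Require Import complex measurable_realfun ring lra.
Import Order.TTheory GRing.Theory Num.Theory.
Import numFieldNormedType.Exports.

Set Implicit Arguments.
Unset Strict Implicit.

Local Open Scope classical_set_scope.
Local Open Scope ring_scope.

(** * Integration over the half line *)

(** Two limits compete in the decay estimate. Damping adds to the convolution equation the term
    [e * sin_tr (l_abel e) x], which is only [O(sqrt e)], and the weight multiplies it by up to
    [e^(d n)]. So [n = |x|] is fixed first and [e] tends to [0] afterwards. The a priori bound that
    starts the argument must then be uniform in [e]. It comes from writing [y^(-1/2)] as a
    superposition of the exponentials [e^(-w^2 y)]: the transform becomes an integral of Poisson
    kernels, positive and dominated by [2 / (w^2 + |x|)], and its limit is a rational integral
    instead of a Fresnel integral. The partial fractions are obtained without complex analysis, from
    the Fourier series on [[0, 2]] of [cosh (x t) - 1] evaluated at [t = 0]. Optimality is tested by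
    a Laplace transform because it replaces the oscillating [sin (x t)] by the positive
    [t / (p^2 + t^2)], so that the constant sign of [symbol_32] excludes cancellation. *)

Section integration.
Context {R : realType}.
Notation mu := (@lebesgue_measure R).
Notation L1 A f := (mu.-integrable A (EFin \o f)).
Implicit Types (A B : set R) (f g h F : R -> R).

Lemma integrable_le A f g : measurable A -> measurable_fun A f -> L1 A g ->
  (forall x, A x -> `|f x| <= g x) -> L1 A f.
Proof.
move=> mA mf ig fg; apply: (@le_integrable _ _ _ mu A mA _ (EFin \o g)) => //.
  exact/measurable_EFinP.
by move=> x Ax /=; rewrite lee_fin (le_trans (fg _ Ax))// ler_norm.
Qed.

Lemma integrable_sum A f g : measurable A -> L1 A f -> L1 A g ->
  L1 A (fun x => f x + g x).
Proof. by move=> mA fi gi; exact: (@integrableD _ _ _ mu A mA (EFin \o f) (EFin \o g)). Qed.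

Lemma integrable_diff A f g : measurable A -> L1 A f -> L1 A g ->
  L1 A (fun x => f x - g x).
Proof. by move=> mA fi gi; exact: (@integrableB _ _ _ mu A mA (EFin \o f) (EFin \o g)). Qed.

Lemma integrable_scale A f c : measurable A -> L1 A f -> L1 A (fun x => c * f x).
Proof. by move=> mA fi; exact: (@integrableZl _ _ _ mu A mA c (EFin \o f)). Qed.

Lemma integrable_measurable {A f} : L1 A f -> measurable_fun A f.
Proof. by move=> /(measurable_int mu)/measurable_EFinP. Qed.

Lemma integrable_norm A f : measurable A -> L1 A f -> L1 A (fun x => `|f x|).
Proof. by move=> mA fi; exact: (@integrable_abse _ _ _ mu A (EFin \o f)). Qed.

Lemma integrable_eq A f g : measurable A -> L1 A f -> (forall x, A x -> f x = g x) ->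
  L1 A g.
Proof.
by move=> mA fi fg; apply: eq_integrable fi => // x /set_mem Ax /=; rewrite fg.
Qed.

Lemma integral_eq A f g : (forall x, A x -> f x = g x) ->
  \int[mu]_(x in A) f x = \int[mu]_(x in A) g x.
Proof. by move=> fg; apply: eq_Rintegral => x /set_mem; exact: fg. Qed.

Lemma le_integral_bound A f g : measurable A -> measurable_fun A f -> L1 A g ->
  (forall x, A x -> `|f x| <= g x) ->
  `|\int[mu]_(x in A) f x| <= \int[mu]_(x in A) g x.
Proof.
move=> mA mf ig fg; have fi := integrable_le mA mf ig fg.
apply: (le_trans (@le_normr_Rintegral _ _ _ mu A f mA fi)).
by apply: le_Rintegral => //; exact: integrable_norm.
Qed.

Lemma dominated_cvgn A (f_ : nat -> R -> R) f g : measurable A ->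
  (forall n, measurable_fun A (f_ n)) ->
  (forall x, A x -> f_ n x @[n --> \oo] --> f x) ->
  L1 A g -> (forall n x, A x -> `|f_ n x| <= g x) ->
  L1 A f /\ \int[mu]_(x in A) f_ n x @[n --> \oo] --> \int[mu]_(x in A) f x.
Proof.
move=> mA mf_ f_f ig f_g.
have mf : measurable_fun A f by exact: measurable_fun_cvg mf_ f_f.
have mE h : measurable_fun A h -> measurable_fun A (EFin \o h).
  by move=> ?; exact/measurable_EFinP.
have := @dominated_convergence _ _ _ mu A mA _ _ _ (fun n => mE _ (mf_ n)) (mE _ mf) _ ig.
case=> [||fi _ h].
- by apply: aeW => x Ax; apply: cvg_EFin; [exact: nearW|exact: f_f].
- by apply: aeW => x n Ax; rewrite lee_fin f_g.
split => //; apply: fine_cvg; rewrite fineK//.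
exact: integrable_fin_num.
Qed.

End integration.

(** * Exchange of iterated integrals over products of sets *)

Section fubini_sets.
Context {R : realType}.
Notation mu := (@lebesgue_measure R).
Notation L1 A f := (mu.-integrable A (EFin \o f)).
Implicit Types (A B : set R) (G : R -> R) (H c : R * R -> R).

(** The zero extension [H'] is integrable on the plane because its inner absolute integrals stay
    below [G]. Integrability of both families of sections makes the inner integrals finite, so that
    nothing is lost by [fine]. *)
Lemma Fubini_set A B H G : measurable A -> measurable B -> measurable_fun setT H ->
  (forall x, A x -> L1 B (fun y => H (x, y))) ->
  (forall y, B y -> L1 A (fun x => H (x, y))) ->
  L1 A G -> (forall x, A x -> \int[mu]_(y in B) `|H (x, y)| <= G x) ->
  \int[mu]_(x in A) \int[mu]_(y in B) H (x, y) =
  \int[mu]_(y in B) \int[mu]_(x in A) H (x, y).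
Proof.
move=> mA mB mH iHx iHy iG HG.
pose H' := (fun z => (H z)%:E) \_ (A `*` B).
have HA x : A x -> (fun y => H' (x, y)) = (fun y => (H (x, y))%:E) \_ B.
  move=> Ax; apply/funext => y; rewrite /H' /patch; congr (if _ then _ else _).
  by apply/idP/idP; rewrite !inE//=; case.
have HAn x : ~ A x -> (fun y => H' (x, y)) = cst 0%E.
  by move=> Ax; apply/funext => y; rewrite /H' /patch memNset// => -[].
have HB y : B y -> (fun x => H' (x, y)) = (fun x => (H (x, y))%:E) \_ A.
  move=> Ax; apply/funext => x; rewrite /H' /patch; congr (if _ then _ else _).
  by apply/idP/idP; rewrite !inE//=; case.
have HBn y : ~ B y -> (fun x => H' (x, y)) = cst 0%E.
  by move=> Ax; apply/funext => x; rewrite /H' /patch memNset// => -[].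
have mH' : measurable_fun setT H'.
  apply/(measurable_restrictT _ _).1 => //; first exact: measurableX.
  by apply: measurable_funTS; exact/measurable_EFinP.
have iH' : (mu \x mu)%E.-integrable setT H'.
  apply/integrable12ltyP => //.
  have iG' : mu.-integrable setT ((EFin \o G) \_ A) by rewrite -integrable_mkcond.
  have /integrableP[mG' /(le_lt_trans _)] := iG'; apply.
  apply: ge0_le_integral => //.
  - by move=> x _; apply: integral_ge0.
  - apply: (@measurable_fun_fubini_tonelli_F _ _ _ _ _ mu (abse \o H')) => //.
      by apply: measurableT_comp.
    by move=> z; exact: abse_ge0.
  - by apply: measurableT_comp.
  move=> x _; have [Ax|Ax] := pselect (A x); last first.
    rewrite integral0_eq ?abse_ge0// => y _.
    by have := congr1 (@^~ y) (HAn _ Ax) => /= ->; rewrite abse0.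
  rewrite patchE mem_set//= (@le_trans _ _ (G x)%:E) ?lee_fin ?ler_norm//.
  apply: (@le_trans _ _ (\int[mu]_(y in B) `|H (x, y)|)%:E); last by rewrite lee_fin HG.
  have iH := integrable_norm mB (iHx _ Ax).
  rewrite fineK; last exact: integrable_fin_num iH.
  rewrite [leRHS]integral_mkcond le_eqVlt; apply/orP; left; apply/eqP.
  apply: eq_integral => y _; have := congr1 (@^~ y) (HA _ Ax) => /= ->.
  by rewrite !patchE; case: ifP => //; rewrite abse0.
have := Fubini iH'.
rewrite /Rintegral => E; congr fine.
rewrite integral_mkcond [RHS]integral_mkcond.
transitivity (\int[mu]_x \int[mu]_y H' (x, y))%E; last rewrite E.
  apply: eq_integral => x _; rewrite /patch; case: ifPn => [/set_mem Ax|].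
    rewrite fineK; first by rewrite HA// -integral_mkcond.
    exact: integrable_fin_num (iHx _ Ax).
  by rewrite notin_setE => /HAn ->; rewrite integral0.
apply: eq_integral => y _; rewrite /patch; case: ifPn => [/set_mem Ax|].
  rewrite fineK; first by rewrite HB// -integral_mkcond.
  exact: integrable_fin_num (iHy _ Ax).
by rewrite notin_setE => /HBn ->; rewrite integral0.
Qed.
End fubini_sets.

Section fubini_kernel.
Context {R : realType}.
Notation mu := (@lebesgue_measure R).
Notation L1 A f := (mu.-integrable A (EFin \o f)).
Implicit Types (A B : set R) (f g h : R -> R) (c : R * R -> R).

Lemma measurable_section1 c x : measurable_fun setT c ->
  measurable_fun setT (fun y : R => c (x, y)).
Proof. by move=> mc; apply: measurableT_comp => //; exact: pair1_measurable. Qed.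

Lemma measurable_section2 c y : measurable_fun setT c ->
  measurable_fun setT (fun x : R => c (x, y)).
Proof. by move=> mc; apply: measurableT_comp => //; exact: pair2_measurable. Qed.

Lemma integrable_bounded_mul A f h : measurable A -> L1 A f -> measurable_fun A h ->
  (forall x, A x -> `|h x| <= 1) -> L1 A (fun x => f x * h x).
Proof.
move=> mA fi mh h1; apply: (integrable_le mA (g := fun x => `|f x|)).
- by apply: measurable_funM => //; exact: integrable_measurable fi.
- exact: integrable_norm.
- by move=> x Ax; rewrite normrM ler_piMr// h1.
Qed.

(** Since [c] is bounded by [1], the inner absolute integral is at most [|f x|] times the norm of
    [g]. In the uses below [c] is a cosine, a sine or a product of two of them. *)
Lemma Fubini_kernel A B f g c : measurable A -> measurable B ->
  L1 A f -> L1 B g -> measurable_fun setT c -> (forall z, `|c z| <= 1) ->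
  \int[mu]_(x in A) (f x * \int[mu]_(y in B) (g y * c (x, y))) =
  \int[mu]_(y in B) (g y * \int[mu]_(x in A) (f x * c (x, y))).
Proof.
move=> mA mB fi gi mc c1.
have mf : measurable_fun setT (f \_ A).
  by apply/(measurable_restrictT _ _).1 => //; exact: integrable_measurable fi.
have mg : measurable_fun setT (g \_ B).
  by apply/(measurable_restrictT _ _).1 => //; exact: integrable_measurable gi.
have gci x : L1 B (fun y => g y * c (x, y)).
  by apply: integrable_bounded_mul => //; apply: measurable_funTS; exact: measurable_section1.
have fci y : L1 A (fun x => f x * c (x, y)).
  by apply: integrable_bounded_mul => //; apply: measurable_funTS; exact: measurable_section2.
(* [f] and [g] are measurable on [A] and [B] only; cutting them off makes [H] measurable on the
   whole plane. *)
pose H (z : R * R) := (f \_ A) z.1 * (g \_ B) z.2 * c z.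
have HE x y : A x -> B y -> H (x, y) = f x * (g y * c (x, y)).
  by move=> Ax By; rewrite /H/= !patchE !mem_set// mulrA.
have HE' x y : A x -> B y -> H (x, y) = g y * (f x * c (x, y)).
  by move=> Ax By; rewrite HE// mulrCA.
have HiB x : A x -> L1 B (fun y => H (x, y)).
  move=> Ax; apply: (@integrable_eq _ _ (fun y => f x * (g y * c (x, y)))) => //.
    exact: integrable_scale.
  by move=> y By; rewrite HE.
have HiA y : B y -> L1 A (fun x => H (x, y)).
  move=> By; apply: (@integrable_eq _ _ (fun x => g y * (f x * c (x, y)))) => //.
    exact: integrable_scale.
  by move=> x Ax; rewrite HE'.
transitivity (\int[mu]_(x in A) \int[mu]_(y in B) H (x, y)).
  apply: integral_eq => x Ax; rewrite -RintegralZl//.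
  by apply: integral_eq => y By; rewrite HE.
rewrite (@Fubini_set _ A B H (fun x : R => (\int[mu]_(y in B) `|g y|) * `|f x|))//.
- apply: integral_eq => y By; rewrite -RintegralZl//.
  by apply: integral_eq => x Ax; rewrite HE'.
- apply: measurable_funM => //; apply: measurable_funM.
  + by apply: measurableT_comp mf _; exact: measurable_fst.
  + by apply: measurableT_comp mg _; exact: measurable_snd.
- by apply: integrable_scale => //; exact: integrable_norm.
move=> x Ax; rewrite mulrC -RintegralZl//; last exact: integrable_norm.
apply: le_Rintegral => //.
- exact: integrable_norm (HiB _ Ax).
- by apply: integrable_scale => //; exact: integrable_norm.
by move=> y By; rewrite HE// normrM ler_wpM2l// normrM ler_piMr.
Qed.

End fubini_kernel.

(** * The fundamental theorem of calculus on half lines *)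

Notation pos_line R := (`]0, +oo[%classic : set R).

Section half_line.
Context {R : realType}.
Notation mu := (@lebesgue_measure R).
Notation P := (pos_line R).
Notation L1 A f := (mu.-integrable A (EFin \o f)).
Implicit Types (f g F : R -> R).

Lemma pos_lineE (x : R) : P x = (0 < x) :> Prop.
Proof. by rewrite /= in_itv/= andbT. Qed.

Lemma continuous_pos_measurable f : (forall x : R, 0 < x -> {for x, continuous f}) ->
  measurable_fun P f.
Proof.
move=> cf; apply: open_continuous_measurable_fun => // x /set_mem.
by rewrite pos_lineE; exact: cf.
Qed.

Lemma cvg_inv_succ : (n.+2%:R^-1 : R) @[n --> \oo] --> 0.
Proof.
have := @cvg_harmonic R.
by rewrite -cvg_shiftS.
Qed.

Lemma FTC_segment f F (a c d : R) : a < c -> c < d ->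
  (forall x : R, a < x -> is_derive x 1 F (f x)) ->
  (forall x : R, a < x -> {for x, continuous f}) ->
  (\int[mu]_(x in `[c, d]) (f x)%:E = (F d - F c)%:E)%E.
Proof.
move=> ac cd dF cf; have itv (x : R) : c <= x -> a < x by exact: lt_le_trans.
have cF (x : R) : a < x -> {for x, continuous F}.
  move=> x0; apply: differentiable_continuous; apply/derivable1_diffP.
  by have [] := dF x x0.
rewrite EFinB; apply: continuous_FTC2 => //.
- apply: continuous_in_subspaceT => x /set_mem /=; rewrite in_itv/= => /andP[cx _].
  exact: cf (itv _ cx).
- split.
  + by move=> x; rewrite in_itv/= => /andP[/ltW/itv x0 _]; have [] := dF x x0.
  + apply: cvg_at_right_filter; exact: cF.
  + apply: cvg_at_left_filter; apply: cF; exact: lt_trans cd.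
- move=> x; rewrite in_itv/= => /andP[/ltW/itv x0 _].
  by rewrite derive1E; have [_ ->] := dF x x0.
Qed.

(** The shift by two gives [1 / (n + 2) < n + 2] for every [n], so that no segment of this
    exhaustion degenerates. *)
Let I a n : set R := `[a + n.+2%:R^-1, a + n.+2%:R].

Let I_lt (a : R) n : a + n.+2%:R^-1 < a + n.+2%:R.
Proof.
by rewrite ltrD2l; apply: (@lt_trans _ _ 1); rewrite ?invf_lt1 ?ltr1n.
Qed.

Let I_bigcup a : \bigcup_n I a n = `]a, +oo[%classic.
Proof.
apply/seteqP; split=> [x [n _]|x]; rewrite /= ?in_itv/= ?andbT.
  by rewrite /I/= in_itv/= => /andP[+ _]; apply: lt_le_trans; rewrite ltrDl invr_gt0.
move=> ax; have xa0 : 0 < x - a by rewrite subr_gt0.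
have [n _ ] : \forall n \near \oo, x - a <= n%:R /\ (x - a)^-1 <= n%:R.
  by near do split; exact: nbhs_infty_ger.
move=> /(_ n.+2 (leq_trans (leqnSn _) (leqnSn _)))[xn xn'].
exists n => //; rewrite /I/= in_itv/= -lerBlDl xn andbT -lerBrDl.
by rewrite -[leRHS]invrK lef_pV2 ?posrE ?invr_gt0.
Unshelve. all: by end_near. Qed.

Let cvg_boundary F a la lb : F x @[x --> a^'+] --> la -> F x @[x --> +oo] --> lb ->
  F (a + n.+2%:R) - F (a + n.+2%:R^-1) @[n --> \oo] --> lb - la.
Proof.
move=> Fa Fb; apply: cvgB.
  move/cvg_pinftyP : Fb; apply.
  apply/cvgryPge => A; near=> n; rewrite -lerBlDl; apply: (@le_trans _ _ n%:R).
    by near: n; exact: nbhs_infty_ger.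
  by rewrite ler_nat -addn2 leq_addr.
move/cvg_at_rightP : Fa; apply; split; first by move=> n; rewrite ltrDl invr_gt0.
by rewrite -[X in _ --> X]addr0; apply: cvgD; [exact: cvg_cst|exact: cvg_inv_succ].
Unshelve. all: by end_near. Qed.

(** For a nonnegative integrand the segment integrals increase, so monotone convergence yields
    integrability together with the value. [FTC_oy] below treats integrands of changing sign: there
    integrability is assumed and dominated convergence takes over. *)
Lemma FTC_oy_ge0 f F (a la lb : R) :
  (forall x : R, a < x -> is_derive x 1 F (f x)) ->
  (forall x : R, a < x -> {for x, continuous f}) ->
  (forall x : R, a < x -> 0 <= f x) ->
  F x @[x --> a^'+] --> la -> F x @[x --> +oo] --> lb ->
  L1 `]a, +oo[ f /\ \int[mu]_(x in `]a, +oo[) f x = lb - la.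
Proof.
move=> dF cf f0 Fa Fb.
have mf : measurable_fun `]a, +oo[ f.
  by apply: open_continuous_measurable_fun => // x /set_mem/=; rewrite in_itv/= andbT; exact: cf.
have subI n : I a n `<=` `]a, +oo[ by rewrite -I_bigcup; exact: bigcup_sup.
have h1 : (\int[mu]_(x in I a i) (f x)%:E @[i --> \oo] --> \int[mu]_(x in `]a, +oo[) (f x)%:E)%E.
  rewrite -I_bigcup; apply: ge0_nondecreasing_set_cvg_integral.
  - move=> m n mn; apply/subsetPset/subset_itv; rewrite bnd_simp.
      by rewrite lerD2l lef_pV2 ?posrE// ler_nat.
    by rewrite lerD2l ler_nat.
  - by move=> i; exact: measurable_itv.
  - move=> i; apply/measurable_EFinP; apply: measurable_funS mf => //.
  - by move=> i x /subI; rewrite /= in_itv/= andbT lee_fin; exact: f0.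
have h2 : (\int[mu]_(x in I a i) (f x)%:E @[i --> \oo] --> (lb - la)%:E)%E.
  under eq_fun do rewrite (FTC_segment _ (I_lt a _) dF cf) ?ltrDl ?invr_gt0//.
  apply: cvg_EFin; first exact: nearW.
  exact: cvg_boundary.
have E : (\int[mu]_(x in `]a, +oo[) (f x)%:E = (lb - la)%:E)%E.
  exact: (cvg_unique _ h1 h2).
split; last by rewrite /Rintegral E.
apply/integrableP; split; first exact/measurable_EFinP.
under eq_integral => x /set_mem.
  rewrite /= in_itv/= andbT => x0.
  rewrite ger0_norm; last exact: f0.
  over.
by rewrite E ltry.
Qed.

Lemma FTC_oy f F (a la lb : R) :
  (forall x : R, a < x -> is_derive x 1 F (f x)) ->
  (forall x : R, a < x -> {for x, continuous f}) ->
  L1 `]a, +oo[ f ->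
  F x @[x --> a^'+] --> la -> F x @[x --> +oo] --> lb ->
  \int[mu]_(x in `]a, +oo[) f x = lb - la.
Proof.
move=> dF cf fi Fa Fb.
have mf : measurable_fun `]a, +oo[ f.
  by apply: open_continuous_measurable_fun => // x /set_mem/=; rewrite in_itv/= andbT; exact: cf.
have mI n : measurable (I a n) by exact: measurable_itv.
have subI n : I a n `<=` `]a, +oo[ by rewrite -I_bigcup; exact: bigcup_sup.
have mP : measurable (`]a, +oo[%classic : set R) by exact: measurable_itv.
have [||||_ h1] := @dominated_cvgn R `]a, +oo[%classic (fun n => f \_ (I a n)) f (fun x => `|f x|) mP.
- move=> n; apply: measurable_funTS; apply/(measurable_restrictT _ _).1 => //.
  exact: measurable_funS mf.
- move=> x Px; apply: cvg_near_cst.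
  move: (Px); rewrite -I_bigcup => -[N _ Ix]; exists N => // n /= Nn.
  rewrite patchE mem_set//; move: Ix; rewrite /I/= !in_itv/= => /andP[Nx xN].
  apply/andP; split; [apply: le_trans Nx|apply: (le_trans xN)].
    by rewrite lerD2l lef_pV2 ?posrE// ler_nat.
  by rewrite lerD2l ler_nat.
- exact: integrable_norm.
- by move=> n x Px; rewrite patchE; case: ifP => //; rewrite normr0.
have h2 : \int[mu]_(x in `]a, +oo[) (f \_ (I a n)) x @[n --> \oo] --> lb - la.
  have -> : (fun n => \int[mu]_(x in `]a, +oo[) (f \_ (I a n)) x) =
            (fun n => F (a + n.+2%:R) - F (a + n.+2%:R^-1)).
    apply/funext => n; rewrite -Rintegral_mkcondr setIidr//.
    by rewrite /Rintegral (FTC_segment _ (I_lt a _) dF cf) ?ltrDl ?invr_gt0.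
  exact: cvg_boundary.
exact: (cvg_unique _ h1 h2).
Qed.

End half_line.

(** * Cosine and sine transforms *)

Section transforms.
Context {R : realType}.
Notation mu := (@lebesgue_measure R).
Notation P := (pos_line R).
Notation L1 A f := (mu.-integrable A (EFin \o f)).
Implicit Types (f g F m : R -> R) (x y : R).

Definition cos_tr m x := \int[mu]_(y in P) (m y * cos (x * y)).
Definition sin_tr m x := \int[mu]_(y in P) (m y * sin (x * y)).

Lemma measurable_pos_line : measurable P.
Proof. exact: measurable_itv. Qed.
Hint Resolve measurable_pos_line : core.

Lemma norm_cos_le1 x : `|cos x| <= 1 :> R.
Proof. by rewrite ler_norml cos_geN1 cos_le1. Qed.

Lemma norm_sin_le1 x : `|sin x| <= 1 :> R.
Proof. by rewrite ler_norml sin_geN1 sin_le1. Qed.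

Lemma continuous_cos_mul x : continuous (fun y => cos (x * y)).
Proof.
by move=> y; apply: (@continuous_comp _ _ _ ( *%R x) cos); [exact: mulrl_continuous|exact: continuous_cos].
Qed.

Lemma continuous_sin_mul x : continuous (fun y => sin (x * y)).
Proof.
by move=> y; apply: (@continuous_comp _ _ _ ( *%R x) sin); [exact: mulrl_continuous|exact: continuous_sin].
Qed.

Lemma measurable_cos_mul A x : measurable_fun A (fun y : R => cos (x * y)).
Proof. by apply: measurable_funTS; apply: continuous_measurable_fun; exact: continuous_cos_mul. Qed.

Lemma measurable_sin_mul A x : measurable_fun A (fun y : R => sin (x * y)).
Proof. by apply: measurable_funTS; apply: continuous_measurable_fun; exact: continuous_sin_mul. Qed.

Lemma integrable_mul_cos A m x : measurable A -> L1 A m -> L1 A (fun y => m y * cos (x * y)).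
Proof.
move=> mA mi; apply: integrable_bounded_mul => //; first exact: measurable_cos_mul.
by move=> y _; exact: norm_cos_le1.
Qed.

Lemma integrable_mul_sin A m x : measurable A -> L1 A m -> L1 A (fun y => m y * sin (x * y)).
Proof.
move=> mA mi; apply: integrable_bounded_mul => //; first exact: measurable_sin_mul.
by move=> y _; exact: norm_sin_le1.
Qed.

Lemma cos_tr_bound m x : L1 P m -> `|cos_tr m x| <= \int[mu]_(y in P) `|m y|.
Proof.
move=> mi; have imc := integrable_mul_cos x measurable_pos_line mi.
apply: le_integral_bound => //; first exact: integrable_measurable imc.
  exact: integrable_norm.
by move=> y _; rewrite normrM ler_piMr// norm_cos_le1.
Qed.

Lemma sin_tr_bound m x : L1 P m -> `|sin_tr m x| <= \int[mu]_(y in P) `|m y|.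
Proof.
move=> mi; have imc := integrable_mul_sin x measurable_pos_line mi.
apply: le_integral_bound => //; first exact: integrable_measurable imc.
  exact: integrable_norm.
by move=> y _; rewrite normrM ler_piMr// norm_sin_le1.
Qed.

Lemma cos_trN m x : cos_tr m (- x) = cos_tr m x.
Proof. by apply: integral_eq => y _; rewrite mulNr cosN. Qed.

Lemma cos_trD f g x : L1 P f -> L1 P g ->
  cos_tr (fun y => f y + g y) x = cos_tr f x + cos_tr g x.
Proof.
move=> fi gi; rewrite /cos_tr -RintegralD//; [|exact: integrable_mul_cos..].
by apply: integral_eq => y _; rewrite mulrDl.
Qed.

(** Dominated convergence is used along sequences, hence continuity of the transforms is tested
    sequentially. *)
Lemma cvg_seq_continuous F x :
  (forall u : nat -> R, u n @[n --> \oo] --> x -> F (u n) @[n --> \oo] --> F x) ->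
  {for x, continuous F}.
Proof. by move=> h; apply/(@cvg_nbhsP _ R^o). Qed.

Lemma continuous_cos_tr m : L1 P m -> continuous (cos_tr m).
Proof.
move=> mi x; apply: cvg_seq_continuous => u ux.
have [] // := @dominated_cvgn R P (fun n y => m y * cos (u n * y))
  (fun y => m y * cos (x * y)) (fun y => `|m y|) measurable_pos_line.
- by move=> n; apply: (integrable_measurable (integrable_mul_cos _ _ mi)).
- move=> y _; apply: cvgMl_tmp.
  apply: continuous_cvg; first exact: continuous_cos.
  exact: cvgMr_tmp.
- exact: integrable_norm.
- by move=> n y _; rewrite normrM ler_piMr// norm_cos_le1.
Qed.

Lemma continuous_sin_tr m : L1 P m -> continuous (sin_tr m).
Proof.
move=> mi x; apply: cvg_seq_continuous => u ux.
have [] // := @dominated_cvgn R P (fun n y => m y * sin (u n * y))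
  (fun y => m y * sin (x * y)) (fun y => `|m y|) measurable_pos_line.
- by move=> n; apply: (integrable_measurable (integrable_mul_sin _ _ mi)).
- move=> y _; apply: cvgMl_tmp.
  apply: continuous_cvg; first exact: continuous_sin.
  exact: cvgMr_tmp.
- exact: integrable_norm.
- by move=> n y _; rewrite normrM ler_piMr// norm_sin_le1.
Qed.

Lemma is_derive_cos_tr m x : L1 P m -> L1 P (fun y => y * m y) ->
  is_derive x 1 (cos_tr m) (- sin_tr (fun y => y * m y) x).
Proof.
move=> mi ymi; pose f x y := m y * cos (x * y).
have df (z y : R) : is_derive z 1 (f ^~ y) (- (y * m y * sin (z * y))).
  rewrite /f; apply: is_derive_eq.
  by rewrite /GRing.scale/=; ring.
have dfE (z y : R) : partial1of2 f z y = - (y * m y * sin (z * y)).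
  by rewrite partial1of2E; have [_ ->] := df z y.
have xI : (`]x - 1, x + 1[%classic : set R) x.
  by rewrite /= in_itv/= ltrBlDr ltrDl ltr01.
have fi z : (`]x - 1, x + 1[%classic : set R) z -> L1 P (f z).
  by move=> _; exact: integrable_mul_cos.
have Hd z y : (`]x - 1, x + 1[%classic : set R) z -> P y -> derivable (f ^~ y) z 1.
  by move=> _ _; have [] := df z y.
have G0 y : 0 <= `|y * m y| by [].
have Gi : L1 P (fun y => `|y * m y|) by exact: integrable_norm.
have Gub z y : (`]x - 1, x + 1[%classic : set R) z -> P y ->
    `|partial1of2 f z y| <= `|y * m y|.
  by move=> _ _; rewrite dfE normrN normrM ler_piMr// norm_sin_le1.
apply: DeriveDef.
  exact: (@derivable_under_integral _ _ _ mu f P measurable_pos_line _ _ _ xI fi Hd _ G0 Gi Gub).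
have := @differentiation_under_integral _ _ _ mu f P measurable_pos_line _ _ _ xI fi Hd _ G0 Gi Gub.
rewrite derive1E => ->.
rewrite /sin_tr -mulN1r -RintegralZl//; last exact: integrable_mul_sin.
by apply: integral_eq => y _; rewrite dfE mulN1r.
Qed.

End transforms.
#[global] Hint Extern 0 (measurable (pos_line _)) => solve [exact: measurable_pos_line] : core.

(** * Laplace transforms of the cosine and the sine *)

Section laplace.
Context {R : realType}.
Notation mu := (@lebesgue_measure R).
Notation P := (pos_line R).
Notation L1 A f := (mu.-integrable A (EFin \o f)).
Implicit Types (f g F m : R -> R) (x y e c : R).

Lemma cvgy0_le_inv F c : (forall x : R, 1 <= x -> `|F x| <= c / x) ->
  F x @[x --> +oo] --> 0.
Proof.
move=> Fc; apply/cvgrPdist_le => /= e e0; near=> x.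
have x1 : 1 <= x by near: x; exact: nbhs_pinfty_ge.
rewrite sub0r normrN (le_trans (Fc _ x1))//.
have x0 : 0 < x by exact: lt_le_trans x1.
by rewrite ler_pdivrMr// mulrC -ler_pdivrMr.
Unshelve. all: by end_near. Qed.

Lemma expRN_le_inv x : 0 < x -> expR (- x) <= x^-1.
Proof.
move=> x0; rewrite expRN lef_pV2 ?posrE ?expR_gt0//.
by rewrite (le_trans _ (expR_ge1Dx x))// lerDr.
Qed.

Lemma cvgy_expNM e c g : 0 < e -> (forall x : R, 1 <= x -> `|g x| <= c) ->
  expR (- (e * x)) * g x @[x --> +oo] --> 0.
Proof.
move=> e0 gc; apply: (@cvgy0_le_inv _ (c / e)) => x x1.
have x0 : 0 < x by exact: lt_le_trans x1.
rewrite normrM ger0_norm ?expR_ge0// -mulrA -invfM mulrC.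
by apply: ler_pM => //; [exact: gc|apply: expRN_le_inv; rewrite mulr_gt0].
Qed.

Lemma continuous_expNM e : continuous (fun x : R => expR (- (e * x))).
Proof.
move=> x; apply: (@continuous_comp _ _ _ (fun y => - (e * y)) expR); last exact: continuous_expR.
by apply: cvgN; exact: mulrl_continuous.
Qed.

Lemma integrable_expNM e : 0 < e ->
  L1 P (fun x => expR (- (e * x))) /\ \int[mu]_(x in P) expR (- (e * x)) = e^-1.
Proof.
move=> e0.
have [|||||] := @FTC_oy_ge0 R (fun x => expR (- (e * x)))
  (fun x => - e^-1 * expR (- (e * x))) 0 (- e^-1) 0.
- move=> x _; apply: is_derive_eq.
  by rewrite /GRing.scale/= mulr1; field; rewrite gt_eqF.
- by move=> x _; exact: continuous_expNM.
- by move=> x _; exact: expR_ge0.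
- rewrite [X in _ --> X](_ : _ = - e^-1 * expR (- (e * 0))); last first.
    by rewrite mulr0 oppr0 expR0 mulr1.
  apply: cvg_at_right_filter; apply: cvgMl_tmp.
  exact: continuous_expNM.
- under eq_fun do rewrite mulrC.
  exact: (@cvgy_expNM _ `|- e^-1|).
- by move=> -> ->; rewrite sub0r opprK.
Qed.

Lemma den_gt0 e a : 0 < e -> 0 < e ^+ 2 + a ^+ 2 :> R.
Proof. by move=> e0; rewrite ltr_pwDl ?sqr_ge0// exprn_gt0. Qed.

Lemma laplace_cos e a : 0 < e ->
  \int[mu]_(x in P) (expR (- (e * x)) * cos (a * x)) = e / (e ^+ 2 + a ^+ 2).
Proof.
move=> e0; have d0 := den_gt0 a e0.
(* The real part of [e^((- e + i a) x) / (- e + i a)]. *)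
pose F x : R := expR (- (e * x)) * ((a * sin (a * x) - e * cos (a * x)) / (e ^+ 2 + a ^+ 2)).
apply: (etrans (@FTC_oy R (fun x => expR (- (e * x)) * cos (a * x)) F 0
  (- (e / (e ^+ 2 + a ^+ 2))) 0 _ _ _ _ _)); last by rewrite sub0r opprK.
- move=> x _; apply: is_derive_eq.
  rewrite /GRing.scale/= !mulr1 ?mul1r; field.
  by rewrite gt_eqF.
- move=> x _; apply: cvgM; [exact: continuous_expNM|exact: continuous_cos_mul].
- by apply: integrable_mul_cos => //; have [] := integrable_expNM e0.
- have -> : - (e / (e ^+ 2 + a ^+ 2)) = F 0.
    by rewrite /F !mulr0 oppr0 expR0 cos0 sin0 mul1r mulr0 sub0r mulr1 mulNr.
  apply: cvg_at_right_filter; apply: cvgM; first exact: continuous_expNM.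
  apply: cvgMr_tmp; apply: cvgB; apply: cvgMl_tmp.
    exact: continuous_sin_mul.
  exact: continuous_cos_mul.
- apply: (@cvgy_expNM _ ((`|a| + e) / (e ^+ 2 + a ^+ 2))) => // x _.
  rewrite normrM normfV (gtr0_norm d0) ler_pM2r ?invr_gt0//.
  rewrite (le_trans (ler_normB _ _))// lerD// normrM.
    by rewrite ler_piMr ?norm_sin_le1.
  by rewrite (gtr0_norm e0) ler_piMr ?norm_cos_le1// ltW.
Qed.

Lemma laplace_sin e a : 0 < e ->
  \int[mu]_(x in P) (expR (- (e * x)) * sin (a * x)) = a / (e ^+ 2 + a ^+ 2).
Proof.
move=> e0; have d0 := den_gt0 a e0.
(* The imaginary part of the same complex primitive. *)
pose F x : R := expR (- (e * x)) * ((- (a * cos (a * x)) - e * sin (a * x)) / (e ^+ 2 + a ^+ 2)).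
apply: (etrans (@FTC_oy R (fun x => expR (- (e * x)) * sin (a * x)) F 0
  (- (a / (e ^+ 2 + a ^+ 2))) 0 _ _ _ _ _)); last by rewrite sub0r opprK.
- move=> x _; apply: is_derive_eq.
  rewrite /GRing.scale/= !mulr1 ?mul1r; field.
  by rewrite gt_eqF.
- move=> x _; apply: cvgM; [exact: continuous_expNM|exact: continuous_sin_mul].
- by apply: integrable_mul_sin => //; have [] := integrable_expNM e0.
- have -> : - (a / (e ^+ 2 + a ^+ 2)) = F 0.
    by rewrite /F !mulr0 oppr0 expR0 cos0 sin0 mul1r mulr0 subr0 mulr1 mulNr.
  apply: cvg_at_right_filter; apply: cvgM; first exact: continuous_expNM.
  apply: cvgMr_tmp; apply: cvgB; [apply: cvgN|]; apply: cvgMl_tmp.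
    exact: continuous_cos_mul.
  exact: continuous_sin_mul.
- apply: (@cvgy_expNM _ ((`|a| + e) / (e ^+ 2 + a ^+ 2))) => // x _.
  rewrite normrM normfV (gtr0_norm d0) ler_pM2r ?invr_gt0//.
  rewrite (le_trans (ler_normB _ _))// lerD// ?normrN normrM.
    by rewrite ler_piMr ?norm_cos_le1.
  by rewrite (gtr0_norm e0) ler_piMr ?norm_sin_le1// ltW.
Qed.

Lemma cvgy_atanM c : 0 < c -> atan (c * x) @[x --> +oo] --> (pi / 2 : R).
Proof.
move=> c0; apply: (@cvg_comp _ _ _ (fun x : R => c * x) atan _ +oo); last exact: cvgy_atan.
by apply/cvgryPge => A; near=> x; rewrite mulrC -ler_pdivrMr.
Unshelve. all: by end_near. Qed.

Lemma integrable_inv1D2 : L1 P (fun x => (1 + x ^+ 2)^-1).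
Proof.
have [||||] := @FTC_oy_ge0 R (fun x => (1 + x ^+ 2)^-1) atan 0 0 (pi / 2).
- move=> x _; apply: continuous_comp; last first.
    by apply: inv_continuous; rewrite gt_eqF// ltr_pwDl// sqr_ge0.
  by apply: cvgD; [exact: cvg_cst|exact: exprn_continuous].
- by move=> x _; rewrite invr_ge0 addr_ge0// sqr_ge0.
- by rewrite -[X in _ --> X]atan0; apply: cvg_at_right_filter; exact: continuous_atan.
- exact: cvgy_atan.
- by [].
Qed.

End laplace.

(** * Inversion of the cosine transform by Abel summation *)

Section inversion.
Context {R : realType}.
Notation mu := (@lebesgue_measure R).
Notation P := (pos_line R).
Notation L1 A f := (mu.-integrable A (EFin \o f)).
Implicit Types (f g F m U : R -> R) (x y e c : R).

Lemma is_derive_continuous f (x df : R) : is_derive x 1 f df -> {for x, continuous f}.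
Proof.
by move=> dfx; apply: differentiable_continuous; apply/derivable1_diffP; have [] := dfx.
Qed.

(* [U] is the sum of a test function and of its reflection, restricted to the half line. *)
Record even_profile (U U1 U2 : R -> R) : Prop := EvenProfile {
  profile_derive : forall y, is_derive y 1 U (U1 y);
  profile_derive1 : forall y, is_derive y 1 U1 (U2 y);
  profile_continuous2 : continuous U2;
  profile_flat : U1 0 = 0;
  profile_integrable : L1 P U;
  profile_integrable1 : L1 P U1;
  profile_integrable2 : L1 P U2;
  profile_cvg : U y @[y --> +oo] --> 0;
  profile_cvg1 : U1 y @[y --> +oo] --> 0 }.

Lemma cvgy0_mul_bounded f g c : f y @[y --> +oo] --> 0 -> (forall y, `|g y| <= c) ->
  f y * g y @[y --> +oo] --> 0.
Proof.
move=> /cvgrPdist_le f0 gc; apply/cvgrPdist_le => /= e e0.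
have c0 : 0 < c + 1 by rewrite (@le_lt_trans _ _ c) ?ltrDl// (le_trans _ (gc 0)).
have [|M [Mr HM]] := f0 (e / (c + 1)); first by rewrite divr_gt0.
exists M; split => // x /HM /=; rewrite !sub0r !normrN normrM => fx.
apply: (@le_trans _ _ (e / (c + 1) * (c + 1))); last by rewrite divfK ?gt_eqF.
by apply: ler_pM => //; rewrite (le_trans (gc x))// lerDl.
Qed.

(** Integration by parts on [U y * sin (x * y)]: the sine removes the boundary term at [0], whatever
    the value of [U 0]. *)
Lemma mul_cos_tr U U1 x : (forall y, is_derive y 1 U (U1 y)) -> continuous U1 ->
  L1 P U -> L1 P U1 -> U y @[y --> +oo] --> 0 -> x * cos_tr U x = - sin_tr U1 x.
Proof.
move=> dU cU1 iU iU1 Uy.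
pose f y := U1 y * sin (x * y) + x * (U y * cos (x * y)).
have i1 : L1 P (fun y => U1 y * sin (x * y)) by exact: integrable_mul_sin.
have i2 : L1 P (fun y => x * (U y * cos (x * y))).
  by apply: integrable_scale => //; exact: integrable_mul_cos.
have : \int[mu]_(y in P) f y = 0 - 0.
  apply: (@FTC_oy R f (fun y => U y * sin (x * y)) 0 0 0).
  - move=> y _; have dUy := dU y; apply: is_derive_eq.
    by rewrite /GRing.scale/= /f mulr1; ring.
  - move=> y _; apply: cvgD; last apply: cvgMl_tmp; apply: cvgM.
    + exact: cU1.
    + exact: continuous_sin_mul.
    + exact: is_derive_continuous.
    + exact: continuous_cos_mul.
  - exact: integrable_sum.
  - rewrite [X in _ --> X](_ : _ = U 0 * sin (x * 0)); last by rewrite mulr0 sin0 mulr0.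
    apply: cvg_at_right_filter; apply: cvgM.
    + exact: is_derive_continuous.
    + exact: continuous_sin_mul.
  - by apply: (cvgy0_mul_bounded (c := 1)) => // y; exact: norm_sin_le1.
rewrite subrr RintegralD// RintegralZl//; last exact: integrable_mul_cos.
by rewrite addrC => /eqP; rewrite addr_eq0 => /eqP.
Qed.

(** Here the cosine does not vanish at [0]; the boundary term is removed by [U1 0 = 0], which holds
    for odd functions. *)
Lemma mul_sin_tr U1 U2 x : (forall y, is_derive y 1 U1 (U2 y)) -> continuous U2 ->
  U1 0 = 0 -> L1 P U1 -> L1 P U2 -> U1 y @[y --> +oo] --> 0 ->
  x * sin_tr U1 x = cos_tr U2 x.
Proof.
move=> dU1 cU2 U10 iU1 iU2 U1y.
pose f y := U2 y * cos (x * y) - x * (U1 y * sin (x * y)).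
have i1 : L1 P (fun y => U2 y * cos (x * y)) by exact: integrable_mul_cos.
have i2 : L1 P (fun y => x * (U1 y * sin (x * y))).
  by apply: integrable_scale => //; exact: integrable_mul_sin.
have : \int[mu]_(y in P) f y = 0 - 0.
  apply: (@FTC_oy R f (fun y => U1 y * cos (x * y)) 0 0 0).
  - move=> y _; have dUy := dU1 y; apply: is_derive_eq.
    by rewrite /GRing.scale/= /f mulr1; ring.
  - move=> y _; apply: cvgB; last apply: cvgMl_tmp; apply: cvgM.
    + exact: cU2.
    + exact: continuous_cos_mul.
    + exact: is_derive_continuous.
    + exact: continuous_sin_mul.
  - exact: integrable_diff.
  - rewrite [X in _ --> X](_ : _ = U1 0 * cos (x * 0)); last by rewrite U10 mul0r.
    apply: cvg_at_right_filter; apply: cvgM.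
    + exact: is_derive_continuous.
    + exact: continuous_cos_mul.
  - by apply: (cvgy0_mul_bounded (c := 1)) => // y; exact: norm_cos_le1.
rewrite subrr RintegralB// RintegralZl//; last exact: integrable_mul_sin.
by move=> /eqP; rewrite subr_eq0 => /eqP.
Qed.

Lemma profile_sin_tr U U1 U2 x : even_profile U U1 U2 -> x * cos_tr U x = - sin_tr U1 x.
Proof.
move=> [dU dU1 _ _ iU iU1 _ Uy _]; apply: mul_cos_tr => // y.
exact: is_derive_continuous.
Qed.

Lemma profile_cos_tr U U1 U2 x : even_profile U U1 U2 -> x * sin_tr U1 x = cos_tr U2 x.
Proof. by move=> [_ dU1 cU2 U10 _ iU1 iU2 _ U1y]; exact: mul_sin_tr. Qed.

(** Two integrations by parts give [x^2 * cos_tr U x = - cos_tr U2 x]; the trivial bound on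
    [cos_tr U] is added to cover small [x]. *)
Lemma cos_tr_profile_decay U U1 U2 : even_profile U U1 U2 ->
  exists2 C, 0 <= C & forall x, `|cos_tr U x| <= C * (1 + x ^+ 2)^-1.
Proof.
move=> pU; have [dU dU1 cU2 U10 iU iU1 iU2 Uy U1y] := pU.
exists (\int[mu]_(y in P) `|U y| + \int[mu]_(y in P) `|U2 y|).
  by rewrite addr_ge0// Rintegral_ge0.
move=> x; have x0 : 0 < 1 + x ^+ 2 by rewrite ltr_pwDl// sqr_ge0.
rewrite ler_pdivlMr// -(ger0_norm (ltW x0)) -normrM mulrDr mulr1.
rewrite (le_trans (ler_normD _ _))// lerD//; first exact: cos_tr_bound.
rewrite (_ : cos_tr U x * x ^+ 2 = - cos_tr U2 x) ?normrN ?cos_tr_bound//.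
by rewrite -(profile_cos_tr _ pU) -mulrN -(profile_sin_tr _ pU); ring.
Qed.

Lemma integrable_cos_tr_profile U U1 U2 : even_profile U U1 U2 -> L1 P (cos_tr U).
Proof.
move=> pU; have [C C0 HC] := cos_tr_profile_decay pU.
apply: (@integrable_le _ _ _ (fun x => C * (1 + x ^+ 2)^-1)) => //.
  apply: continuous_pos_measurable => x _; apply: continuous_cos_tr.
  exact: profile_integrable pU.
by apply: integrable_scale => //; exact: integrable_inv1D2.
Qed.

(** [dQ] is the Poisson kernel at height [e], symmetrized in [x]: the Laplace transform at [e] of
    [cos (x t) * cos (t y)] in [t]. [Q] is its primitive in [y] that vanishes at [0]. As [e] tends
    to [0], [Q] stays bounded and tends on the half line to [pi / 2] times the indicator of [y > x],
    except at [y = x]. *)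
Let Q e x y := 2^-1 * (atan ((y - x) / e) + atan ((y + x) / e)).
Let dQ e x y := 2^-1 * (e / (e ^+ 2 + (y - x) ^+ 2) + e / (e ^+ 2 + (y + x) ^+ 2)).

Let is_derive_Q e x y : 0 < e -> is_derive y 1 (Q e x) (dQ e x y).
Proof.
move=> e0; apply: is_derive_eq.
have e1 := lt0r_neq0 e0.
have d1 := lt0r_neq0 (den_gt0 (y - x) e0).
have d2 := lt0r_neq0 (den_gt0 (y + x) e0).
rewrite /dQ /GRing.scale/= !(mulr1, addr0, mulr0); field.
by rewrite e1/= d1 d2.
Qed.

Lemma cvg_atan_sg (a : R) : atan (a * n.+1%:R) @[n --> \oo] --> pi / 2 * Num.sg a.
Proof.
have pos (b : R) : 0 < b -> atan (b * n.+1%:R) @[n --> \oo] --> (pi / 2 : R).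
  move=> b0; have /cvg_pinftyP := cvgy_atanM b0; apply.
  apply/cvgryPge => A; near=> n; apply: (@le_trans _ _ n%:R); last by rewrite ler_nat.
  by near: n; exact: nbhs_infty_ger.
have [a0|a0|->] := ltgtP a 0.
- rewrite ltr0_sg// mulrN1; have -> : (fun n => atan (a * n.+1%:R)) =
    (fun n => - atan ((- a) * n.+1%:R)) by apply/funext => n; rewrite mulNr atanN opprK.
  by apply: cvgN; apply: pos; rewrite oppr_gt0.
- by rewrite gtr0_sg// mulr1; exact: pos.
- rewrite sgr0 mulr0; under eq_fun do rewrite mul0r atan0; exact: cvg_cst.
Unshelve. all: by end_near. Qed.

Let cvg_Q x y : 0 < x -> 0 < y -> Q n.+1%:R^-1 x y @[n --> \oo] -->
   pi / 4 * (Num.sg (y - x) + 1).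
Proof.
move=> x0 y0; rewrite /Q.
rewrite [X in _ --> X](_ : _ = 2^-1 * (pi / 2 * Num.sg (y - x) + pi / 2 * Num.sg (y + x))).
  by under eq_fun do rewrite invrK; apply: cvgMl_tmp; apply: cvgD; exact: cvg_atan_sg.
by rewrite (gtr0_sg (addr_gt0 y0 x0)); lra.
Qed.

Lemma norm_atan_le (x : R) : `|atan x| <= pi / 2.
Proof. by rewrite ler_norml ltW ?atan_gtNpi2//= ltW ?atan_ltpi2. Qed.

Let Q_bound e x y : `|Q e x y| <= pi / 2.
Proof.
rewrite /Q normrM ger0_norm// ler_pdivrMl// mulr_natl mulr2n.
by rewrite (le_trans (ler_normD _ _))// lerD// norm_atan_le.
Qed.

Let measurable_Q e x : measurable_fun setT (Q e x).
Proof.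
apply: continuous_measurable_fun => y; apply: cvgMl_tmp.
apply: cvgD; (apply: continuous_comp; last exact: continuous_atan); apply: cvgMr_tmp.
  by apply: cvgB => //; exact: cvg_cst.
by apply: cvgD => //; exact: cvg_cst.
Qed.

Let den_neq0 e (a : R) : 0 < e -> e ^+ 2 + a ^+ 2 != 0.
Proof. by move=> /(den_gt0 a)/lt0r_neq0. Qed.

Let continuous_dQ e x : 0 < e -> continuous (dQ e x).
Proof.
move=> e0 y; apply: cvgMl_tmp.
apply: cvgD; apply: cvgMl_tmp; (apply: cvgV; first exact: den_neq0);
  apply: cvgD; (try exact: cvg_cst); apply: (@cvg_comp _ _ _ _ (fun z => z ^+ 2));
  try exact: exprn_continuous.
  by apply: cvgB => //; exact: cvg_cst.
by apply: cvgD => //; exact: cvg_cst.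
Qed.

Let dQ_bound e x y : 0 < e -> `|dQ e x y| <= e^-1.
Proof.
move=> e0.
have H a : 0 <= e / (e ^+ 2 + a ^+ 2) <= e^-1.
  have d0 := den_gt0 a e0; apply/andP; split; first by rewrite divr_ge0 ?ltW.
  rewrite ler_pdivrMr//; by rewrite mulrDr expr2 mulKf ?gt_eqF// lerDl mulr_ge0 ?sqr_ge0// invr_ge0 ltW.
have /andP[a1 a2] := H (y - x); have /andP[b1 b2] := H (y + x).
by rewrite ger0_norm /dQ; lra.
Qed.

(** Integration by parts trades the kernel [dQ], which concentrates at [y = x], for its primitive
    [Q], to which dominated convergence applies as [e] tends to [0]. The boundary terms vanish
    because [Q] is [0] at [y = 0] and [U] tends to [0] at infinity. *)
Let abel_regularized e x U U1 U2 : even_profile U U1 U2 -> 0 < x -> 0 < e ->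
  \int[mu]_(t in P) (expR (- (e * t)) * (cos_tr U t * cos (t * x))) =
  - \int[mu]_(y in P) (U1 y * Q e x y).
Proof.
move=> [dU dU1 cU2 U10 iU iU1 iU2 Uy U1y] x0 e0.
have [ie _] := integrable_expNM e0.
have cU (y : R) : {for y, continuous U} by exact: is_derive_continuous.
have cU1 (y : R) : {for y, continuous U1} by exact: is_derive_continuous.
have iQ : L1 P (fun y => U1 y * Q e x y).
  apply: (@integrable_le _ _ _ (fun y => pi / 2 * `|U1 y|)) => //.
  - apply: measurable_funM; first exact: integrable_measurable iU1.
    exact: measurable_funTS.
  - by apply: integrable_scale => //; exact: integrable_norm.
  - by move=> y _; rewrite normrM mulrC ler_wpM2r.
have idQ : L1 P (fun y => U y * dQ e x y).
  apply: (@integrable_le _ _ _ (fun y => e^-1 * `|U y|)) => //.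
  - apply: measurable_funM; first exact: integrable_measurable iU.
    by apply: measurable_funTS; apply: continuous_measurable_fun; exact: continuous_dQ.
  - by apply: integrable_scale => //; exact: integrable_norm.
  - by move=> y _; rewrite normrM mulrC ler_wpM2r// dQ_bound.
transitivity (\int[mu]_(y in P) (U y * dQ e x y)).
  transitivity (\int[mu]_(t in P) (expR (- (e * t)) *
      \int[mu]_(y in P) (U y * (cos (x * t) * cos (t * y))))).
    apply: integral_eq => t _; congr (_ * _).
    rewrite mulrC (mulrC t x) -RintegralZl//; last exact: integrable_mul_cos.
    by apply: integral_eq => y _; ring.
  rewrite (@Fubini_kernel _ _ _ _ _ (fun z => cos (x * z.1) * cos (z.1 * z.2)))//; first last.
  - move=> z /=; rewrite normrM -[leRHS]mulr1.
    by apply: ler_pM => //; exact: norm_cos_le1.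
  - apply: measurable_funM; (apply: measurableT_comp;
      first by apply: continuous_measurable_fun; exact: continuous_cos).
      by apply: measurable_funM => //; exact: measurable_fst.
    by apply: measurable_funM; [exact: measurable_fst|exact: measurable_snd].
  apply: integral_eq => y _; congr (_ * _); rewrite /dQ.
  rewrite -laplace_cos// -laplace_cos// -RintegralD//; [|exact: integrable_mul_cos..].
  rewrite -RintegralZl//; last by apply: integrable_sum => //; exact: integrable_mul_cos.
  apply: integral_eq => t _; rewrite (mulrC t y) !mulrBl !mulrDl cosB cosD.
  by field.
apply/eqP; rewrite -addr_eq0 -RintegralD//; apply/eqP.
apply: (etrans (@FTC_oy R _ (fun y => U y * Q e x y) 0 0 0 _ _ _ _ _)); last exact: subrr.
- move=> y _; have dUy := dU y; have dQy := is_derive_Q x y e0; apply: is_derive_eq.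
  by rewrite /GRing.scale/=; ring.
- move=> y _; apply: cvgD; apply: cvgM;
    [exact: cU|exact: continuous_dQ|exact: cU1|exact: is_derive_continuous (is_derive_Q x y e0)].
- exact: (integrable_sum (@measurable_pos_line R) idQ iQ).
- rewrite [X in _ --> X](_ : _ = U 0 * Q e x 0); last first.
    by rewrite /Q !add0r mulNr atanN addNr !mulr0.
  apply: cvg_at_right_filter; apply: cvgM; first exact: cU.
  exact: is_derive_continuous (is_derive_Q x 0 e0).
- exact: (cvgy0_mul_bounded (c := pi / 2)).
Qed.

(** The step function vanishes below [x] and is [pi / 2] above it, so only the integral of [U1] from
    [x] to infinity survives. *)
Let integral_sg_step U U1 U2 x : even_profile U U1 U2 -> 0 < x ->
  L1 P (fun y => U1 y * (pi / 4 * (Num.sg (y - x) + 1))) ->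
  \int[mu]_(y in P) (U1 y * (pi / 4 * (Num.sg (y - x) + 1))) = - (pi / 2 * U x).
Proof.
move=> [dU dU1 cU2 U10 iU iU1 iU2 Uy U1y] x0 fi.
pose f y := U1 y * (pi / 4 * (Num.sg (y - x) + 1)).
have PE : P = `]0, x] `|` `]x, +oo[.
  apply/seteqP; split=> y /=; rewrite !in_itv/= !andbT.
    by move=> ->; have [yx|xy] := leP y x; [left|right].
  by case=> [/andP[]//|]; exact: lt_trans.
have f0 : \int[mu]_(y in `]0, x]) f y = 0.
  rewrite -Rintegral_itv_bndo_bndc.
    transitivity (\int[mu]_(y in `]0, x[) (0 : R)).
      apply: integral_eq => y /=; rewrite in_itv/= => /andP[_ yx].
      by rewrite /f ltr0_sg ?subr_lt0// addNr !mulr0.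
    by rewrite /Rintegral integral0.
  apply: integrableS fi => //; rewrite PE => y /=; rewrite !in_itv/= => /andP[-> /ltW ->].
  by left.
have fE : \int[mu]_(y in `]x, +oo[) f y = pi / 2 * (0 - U x).
  transitivity (\int[mu]_(y in `]x, +oo[) (pi / 2 * U1 y)).
    apply: integral_eq => y /=; rewrite in_itv/= andbT => xy.
    by rewrite /f gtr0_sg ?subr_gt0//; field.
  rewrite RintegralZl//; last by apply: integrableS iU1 => //; rewrite PE; right.
  congr (_ * _); apply: (@FTC_oy R _ U) => //.
  - by move=> y _; exact: is_derive_continuous.
  - by apply: integrableS iU1 => //; rewrite PE; right.
  - by apply: cvg_at_right_filter; exact: is_derive_continuous.
rewrite -/f PE Rintegral_setU//; last 2 first.
  by rewrite -PE.
  apply/disj_setPS => y [] /=; rewrite !in_itv/= => /andP[_ yx]; rewrite andbT.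
  by rewrite ltNge yx.
by rewrite f0 fE add0r sub0r mulrN.
Qed.

(** Both sides of [abel_regularized] have limits by dominated convergence, with majorants
    [|cos_tr U|] on the left and [pi / 2 * |U1|] on the right. *)
Lemma cos_inversion U U1 U2 x : even_profile U U1 U2 -> 0 < x ->
  \int[mu]_(t in P) (cos_tr U t * cos (t * x)) = pi / 2 * U x.
Proof.
move=> pU x0; have icU := integrable_cos_tr_profile pU.
have iU1 := profile_integrable1 pU.
pose e n : R := n.+1%:R^-1.
have e0 n : 0 < e n by rewrite invr_gt0.
have e_0 : e n @[n --> \oo] --> 0 by exact: cvg_harmonic.
have mcos : measurable_fun P (fun t : R => cos_tr U t * cos (t * x)).
  apply: measurable_funM; first exact: integrable_measurable icU.
  apply: (eq_measurable_fun (fun t => cos (x * t))) => [t _|]; first by rewrite mulrC.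
  exact: measurable_cos_mul.
have [||||_ h1] := @dominated_cvgn R P
  (fun n t => expR (- (e n * t)) * (cos_tr U t * cos (t * x)))
  (fun t => cos_tr U t * cos (t * x)) (fun t => `|cos_tr U t|) (@measurable_pos_line R).
- move=> n; apply: measurable_funM => //; apply: measurable_funTS.
  by apply: continuous_measurable_fun; exact: continuous_expNM.
- move=> t _; rewrite -[X in _ --> X]mul1r; apply: cvgMr_tmp.
  rewrite -expR0; apply: continuous_cvg; first exact: continuous_expR.
  by rewrite -oppr0 -(mul0r t); apply: cvgN; exact: cvgMr_tmp.
- exact: integrable_norm.
- move=> n t; rewrite pos_lineE => t0; rewrite !normrM ger0_norm ?expR_ge0//.
  rewrite -[leRHS]mul1r; apply: ler_pM => //.
    by rewrite -expR0 ler_expR oppr_le0 mulr_ge0// ltW.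
  by rewrite ler_piMr// norm_cos_le1.
have [||||i2 h2] := @dominated_cvgn R P (fun n y => U1 y * Q (e n) x y)
  (fun y => U1 y * (pi / 4 * (Num.sg (y - x) + 1))) (fun y => pi / 2 * `|U1 y|)
  (@measurable_pos_line R).
- move=> n; apply: measurable_funM; first exact: integrable_measurable iU1.
  exact: measurable_funTS.
- by move=> y; rewrite pos_lineE => y0; apply: cvgMl_tmp; exact: cvg_Q.
- by apply: integrable_scale => //; exact: integrable_norm.
- by move=> n y _; rewrite normrM mulrC ler_wpM2r.
rewrite (integral_sg_step pU x0 i2) in h2.
have {}h2 := cvgN h2; rewrite opprK in h2.
have E : (fun n => \int[mu]_(t in P) (expR (- (e n * t)) * (cos_tr U t * cos (t * x)))) =
    (fun n => - \int[mu]_(y in P) (U1 y * Q (e n) x y)).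
  by apply/funext => n; exact: (abel_regularized pU x0 (e0 n)).
rewrite E in h1; exact: (cvg_unique _ h1 (h2 _)).
Qed.

Lemma pairing_profile U U1 U2 m : even_profile U U1 U2 -> L1 P m ->
  \int[mu]_(x in P) (cos_tr m x * cos_tr U x) = pi / 2 * \int[mu]_(y in P) (m y * U y).
Proof.
move=> pU mi; have icU := integrable_cos_tr_profile pU.
transitivity (\int[mu]_(x in P) (cos_tr U x * \int[mu]_(y in P) (m y * cos (x * y)))).
  by apply: integral_eq => x _; rewrite mulrC.
rewrite (@Fubini_kernel _ _ _ _ _ (fun z => cos (z.1 * z.2)))//; first last.
- by move=> z; exact: norm_cos_le1.
- apply: measurableT_comp; first by apply: continuous_measurable_fun; exact: continuous_cos.
  by apply: measurable_funM; [exact: measurable_fst|exact: measurable_snd].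
transitivity (\int[mu]_(y in P) (pi / 2 * (m y * U y))).
  apply: integral_eq => y; rewrite pos_lineE => y0 /=.
  by rewrite (cos_inversion pU y0); ring.
rewrite RintegralZl//.
have [mc ic] := (integrable_measurable mi, integrable_norm (@measurable_pos_line R) icU).
apply: (@integrable_le _ _ _ (fun y => (2 / pi * \int[mu]_(x in P) `|cos_tr U x|) * `|m y|)) => //.
- by apply: measurable_funM => //; exact: integrable_measurable (profile_integrable pU).
- by apply: integrable_scale => //; exact: integrable_norm.
move=> y; rewrite pos_lineE => y0; rewrite normrM mulrC ler_wpM2r//.
(* A bound on [U] is not a field of [even_profile]; inversion supplies one in terms of the integral
   of [|cos_tr U|]. *)
have -> : U y = 2 / pi * \int[mu]_(t in P) (cos_tr U t * cos (t * y)).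
  have cancel (p z : R) : 0 < p -> z = 2 / p * (p / 2 * z).
    by move=> p0; field; rewrite gt_eqF.
  by rewrite (cos_inversion pU y0); apply: cancel; exact: pi_gt0.
rewrite normrM ger0_norm ?divr_ge0 ?pi_ge0// ler_wpM2l ?divr_ge0 ?pi_ge0//.
apply: le_integral_bound => //.
  apply: measurable_funM; first exact: integrable_measurable icU.
  apply: (eq_measurable_fun (fun t => cos (y * t))) => [t _|]; first by rewrite mulrC.
  exact: measurable_cos_mul.
by move=> t _; rewrite normrM ler_piMr// norm_cos_le1.
Qed.

End inversion.

(** * Integrals over the half line in closed form *)

Section half_line_integrals.
Context {R : realType}.
Notation mu := (@lebesgue_measure R).
Notation P := (pos_line R).
Notation L1 A f := (mu.-integrable A (EFin \o f)).
Implicit Types (f g F m : R -> R) (x y e c a b : R).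

(** The common majorant of the file: [x^(-1/2)] at [0] and [x^(-3/2)] at infinity. Its integral
    [pi / sqrt b] depends on [b] explicitly, and this is what produces both the exponent [1/2] of
    the Hölder estimate and the rate [sqrt e] of the damping error. *)
Definition sqrt_weight b x : R := (Num.sqrt x)^-1 * (1 + b * x)^-1.

Lemma continuous_inv_sqrt x : 0 < x -> {for x, continuous (fun x => (Num.sqrt x)^-1)}.
Proof.
move=> x0; apply: cvgV; first by rewrite gt_eqF// sqrtr_gt0.
exact: sqrt_continuous.
Qed.

Lemma cvgy_sqrtr : Num.sqrt (x : R) @[x --> +oo] --> +oo.
Proof.
apply/cvgryPge => A; near=> x.
have A0 : A <= `|A| by exact: ler_norm.
rewrite (le_trans A0)// -sqrtr_sqr ler_wsqrtr//.
Unshelve. all: by end_near. Qed.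

Lemma integrable_sqrt_weight b : 0 < b ->
  L1 P (sqrt_weight b) /\ \int[mu]_(x in P) sqrt_weight b x = pi / Num.sqrt b.
Proof.
move=> b0; have sb : 0 < Num.sqrt b by rewrite sqrtr_gt0.
pose F x := 2 / Num.sqrt b * atan (Num.sqrt b * Num.sqrt x).
have [|||||fi ->] := @FTC_oy_ge0 R (sqrt_weight b) F 0 0 (2 / Num.sqrt b * (pi / 2)).
- move=> x x0; have dx := is_derive1_sqrt x0; apply: is_derive_eq.
  have sx : 0 < Num.sqrt x by rewrite sqrtr_gt0.
  have d0 : 0 < 1 + b * x by rewrite addr_gt0// mulr_gt0.
  rewrite /GRing.scale/= exprMn !sqr_sqrtr ?ltW// /sqrt_weight; field.
  by rewrite !gt_eqF.
- move=> x x0; apply: cvgM; first exact: continuous_inv_sqrt.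
  apply: cvgV; first by rewrite gt_eqF// addr_gt0// mulr_gt0.
  by apply: cvgD; [exact: cvg_cst|exact: mulrl_continuous].
- move=> x x0; rewrite /sqrt_weight mulr_ge0// invr_ge0.
  by rewrite addr_ge0// mulr_ge0 ?ltW.
- rewrite [X in _ --> X](_ : _ = F 0); last by rewrite /F sqrtr0 mulr0 atan0 mulr0.
  apply: cvg_at_right_filter; apply: cvgMl_tmp.
  apply: continuous_cvg; first exact: continuous_atan.
  by apply: cvgMl_tmp; exact: sqrt_continuous.
- apply: cvgMl_tmp; apply: (@cvg_comp _ _ _ Num.sqrt (fun y => atan (Num.sqrt b * y)) _ +oo).
    exact: cvgy_sqrtr.
  exact: cvgy_atanM.
- by split => //; field; rewrite gt_eqF.
Qed.

Lemma integrable_inv_sqrD c : 0 < c ->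
  L1 P (fun w => (w ^+ 2 + c)^-1) /\
  \int[mu]_(w in P) (w ^+ 2 + c)^-1 = pi / (2 * Num.sqrt c).
Proof.
move=> c0; have sc : 0 < Num.sqrt c by rewrite sqrtr_gt0.
have d0 (w : R) : 0 < w ^+ 2 + c by rewrite ltr_wpDl// sqr_ge0.
pose F w := (Num.sqrt c)^-1 * atan ((Num.sqrt c)^-1 * w).
have [|||||fi ->] := @FTC_oy_ge0 R (fun w => (w ^+ 2 + c)^-1) F 0 0 ((Num.sqrt c)^-1 * (pi / 2)).
- move=> w w0; apply: is_derive_eq.
  rewrite /GRing.scale/= exprMn exprVn sqr_sqrtr ?ltW//.
  rewrite mulr1 mulrCA -expr2 exprVn sqr_sqrtr ?ltW//; field.
  by rewrite !gt_eqF// addrC.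
- move=> w w0; apply: cvgV; first by rewrite gt_eqF.
  by apply: cvgD; [exact: exprn_continuous|exact: cvg_cst].
- by move=> w w0; rewrite invr_ge0 ltW.
- rewrite [X in _ --> X](_ : _ = F 0); last by rewrite /F mulr0 atan0 mulr0.
  apply: cvg_at_right_filter; apply: cvgMl_tmp.
  apply: continuous_cvg; first exact: continuous_atan.
  exact: mulrl_continuous.
- by apply: cvgMl_tmp; apply: cvgy_atanM; rewrite invr_gt0.
- by split => //; field; rewrite gt_eqF.
Qed.

(** The denominator factors as [(w^2 - a w + a^2 / 2) (w^2 + a w + a^2 / 2)], which leads to the
    logarithms and arctangents of [F]. At infinity the logarithms cancel and each arctangent
    contributes [pi / 2]. *)
Lemma integral_quartic a : 0 < a ->
  \int[mu]_(w in P) (w ^+ 2 / (w ^+ 4 + a ^+ 4 / 4)) = pi / (2 * a).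
Proof.
move=> a0.
pose p s w : R := w ^+ 2 + s * a * w + a ^+ 2 / 2.
have p_gt0 s w : s ^+ 2 = 1 -> 0 < p s w.
  move=> s1; rewrite (_ : p s w = (w + s * a / 2) ^+ 2 + a ^+ 2 / 4).
    by rewrite ltr_wpDl ?sqr_ge0// divr_gt0// exprn_gt0.
  by rewrite sqrrD !exprMn s1 /p; field.
have pN w : 0 < p (- 1) w by apply: p_gt0; rewrite sqrrN expr1n.
have pP w : 0 < p 1 w by apply: p_gt0; rewrite expr1n.
have dE w : w ^+ 4 + a ^+ 4 / 4 = p (-1) w * p 1 w by rewrite /p; field.
pose F w := (4 * a)^-1 * (ln (p (-1) w) - ln (p 1 w)) +
  (2 * a)^-1 * (atan (2 / a * w - 1) + atan (2 / a * w + 1)).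
have [|||||_ ->] := @FTC_oy_ge0 R (fun w => w ^+ 2 / (w ^+ 4 + a ^+ 4 / 4)) F 0 0
  ((4 * a)^-1 * 0 + (2 * a)^-1 * (pi / 2 + pi / 2)).
- move=> w w0; have dN := is_derive1_ln (pN w); have dP := is_derive1_ln (pP w).
  have dpN : is_derive w 1 (p (-1)) (2 * w - a).
    by rewrite /p; apply: is_derive_eq; rewrite /GRing.scale/=; ring.
  have dpP : is_derive w 1 (p 1) (2 * w + a).
    by rewrite /p; apply: is_derive_eq; rewrite /GRing.scale/=; ring.
  apply: is_derive_eq; rewrite dE /GRing.scale/=.
  have -> : 1 + (2 / a * w - 1) ^+ 2 = 4 / a ^+ 2 * p (-1) w.
    by rewrite /p; field; rewrite gt_eqF.
  have -> : 1 + (2 / a * w + 1) ^+ 2 = 4 / a ^+ 2 * p 1 w.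
    by rewrite /p; field; rewrite gt_eqF.
  have h1 : (w ^+ 2 + a * w) * 2 + a ^+ 2 != 0.
    rewrite (_ : _ + _ = 2 * p 1 w) ?mulf_neq0 ?gt_eqF//.
    by rewrite /p; field.
  have h2 : (w ^+ 2 + -1 * a * w) * 2 + a ^+ 2 != 0.
    rewrite (_ : _ + _ = 2 * p (-1) w) ?mulf_neq0 ?gt_eqF//.
    by rewrite /p; field.
  by rewrite /p; field; rewrite h1 h2 gt_eqF.
- move=> w w0; apply: cvgM; first exact: exprn_continuous.
  apply: cvgV; first by rewrite dE gt_eqF// mulr_gt0.
  by apply: cvgD; [exact: exprn_continuous|exact: cvg_cst].
- by move=> w w0; rewrite dE divr_ge0 ?sqr_ge0// mulr_ge0 ?ltW.
- rewrite [X in _ --> X](_ : _ = F 0); last first.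
    rewrite /F /p !mulr0 !addr0 subrr mulr0 !add0r atanN addNr mulr0//.
  have cp s : {for 0, continuous (p s)}.
    apply: cvgD; last exact: cvg_cst.
    by apply: cvgD; [exact: exprn_continuous|exact: mulrl_continuous].
  have cw : {for 0, continuous (fun w => 2 / a * w)} by exact: mulrl_continuous.
  apply: cvg_at_right_filter; apply: cvgD; apply: cvgMl_tmp.
    apply: cvgB; (apply: continuous_cvg; [exact: continuous_ln|exact: cp]).
  apply: cvgD; (apply: continuous_cvg; first exact: continuous_atan).
    by apply: cvgB => //; exact: cvg_cst.
  by apply: cvgD => //; exact: cvg_cst.
- apply: cvgD; apply: cvgMl_tmp.
    have -> : (fun w => ln (p (-1) w) - ln (p 1 w)) = (fun w => ln (p (-1) w / p 1 w)).
      by apply/funext => w; rewrite ln_div ?posrE.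
    rewrite -ln1; apply: continuous_cvg; first exact: continuous_ln.
    rewrite -[X in _ --> X]subr0.
    have -> : (fun w => p (-1) w / p 1 w) = (fun w => 1 - 2 * a * w / p 1 w).
      apply/funext => w; have h := lt0r_neq0 (pP w).
      by apply: (mulIf h); rewrite mulrBl mul1r !divfK// /p; ring.
    apply: cvgB; first exact: cvg_cst.
    apply: (@cvgy0_le_inv _ _ (2 * a)) => x x1.
    have x0 : 0 < x by exact: lt_le_trans x1.
    rewrite ger0_norm; last by rewrite divr_ge0 ?ltW// !mulr_gt0.
    rewrite ler_pdivrMr// -!mulrA ler_wpM2l//.
    rewrite ler_pM2l// ler_pdivlMl// /p -expr2 mul1r -addrA lerDl addr_ge0//.
      by rewrite mulr_ge0 ?ltW.
    by rewrite divr_ge0// sqr_ge0.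
  have a2 : 0 < 2 / a by rewrite divr_gt0.
  have H c : atan (2 / a * w + c) @[w --> +oo] --> (pi / 2 : R).
    apply: (@cvg_comp _ _ _ (fun w : R => 2 / a * w + c) atan _ +oo); last exact: cvgy_atan.
    by apply/cvgryPge => A; near=> w; rewrite -lerBlDr mulrC -ler_pdivrMr.
  by apply: cvgD; exact: H.
- by field; rewrite gt_eqF.
Unshelve. all: by end_near. Qed.

Lemma integral_gauss_scaled x : 0 < x ->
  L1 P (fun w => expR (- (w ^+ 2 * x))) /\
  \int[mu]_(w in P) expR (- (w ^+ 2 * x)) = Num.sqrt pi / 2 * (Num.sqrt x)^-1.
Proof.
move=> x0; have sx : 0 < Num.sqrt x by rewrite sqrtr_gt0.
have h : (\int[mu]_(w in `[0%R, +oo[) (Num.sqrt x * expR (- (w ^+ 2 * x)))%:E =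
    (Num.sqrt pi / 2)%:E)%E.
  pose F (w : R) := Num.sqrt x * w.
  have F'E : derive1 F = cst (Num.sqrt x).
    apply/funext => w; rewrite derive1E.
    have dF : is_derive w 1 F (Num.sqrt x).
      by apply: is_derive_eq; rewrite /GRing.scale/= mulr1.
    by rewrite derive_val.
  rewrite -integral0y_gauss (_ : `[0, +oo[%classic = `[F 0, +oo[%classic); last first.
    by rewrite /F mulr0.
  rewrite [RHS]increasing_ge0_integration_by_substitutiony ?F'E.
  - rewrite {1}/F mulr0; apply: eq_integral => w _ /=; congr EFin.
    transitivity (expR (- (Num.sqrt x * w) ^+ 2) * Num.sqrt x) => //.
    by rewrite exprMn sqr_sqrtr ?ltW// mulrC (mulrC x).
  - by move=> u v _ _ uv; rewrite ltr_pM2l.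
  - by move=> u _; exact: cvg_cst.
  - by apply/cvg_ex; exists (Num.sqrt x); exact: cvg_cst.
  - by apply/cvg_ex; exists (Num.sqrt x); exact: cvg_cst.
  - split; last by apply: cvg_at_right_filter; exact: mulrl_continuous.
    by move=> u _; rewrite /F.
  - by apply/cvgryPge => A; near=> w; rewrite /F mulrC -ler_pdivrMr.
  - by apply: continuous_subspaceT => u; exact: continuous_gauss_fun.
  - by move=> u _; exact: gauss_fun_ge0.
have mg c : measurable_fun P (fun w => c * expR (- (w ^+ 2 * x))).
  apply: measurable_funTS; apply: continuous_measurable_fun => w; apply: cvgMl_tmp.
  apply: continuous_cvg; first exact: continuous_expR.
  by apply: cvgN; apply: cvgMr_tmp; exact: exprn_continuous.
have {}h : (\int[mu]_(w in P) (Num.sqrt x * expR (- (w ^+ 2 * x)))%:E = (Num.sqrt pi / 2)%:E)%E.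
  by rewrite -h integral_itv_obnd_cbnd//; exact/measurable_EFinP.
have si : L1 P (fun w => Num.sqrt x * expR (- (w ^+ 2 * x))).
  apply/integrableP; split; first by apply/measurable_EFinP; exact: mg.
  under eq_integral do rewrite /= ger0_norm ?mulr_ge0 ?expR_ge0//.
  by rewrite h ltry.
have gi : L1 P (fun w => expR (- (w ^+ 2 * x))).
  apply: (integrable_eq (@measurable_pos_line R)
    (integrable_scale (Num.sqrt x)^-1 (@measurable_pos_line R) si)).
  by move=> w _ /=; rewrite mulKf ?gt_eqF.
split => //; apply: (@mulfI _ (Num.sqrt x)); first by rewrite gt_eqF.
rewrite -RintegralZl// /Rintegral h/=; field; rewrite gt_eqF//.
Unshelve. all: by end_near. Qed.

End half_line_integrals.

(** * The cosine transform of [y^(-1/2)] *)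

Section inverse_sqrt_symbol.
Context {R : realType}.
Notation mu := (@lebesgue_measure R).
Notation P := (pos_line R).
Notation L1 A f := (mu.-integrable A (EFin \o f)).
Implicit Types (f g F m U : R -> R) (x y e c a b : R).

Definition sqrt_abel e y : R := (Num.sqrt y)^-1 * expR (- (e * y)).

Lemma measurable_invr : measurable_fun setT (fun x : R => x^-1).
Proof.
rewrite -(setvU [set (0 : R)]); apply/measurable_funU => //.
  by apply: measurableC; exact: measurable_set1.
split; last exact: measurable_fun_set1.
apply: open_continuous_measurable_fun.
  by apply: closed_openC; exact: closed_eq.
by move=> x /set_mem /= /eqP x0; exact: inv_continuous.
Qed.

Lemma measurable_funV A f : measurable_fun A f -> measurable_fun A (fun x => (f x)^-1).
Proof. by move=> mf; apply: measurableT_comp => //; exact: measurable_invr. Qed.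

Lemma measurable_inv_sqrt A : measurable_fun A (fun y : R => (Num.sqrt y)^-1).
Proof.
by apply: measurable_funTS; apply: measurable_funV; apply: continuous_measurable_fun; exact: sqrt_continuous.
Qed.

Lemma measurable_expNM A e : measurable_fun A (fun y : R => expR (- (e * y))).
Proof. by apply: measurable_funTS; apply: continuous_measurable_fun; exact: continuous_expNM. Qed.

Lemma integrable_sqrt_abel e : 0 < e -> L1 P (sqrt_abel e).
Proof.
move=> e0; have [wi _] := integrable_sqrt_weight e0.
apply: (integrable_le _ _ wi) => //.
  by apply: measurable_funM; [exact: measurable_inv_sqrt|exact: measurable_expNM].
move=> x; rewrite pos_lineE => x0; rewrite /sqrt_abel normrM.
rewrite !ger0_norm ?expR_ge0 ?invr_ge0// ler_wpM2l ?invr_ge0//.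
by rewrite expRN lef_pV2 ?posrE ?expR_gt0 ?expR_ge1Dx// addr_gt0 ?mulr_gt0.
Qed.

(** The factor [y^(-1/2)] is [2 / sqrt pi] times the integral of [e^(- w^2 y)] over [w]. After the
    exchange of integrals, [laplace_cos] at [w^2 + e] evaluates the inner one. *)
Lemma cos_tr_sqrt_abel e x : 0 < e ->
  cos_tr (sqrt_abel e) x =
  2 / Num.sqrt pi * \int[mu]_(w in P) ((w ^+ 2 + e) / ((w ^+ 2 + e) ^+ 2 + x ^+ 2)).
Proof.
move=> e0; have sp : 0 < Num.sqrt (pi : R) by rewrite sqrtr_gt0 pi_gt0.
have we (w : R) : 0 < w ^+ 2 + e by rewrite ltr_wpDl ?sqr_ge0.
pose H (z : R * R) := expR (- ((z.2 ^+ 2 + e) * z.1)) * cos (x * z.1).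
have HE y w : H (y, w) = (expR (- (e * y)) * cos (x * y)) * expR (- (w ^+ 2 * y)).
  by rewrite /H/= mulrDl opprD expRD; ring.
have iHw y : 0 < y -> L1 P (fun w => H (y, w)).
  move=> y0; have [gi _] := integral_gauss_scaled y0.
  apply: (integrable_eq (@measurable_pos_line R) (integrable_scale
    (expR (- (e * y)) * cos (x * y)) (@measurable_pos_line R) gi)).
  by move=> w _; rewrite HE.
have mH : measurable_fun setT H.
  apply: measurable_funM.
    apply: measurableT_comp; first by apply: continuous_measurable_fun; exact: continuous_expR.
    apply: measurableT_comp => //; apply: measurable_funM; last exact: measurable_fst.
    by apply: measurable_funD => //; apply: measurable_funX; exact: measurable_snd.
  apply: measurableT_comp; first by apply: continuous_measurable_fun; exact: continuous_cos.
  by apply: measurable_funM => //; exact: measurable_fst.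
have E1 : cos_tr (sqrt_abel e) x =
    2 / Num.sqrt pi * \int[mu]_(y in P) \int[mu]_(w in P) H (y, w).
  rewrite -RintegralZl//; last first.
    have := integrable_mul_cos x (@measurable_pos_line R) (integrable_sqrt_abel e0).
    move=> /(integrable_scale (Num.sqrt pi / 2) (@measurable_pos_line R)) h.
    apply: (integrable_eq (@measurable_pos_line R) h) => y; rewrite pos_lineE => y0.
    have [gi gE] := integral_gauss_scaled y0.
    rewrite (_ : (fun w => H (y, w)) = (fun w => (expR (- (e * y)) * cos (x * y)) * expR (- (w ^+ 2 * y)))).
      by rewrite RintegralZl// gE /sqrt_abel; ring.
    by apply/funext => w; rewrite HE.
  apply: integral_eq => y; rewrite pos_lineE => y0.
  have [gi gE] := integral_gauss_scaled y0.
  rewrite (_ : (fun w => H (y, w)) = (fun w => (expR (- (e * y)) * cos (x * y)) * expR (- (w ^+ 2 * y)))).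
    rewrite RintegralZl// gE /sqrt_abel; field.
    by rewrite !gt_eqF// sqrtr_gt0.
  by apply/funext => w; rewrite HE.
rewrite E1; congr (_ * _).
rewrite (@Fubini_set _ _ _ H (fun y => Num.sqrt pi / 2 * sqrt_abel e y))//.
- by apply: integral_eq => w _; rewrite -laplace_cos.
- by move=> y; rewrite pos_lineE; exact: iHw.
- move=> w _; apply: integrable_mul_cos => //.
  by have [] := integrable_expNM (we w).
- by apply: integrable_scale => //; exact: integrable_sqrt_abel.
move=> y; rewrite pos_lineE => y0; have [gi gE] := integral_gauss_scaled y0.
apply: (@le_trans _ _ (\int[mu]_(w in P) (expR (- (e * y)) * expR (- (w ^+ 2 * y))))).
  apply: le_Rintegral => //.
  - by apply: integrable_norm => //; exact: iHw.
  - exact: integrable_scale.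
  - move=> w _; rewrite HE !normrM !(ger0_norm (expR_ge0 _)) ler_wpM2r ?expR_ge0//.
    by rewrite ler_piMr ?expR_ge0 ?norm_cos_le1.
rewrite RintegralZl// gE le_eqVlt; apply/orP; left; apply/eqP.
by rewrite /sqrt_abel; ring.
Qed.

Let dilated_poisson_le (v x : R) : 0 < v -> 0 < x -> v / (v ^+ 2 + x ^+ 2) <= 2 * (v + x)^-1.
Proof.
move=> v0 x0; have d0 := den_gt0 x v0.
rewrite ler_pdivrMr// mulrAC ler_pdivlMr ?addr_gt0//.
by have := sqr_ge0 (v - x); rewrite !expr2; nra.
Qed.

Let dilated_poisson_bound e x w : 0 <= e -> x != 0 -> 0 < w ->
  `|(w ^+ 2 + e) / ((w ^+ 2 + e) ^+ 2 + x ^+ 2)| <= 2 * (w ^+ 2 + `|x|)^-1.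
Proof.
move=> e0 x0 w0; have w2 : 0 < w ^+ 2 by rewrite exprn_gt0.
have v0 : 0 < w ^+ 2 + e by rewrite ltr_pwDl.
have x1 : 0 < `|x| by rewrite normr_gt0.
rewrite ger0_norm; last by rewrite divr_ge0 ?ltW// den_gt0.
rewrite -(real_normK (num_real x)) (le_trans (dilated_poisson_le v0 x1))//.
have p1 : 0 < w ^+ 2 + `|x| by rewrite addr_gt0.
have p2 : 0 < w ^+ 2 + e + `|x| by rewrite addr_gt0.
by rewrite ler_pM2l// lef_pV2 ?posrE// lerD2r lerDl.
Qed.

Let measurable_dilated_poisson e x :
  measurable_fun P (fun w : R => (w ^+ 2 + e) / ((w ^+ 2 + e) ^+ 2 + x ^+ 2)).
Proof.
have m1 : measurable_fun P (fun w : R => w ^+ 2 + e).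
  by apply: measurable_funD => //; exact: measurable_funX.
apply: measurable_funM => //; apply: measurable_funV.
by apply: measurable_funD => //; exact: measurable_funX.
Qed.

(** Uniformity in [e] is the point: this is the majorant for the limit [e -> 0] in the pairing, and
    it enters the a priori bound from which the decay is bootstrapped. *)
Lemma cos_tr_sqrt_abel_bound e x : 0 < e -> x != 0 ->
  `|cos_tr (sqrt_abel e) x| <= 2 * Num.sqrt pi * (Num.sqrt `|x|)^-1.
Proof.
move=> e0 x0; have sp : 0 < Num.sqrt (pi : R) by rewrite sqrtr_gt0 pi_gt0.
have x1 : 0 < `|x| by rewrite normr_gt0.
have [wi wE] := integrable_inv_sqrD x1.
rewrite cos_tr_sqrt_abel// normrM ger0_norm ?divr_ge0//.
apply: (@le_trans _ _ (2 / Num.sqrt pi * \int[mu]_(w in P) (2 * (w ^+ 2 + `|x|)^-1))).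
  rewrite ler_wpM2l ?divr_ge0//; apply: le_integral_bound => //.
    exact: integrable_scale.
  by move=> w; rewrite pos_lineE => w0; apply: dilated_poisson_bound => //; exact: ltW.
rewrite RintegralZl// wE le_eqVlt; apply/orP; left; apply/eqP.
have H (p q b : R) : 0 < q -> 0 < b -> p = q ^+ 2 -> 2 / q * (2 * (p / (2 * b))) = 2 * q * b^-1.
  by move=> q0 b0 ->; field; rewrite !gt_eqF.
by apply: H => //; rewrite ?sqrtr_gt0 ?sqr_sqrtr ?pi_ge0.
Qed.

Lemma cvg_cos_tr_sqrt_abel x : x != 0 ->
  cos_tr (sqrt_abel n.+1%:R^-1) x @[n --> \oo] --> Num.sqrt pi / Num.sqrt (2 * `|x|).
Proof.
move=> x0; have sp : 0 < Num.sqrt (pi : R) by rewrite sqrtr_gt0 pi_gt0.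
have x1 : 0 < `|x| by rewrite normr_gt0.
have [wi wE] := integrable_inv_sqrD x1.
(* Chosen so that [a^4 / 4 = x^2], the form required by [integral_quartic]. *)
pose a := Num.sqrt (2 * `|x|).
have a0 : 0 < a by rewrite sqrtr_gt0 mulr_gt0.
have a4 : a ^+ 4 / 4 = x ^+ 2.
  rewrite (_ : a ^+ 4 = (a ^+ 2) ^+ 2); last by rewrite -exprM.
  rewrite sqr_sqrtr ?mulr_ge0// exprMn real_normK ?num_real//.
  by field.
have e0 n : 0 < (n.+1%:R^-1 : R) by rewrite invr_gt0.
have -> : (fun n => cos_tr (sqrt_abel n.+1%:R^-1) x) = (fun n => 2 / Num.sqrt pi *
    \int[mu]_(w in P) ((w ^+ 2 + n.+1%:R^-1) / ((w ^+ 2 + n.+1%:R^-1) ^+ 2 + x ^+ 2))).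
  by apply/funext => n; rewrite cos_tr_sqrt_abel.
rewrite [X in _ --> X](_ : _ = 2 / Num.sqrt pi * (pi / (2 * a))); last first.
  have H (p q b : R) : 0 < q -> 0 < b -> p = q ^+ 2 -> q / b = 2 / q * (p / (2 * b)).
    by move=> q0 b0 ->; field; rewrite !gt_eqF.
  by apply: H => //; rewrite sqr_sqrtr ?pi_ge0.
apply: cvgMl_tmp; rewrite -integral_quartic// a4.
have [||||_ h] // := @dominated_cvgn R P
  (fun n w => (w ^+ 2 + n.+1%:R^-1) / ((w ^+ 2 + n.+1%:R^-1) ^+ 2 + x ^+ 2))
  (fun w => w ^+ 2 / (w ^+ 4 + x ^+ 2)) (fun w => 2 * (w ^+ 2 + `|x|)^-1) (@measurable_pos_line R).
- move=> w; rewrite pos_lineE => w0.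
  have c1 : w ^+ 2 + n.+1%:R^-1 @[n --> \oo] --> w ^+ 2.
    rewrite -[X in _ --> X]addr0; apply: cvgD; first exact: cvg_cst.
    exact: cvg_harmonic.
  apply: cvgM => //; apply: cvgV.
    by rewrite gt_eqF// ltr_wpDl ?exprn_ge0 ?ltW// exprn_even_gt0.
  apply: cvgD; last exact: cvg_cst.
  rewrite (_ : w ^+ 4 = (w ^+ 2) ^+ 2); last by rewrite -exprM.
  apply: (@cvg_comp _ _ _ _ (fun z : R => z ^+ 2) _ _ _ c1).
  exact: exprn_continuous.
- exact: integrable_scale.
- by move=> n w; rewrite pos_lineE => w0; apply: dilated_poisson_bound => //; exact: ltW.
Qed.

Lemma sqrt_weight1_ge x : 0 <= x ->
  (Num.sqrt x)^-1 * (1 + x ^+ 2)^-1 <= 2 * sqrt_weight 1 x.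
Proof.
move=> x0; rewrite /sqrt_weight mulrCA ler_wpM2l ?invr_ge0//.
have d0 : 0 < 1 + 1 * x by rewrite mul1r ltr_pwDl.
have d1 : 0 < 1 + x ^+ 2 by rewrite ltr_pwDl// sqr_ge0.
rewrite ler_pdivlMr// mulrC ler_pdivrMr//.
by have := sqr_ge0 (x - 1); rewrite !expr2; nra.
Qed.

(** [y^(-1/2)] is not integrable, so [pairing_profile] is applied to [sqrt_abel] and the damping is
    then removed on both sides. On the left the uniform bound by [|x|^(-1/2)] is combined with the
    quadratic decay of [cos_tr U]. *)
Lemma pairing_inv_sqrt U U1 U2 : even_profile U U1 U2 ->
  L1 P (fun y => (Num.sqrt y)^-1 * U y) ->
  \int[mu]_(x in P) (Num.sqrt pi / Num.sqrt (2 * `|x|) * cos_tr U x) =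
  pi / 2 * \int[mu]_(y in P) ((Num.sqrt y)^-1 * U y).
Proof.
move=> pU iU; have [C C0 HC] := cos_tr_profile_decay pU.
have icU := integrable_cos_tr_profile pU.
have [wi _] := integrable_sqrt_weight (ltr01 : 0 < 1 :> R).
have e0 n : 0 < (n.+1%:R^-1 : R) by rewrite invr_gt0.
have [||||_ h1] := @dominated_cvgn R P
  (fun n x => cos_tr (sqrt_abel n.+1%:R^-1) x * cos_tr U x)
  (fun x => Num.sqrt pi / Num.sqrt (2 * `|x|) * cos_tr U x)
  (fun x => 2 * Num.sqrt pi * C * 2 * sqrt_weight 1 x) (@measurable_pos_line R).
- move=> n; apply: measurable_funM; last exact: integrable_measurable icU.
  apply: measurable_funTS; apply: continuous_measurable_fun.
  by apply: continuous_cos_tr; exact: integrable_sqrt_abel.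
- move=> x; rewrite pos_lineE => x0; apply: cvgMr_tmp.
  by apply: cvg_cos_tr_sqrt_abel; rewrite gt_eqF.
- exact: integrable_scale.
- move=> n x; rewrite pos_lineE => x0; rewrite normrM.
  apply: (@le_trans _ _ (2 * Num.sqrt pi * (Num.sqrt `|x|)^-1 * (C * (1 + x ^+ 2)^-1))).
    by apply: ler_pM => //; apply: cos_tr_sqrt_abel_bound => //; rewrite gt_eqF.
  rewrite gtr0_norm// -!mulrA !ler_wpM2l// mulrCA ler_wpM2l//.
  by apply: sqrt_weight1_ge; exact: ltW.
have [||||_ h2] := @dominated_cvgn R P
  (fun n y => sqrt_abel n.+1%:R^-1 y * U y) (fun y => (Num.sqrt y)^-1 * U y)
  (fun y => `|(Num.sqrt y)^-1 * U y|) (@measurable_pos_line R).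
- move=> n; apply: measurable_funM; last exact: integrable_measurable (profile_integrable pU).
  exact: integrable_measurable (integrable_sqrt_abel (e0 n)).
- move=> y _; apply: cvgMr_tmp; rewrite -[X in _ --> X]mulr1; apply: cvgMl_tmp.
  rewrite -[X in _ --> X]expR0; apply: continuous_cvg; first exact: continuous_expR.
  rewrite -oppr0 -(mul0r y); apply: cvgN.
  have e_0 : (n.+1%:R^-1 : R) @[n --> \oo] --> 0 by exact: cvg_harmonic.
  exact: cvgMr_tmp.
- exact: integrable_norm.
- move=> n y; rewrite pos_lineE => y0; rewrite !normrM ler_wpM2r// ler_piMr//.
  by rewrite ger0_norm ?expR_ge0// -expR0 ler_expR oppr_le0 mulr_ge0// ltW.
have E : (fun n => \int[mu]_(x in P) (cos_tr (sqrt_abel n.+1%:R^-1) x * cos_tr U x)) =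
    (fun n => pi / 2 * \int[mu]_(y in P) (sqrt_abel n.+1%:R^-1 y * U y)).
  by apply/funext => n; exact: (pairing_profile pU (integrable_sqrt_abel (e0 n))).
rewrite E in h1; apply: (cvg_unique _ h1) => //.
by apply: cvgM; [exact: cvg_cst|exact: h2].
Qed.

End inverse_sqrt_symbol.

(** * Partial fractions of the hyperbolic cosecant *)

Section hyperbolic_partial_fractions.
Context {R : realType}.
Notation mu := (@lebesgue_measure R).
Notation P := (pos_line R).
Notation L1 A f := (mu.-integrable A (EFin \o f)).
Implicit Types (f g F : R -> R) (x y z t c : R).

Definition cosh x : R := (expR x + expR (- x)) / 2.
Definition sinh x : R := (expR x - expR (- x)) / 2.

Lemma sinh_gt0 x : 0 < x -> 0 < sinh x.
Proof. by move=> x0; rewrite divr_gt0// subr_gt0 ltr_expR; lra. Qed.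

Let c : R := pi / 2.

Let c_gt0 : 0 < c. Proof. by rewrite divr_gt0// pi_gt0. Qed.

(** Up to sign, the remainder after [n] terms when [1 / (e^(c y) + 1)] is expanded into the
    alternating sum of the [e^(- k c y)] and integrated against the sine; [tail x 0] is the integral
    to be computed. *)
Let tail x n := \int[mu]_(y in P)
  (expR (- (n%:R * c * y)) / (expR (c * y) + 1) * sin (x * y)).

Let tail_weight_le n y : 0 < y ->
  `|expR (- (n%:R * c * y)) / (expR (c * y) + 1)| <= expR (- (n%:R * c * y)).
Proof.
move=> y0; rewrite ger0_norm ?divr_ge0 ?addr_ge0 ?expR_ge0//.
by rewrite ler_pdivrMr ?addr_gt0 ?expR_gt0// ler_peMr ?expR_ge0// lerDr expR_ge0.
Qed.

Let measurable_tail_weight n :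
  measurable_fun P (fun y => expR (- (n%:R * c * y)) / (expR (c * y) + 1)).
Proof.
apply: measurable_funM; first exact: measurable_expNM.
apply: measurable_funV; apply: measurable_funD => //; apply: measurable_funTS.
apply: continuous_measurable_fun => y; apply: continuous_comp; last exact: continuous_expR.
exact: mulrl_continuous.
Qed.

Lemma fermi_le y : 0 < y -> (expR (c * y) + 1)^-1 <= expR (- (c * y)).
Proof.
by move=> y0; rewrite expRN lef_pV2 ?posrE ?addr_gt0 ?expR_gt0// lerDl.
Qed.

Let integrable_tail_weight n :
  L1 P (fun y => expR (- (n%:R * c * y)) / (expR (c * y) + 1)).
Proof.
have [ci _] := integrable_expNM c_gt0.
apply: (integrable_le (@measurable_pos_line R) (measurable_tail_weight n) ci).
move=> y; rewrite pos_lineE => y0; rewrite normrM !ger0_norm ?expR_ge0 ?invr_ge0 ?addr_ge0 ?expR_ge0//.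
rewrite -[leRHS]mul1r; apply: ler_pM; rewrite ?expR_ge0 ?invr_ge0 ?addr_ge0 ?expR_ge0//.
  by rewrite -expR0 ler_expR oppr_le0 mulr_ge0 1?mulr_ge0// ltW.
exact: fermi_le.
Qed.

Let tail_recurrence x n : tail x n + tail x n.+1 = x / (x ^+ 2 + (n.+1%:R * c) ^+ 2).
Proof.
have nc : 0 < n.+1%:R * c by rewrite mulr_gt0.
rewrite [x ^+ 2 + _]addrC -laplace_sin// /tail -RintegralD//;
  [|exact: (integrable_mul_sin _ (@measurable_pos_line R) (integrable_tail_weight _))..].
apply: integral_eq => y _; rewrite -mulrDl -mulrDl; congr (_ * _).
have E : expR (- (n%:R * c * y)) = expR (c * y) * expR (- (n.+1%:R * c * y)).
  by rewrite -expRD -natr1; congr expR; ring.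
by rewrite E; field; rewrite gt_eqF// addr_gt0 ?expR_gt0.
Qed.

Let tail_bound x n : `|tail x n.+1| <= (n.+1%:R * c)^-1.
Proof.
have nc : 0 < n.+1%:R * c by rewrite mulr_gt0.
have [ei <-] := integrable_expNM nc.
apply: le_integral_bound => //.
  by apply: measurable_funM; [exact: measurable_tail_weight|exact: measurable_sin_mul].
move=> y; rewrite pos_lineE => y0; rewrite normrM -[leRHS]mulr1.
by apply: ler_pM => //; [exact: tail_weight_le|exact: norm_sin_le1].
Qed.

Let S x := fix S n := if n is m.+1 then S m + (-1) ^+ m * (x / (x ^+ 2 + (m.+1%:R * c) ^+ 2)) else 0.

Let S_tail x n : tail x 0 = S x n + (-1) ^+ n * tail x n.
Proof.
elim: n => [|n IHn]; first by rewrite add0r expr0 mul1r.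
by rewrite IHn /= -tail_recurrence exprS; ring.
Qed.

Let cvg_S x : S x n @[n --> \oo] --> tail x 0.
Proof.
rewrite -(cvg_shiftS (S x)); apply/cvgrPdist_le => e e0; near=> n.
rewrite (S_tail x n.+1) addrAC subrr add0r normrM normrX normrN1 expr1n mul1r.
apply: (le_trans (tail_bound _ _)).
have ec : 0 < e * c by rewrite mulr_gt0.
rewrite invfM ler_pdivrMr// -[leRHS]invrK lef_pV2 ?posrE ?invr_gt0//.
apply: (@le_trans _ _ n%:R); last by rewrite ler_nat.
by near: n; exact: nbhs_infty_ger.
Unshelve. all: by end_near. Qed.

Let J : set R := `[0, 2].

Let integrable_J f : continuous f -> L1 J f.
Proof.
move=> cf; apply: continuous_compact_integrable; first exact: segment_compact.
exact: continuous_subspaceT.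
Qed.

(* [cosh (x * t) - 1] vanishes to second order at [t = 0]; its Fejer means there tend to [0],
   which sums the alternating series of the [x / (x ^+ 2 + (k * c) ^+ 2)]. *)
Fixpoint dirichlet n t : R :=
  if n is m.+1 then dirichlet m t + 2 * cos (n%:R * c * t) else 1.

Fixpoint fejer n t : R := if n is m.+1 then fejer m t + dirichlet m t else 0.

(** Multiplied by [1 - cos (c t)] the cosine sum telescopes; this form also avoids dividing by a
    factor that vanishes at [t = 0]. *)
Lemma dirichletE n t :
  (1 - cos (c * t)) * dirichlet n t = cos (n%:R * c * t) - cos (n.+1%:R * c * t).
Proof.
elim: n => [|n IHn]; first by rewrite /= !mul0r mul1r cos0 mulr1.
rewrite [dirichlet _ _]/= mulrDr IHn.
have -> : n%:R * c * t = n.+1%:R * c * t - c * t by rewrite -natr1; ring.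
have -> : n.+2%:R * c * t = n.+1%:R * c * t + c * t by rewrite -(natr1 n.+1); ring.
by rewrite cosB cosD; ring.
Qed.

Lemma fejerE n t : (1 - cos (c * t)) * fejer n t = 1 - cos (n%:R * c * t).
Proof.
elim: n => [|n IHn]; first by rewrite /= !mul0r mulr0 cos0 subrr.
by rewrite [fejer _ _]/= mulrDr IHn dirichletE; ring.
Qed.

Let continuous_dirichlet n : continuous (dirichlet n).
Proof.
elim: n => [|n IHn] t; first exact: cvg_cst.
by apply: cvgD; [exact: IHn|apply: cvgMl_tmp; exact: continuous_cos_mul].
Qed.

Let continuous_fejer n : continuous (fejer n).
Proof.
elim: n => [|n IHn] t; first exact: cvg_cst.
by apply: cvgD; [exact: IHn|exact: continuous_dirichlet].
Qed.

Let continuous_cosh1 x : continuous (fun t => cosh (x * t) - 1).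
Proof.
move=> t; apply: cvgB; last exact: cvg_cst.
apply: cvgMr_tmp; apply: cvgD; (apply: continuous_cvg; first exact: continuous_expR).
  exact: mulrl_continuous.
by apply: cvgN; exact: mulrl_continuous.
Qed.

Lemma cos_natpi n : cos (n%:R * pi) = (-1) ^+ n :> R.
Proof.
elim: n => [|n IHn]; first by rewrite mul0r cos0.
by rewrite -natr1 mulrDl mul1r cosDpi IHn exprS mulN1r.
Qed.

Lemma sin_natpi n : sin (n%:R * pi) = 0 :> R.
Proof.
elim: n => [|n IHn]; first by rewrite mul0r sin0.
by rewrite -natr1 mulrDl mul1r sinDpi IHn oppr0.
Qed.

(** At [t = 2] the argument of the cosine is a multiple of [pi], so the sine terms of the primitive
    drop out and the cosine contributes the alternating sign. *)
Let coef x k : 0 < x -> \int[mu]_(t in J) ((cosh (x * t) - 1) * cos (k.+1%:R * c * t)) =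
  (-1) ^+ k.+1 * sinh (2 * x) * (x / (x ^+ 2 + (k.+1%:R * c) ^+ 2)).
Proof.
move=> x0; set w := k.+1%:R * c.
have w0 : 0 < w by rewrite mulr_gt0.
have d0 := den_gt0 w x0.
pose F t := (x * sinh (x * t) * cos (w * t) + w * cosh (x * t) * sin (w * t)) / (x ^+ 2 + w ^+ 2)
  - sin (w * t) / w.
have w2 : w * 2 = k.+1%:R * pi by rewrite /w /c mulrA divfK.
apply: (etrans (congr1 fine (@FTC_segment R (fun t => (cosh (x * t) - 1) * cos (w * t)) F (-1) 0 2 _ _ _ _))).
- by rewrite ltrN10.
- by [].
- move=> t _; rewrite /F /sinh /cosh; apply: is_derive_eq; rewrite /GRing.scale/=.
  by field; rewrite !gt_eqF.
- by move=> t _; apply: cvgM; [exact: continuous_cosh1|exact: continuous_cos_mul].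
rewrite /= /F w2 sin_natpi cos_natpi !mulr0 sin0 /sinh /cosh !mulr0 oppr0 !mul0r subrr !(mulr0, mul0r, addr0, subr0).
by rewrite (mulrC x 2) mulrAC mulrA; ring.
Qed.

Let fejer_moment x n := \int[mu]_(t in J) ((cosh (x * t) - 1) * fejer n t).
Let dirichlet_moment x n := \int[mu]_(t in J) ((cosh (x * t) - 1) * dirichlet n t).

Let measurable_J : measurable J.
Proof. exact: measurable_itv. Qed.

Let continuous_moment x f : continuous f -> continuous (fun t => (cosh (x * t) - 1) * f t).
Proof. by move=> cf t; apply: cvgM; [exact: continuous_cosh1|exact: cf]. Qed.

(** These moments are twice the partial sums at [t = 0] of the cosine series of [cosh (x t) - 1] on
    [[0, 2]]. The function vanishes at [0], so the expected limit is [0], and this will determine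
    the limit of [S]. *)
Let dirichlet_momentE x n : 0 < x ->
  dirichlet_moment x n = sinh (2 * x) * (x^-1 - 2 * S x n) - 2.
Proof.
move=> x0; elim: n => [|n IHn].
  pose F t := sinh (x * t) / x - t.
  apply: (etrans (congr1 fine (@FTC_segment R (fun t => (cosh (x * t) - 1) * 1) F (-1) 0 2 _ _ _ _))).
  - by rewrite ltrN10.
  - by [].
  - move=> t _; rewrite /F /sinh /cosh; apply: is_derive_eq; rewrite /GRing.scale/=.
    by field; rewrite gt_eqF.
  - by move=> t _; apply: cvgM; [exact: continuous_cosh1|exact: cvg_cst].
  rewrite /= /F /sinh mulr0 oppr0 (mulrC x 2).
  by ring.
transitivity (\int[mu]_(t in J) ((cosh (x * t) - 1) * dirichlet n t +
    2 * ((cosh (x * t) - 1) * cos (n.+1%:R * c * t)))).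
  by apply: integral_eq => t _ /=; ring.
rewrite RintegralD//.
- rewrite RintegralZl//.
    rewrite coef// -/(dirichlet_moment x n) IHn /= exprS; ring.
  by apply: integrable_J; apply: continuous_moment; exact: continuous_cos_mul.
- by apply: integrable_J; apply: continuous_moment.
- apply: integrable_J => t; apply: cvgMl_tmp.
  by apply: continuous_moment; exact: continuous_cos_mul.
Qed.

Let fejer_momentE x n : fejer_moment x n = series (dirichlet_moment x) n.
Proof.
elim: n => [|n IHn].
  rewrite /series /= big_nil /fejer_moment /=.
  transitivity (\int[mu]_(t in J) (0 : R)); first by apply: integral_eq => t _; rewrite mulr0.
  by rewrite /Rintegral integral0.
rewrite /series /= big_nat_recr//= -[X in X + _]IHn.
rewrite -RintegralD//; [|by apply: integrable_J; apply: continuous_moment..].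
by apply: integral_eq => t _ /=; rewrite mulrDr.
Qed.

(** With [a = t / 2], the mean value theorem gives [sin a >= a cos a], hence [sin t >= 2 a cos^2 a];
    and [2 cos^2 a >= 1] because [cos t >= 0]. *)
Lemma sin_ge_half t : 0 <= t <= pi / 2 -> t / 2 <= sin t.
Proof.
move=> /andP[]; rewrite le_eqVlt => /predU1P[<- _|t0 tpi].
  by rewrite mul0r sin0.
pose a := t / 2; have a0 : 0 < a by rewrite divr_gt0.
have pi0 := pi_gt0 R.
have [b] := @MVT R sin cos 0 a a0 (fun x _ => is_derive_sin x)
  (continuous_subspaceT (@continuous_sin R)).
rewrite in_itv/= => /andP[b0 ba]; rewrite sin0 !subr0 => sa.
have cb : cos a <= cos b.
  by rewrite ltW// ltr_cos// !in_itv/=; apply/andP; split; rewrite /a in ba *; lra.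
have ca : 0 <= cos a by apply: cos_ge0_pihalf; rewrite /a; apply/andP; split; lra.
have ct : 0 <= cos t by apply: cos_ge0_pihalf; apply/andP; split; lra.
have tE : t = a + a by rewrite /a; field.
have c2 : cos a ^+ 2 + sin a ^+ 2 = 1 := cos2Dsin2 a.
have : sin t = 2 * sin a * cos a by rewrite [in LHS]tE sinD; ring.
have : cos t = cos a ^+ 2 - sin a ^+ 2 by rewrite [in LHS]tE cosD; ring.
move=> ctE ->; rewrite sa -/a.
have : a <= 2 * a * cos a ^+ 2.
  by have : 1 <= 2 * cos a ^+ 2; [lra|nra].
move=> /le_trans; apply.
have cba : 0 <= cos b - cos a by rewrite subr_ge0.
by have := mulr_ge0 (mulr_ge0 (ltW a0) ca) cba; nra.
Qed.

Let c_ge1 : 1 <= c.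
Proof. by rewrite /c ler_pdivlMr// mul1r pi_ge2. Qed.

(** Both quantities are of order [t^2]: the left one is [(X - Y)^2 / 2] with [X - Y <= x t X], and
    [1 - cos (c t) = 2 sin^2 (c t / 2)] is at least [t^2 / 8]. The quotient of these bounds is the
    factor [4 x^2 e^(2 x)]. *)
Lemma cosh1_le x t : 0 < x -> 0 <= t <= 2 ->
  0 <= cosh (x * t) - 1 <= 4 * x ^+ 2 * expR (2 * x) * (1 - cos (c * t)).
Proof.
move=> x0 /andP[t0 t2].
pose X := expR (x * t / 2); pose Y := expR (- (x * t / 2)).
have XY : X * Y = 1 by exact: expRxMexpNx_1.
have cE : cosh (x * t) - 1 = (X - Y) ^+ 2 / 2.
  have -> : cosh (x * t) = (X ^+ 2 + Y ^+ 2) / 2.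
    rewrite /cosh /X /Y -!expRM_natl; congr ((expR _ + expR _) / 2); by field.
  by rewrite sqrrB XY; field.
rewrite cE divr_ge0 ?sqr_ge0//=.
have xt0 : 0 <= x * t by rewrite mulr_ge0// ltW.
have X0 : 0 < X by exact: expR_gt0.
have YX : Y <= X by rewrite ler_expR; lra.
have XYle : X - Y <= x * t * X.
  have -> : Y = X * expR (- (x * t)) by rewrite -expRD; congr expR; field.
  by have := expR_ge1Dx (- (x * t)); nra.
have X2 : X ^+ 2 <= expR (2 * x).
  by rewrite /X -expRM_natl ler_expR; nra.
have h1 : (X - Y) ^+ 2 <= x ^+ 2 * t ^+ 2 * expR (2 * x).
  apply: (@le_trans _ _ ((x * t * X) ^+ 2)).
    by rewrite ler_pXn2r// ?nnegrE ?subr_ge0// mulr_ge0// ltW.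
  by rewrite exprMn exprMn ler_wpM2l// mulr_ge0 ?sqr_ge0.
have h2 : t ^+ 2 / 8 <= 1 - cos (c * t).
  pose a := c * t / 2.
  have -> : c * t = a + a by rewrite /a; field.
  have pi2 := pi_ge2 R.
  have /sin_ge_half sa : 0 <= a <= pi / 2.
    by rewrite /a /c; apply/andP; split; nra.
  have c2 : cos a ^+ 2 + sin a ^+ 2 = 1 := cos2Dsin2 a.
  have -> : 1 - cos (a + a) = 2 * sin a ^+ 2 by rewrite cosD; move: c2; rewrite !expr2; lra.
  have ta : t / 4 <= sin a.
    by apply: le_trans sa; rewrite /a; have := c_ge1; nra.
  have t4 : 0 <= t / 4 by rewrite divr_ge0.
  have : (t / 4) ^+ 2 <= sin a ^+ 2 by rewrite ler_pXn2r// nnegrE// (le_trans t4).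
  by rewrite expr_div_n; lra.
have p0 : 0 <= x ^+ 2 * expR (2 * x) by rewrite mulr_ge0 ?sqr_ge0 ?expR_ge0.
have := ler_wpM2l p0 h2.
move: h1; set A := expR _; set B := cos _.
by rewrite -!mulrA => h1 h3; nra.
Qed.

(** The peak of [fejer n] at [0] is absorbed: [cosh (x t) - 1] is dominated by a multiple of
    [1 - cos (c t)], whose product with [fejer n] is [1 - cos (n c t)], at most [2]. *)
Let fejer_moment_bound x : 0 < x -> exists C, forall n, `|fejer_moment x n| <= C.
Proof.
move=> x0; pose K := 4 * x ^+ 2 * expR (2 * x).
have K0 : 0 <= K by rewrite mulr_ge0 ?expR_ge0// mulr_ge0 ?sqr_ge0.
exists (\int[mu]_(t in J) (2 * K)) => n; apply: le_integral_bound => //.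
- apply: measurable_funTS; apply: continuous_measurable_fun.
  by apply: continuous_moment.
- by apply: integrable_J => t; exact: cvg_cst.
- move=> t; rewrite /J/= in_itv/= => /(cosh1_le x0)/andP[h0 h1].
  have c1 : 0 <= 1 - cos (c * t) by rewrite subr_ge0 cos_le1.
  rewrite normrM (ger0_norm h0).
  apply: (@le_trans _ _ (K * (1 - cos (c * t)) * `|fejer n t|)); first exact: ler_wpM2r.
  rewrite -mulrA -{1}(ger0_norm c1) -normrM fejerE mulrC ler_wpM2r//.
  rewrite (le_trans (ler_normB _ _))// normr1.
  by have := norm_cos_le1 (n%:R * c * t); lra.
Qed.

(** The Dirichlet moments converge to [L] because [S] converges. Their Cesàro means are bounded
    Fejér moments divided by the index, so they tend to [0]. Hence [L = 0], an equation that is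
    solved for [tail x 0]. *)
Lemma integral_sin_fermi x : 0 < x ->
  \int[mu]_(y in P) ((expR (pi / 2 * y) + 1)^-1 * sin (x * y)) =
  (2 * x)^-1 - (sinh (2 * x))^-1.
Proof.
move=> x0; have s0 : 0 < sinh (2 * x) by rewrite sinh_gt0// mulr_gt0.
rewrite (_ : \int[mu]_(y in P) _ = tail x 0); last first.
  by apply: integral_eq => y _; rewrite !mul0r oppr0 expR0 mul1r.
pose L := sinh (2 * x) * (x^-1 - 2 * tail x 0) - 2.
have uL : dirichlet_moment x n @[n --> \oo] --> L.
  under eq_fun do rewrite dirichlet_momentE//.
  apply: cvgB; last exact: cvg_cst.
  apply: cvgMl_tmp; apply: cvgB; first exact: cvg_cst.
  by apply: cvgMl_tmp; exact: cvg_S.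
have m1 := cesaro uL.
have [C HC] := fejer_moment_bound x0.
have m2 : arithmetic_mean (dirichlet_moment x) n @[n --> \oo] --> 0.
  apply/cvgrPdist_le => e e0; near=> n.
  rewrite sub0r normrN /arithmetic_mean/= -fejer_momentE normrM ger0_norm ?invr_ge0//.
  rewrite ler_pdivrMl//; apply: (le_trans (HC _)).
  rewrite mulrC -ler_pdivrMl// mulrC; apply: (@le_trans _ _ n%:R); last by rewrite ler_nat.
  by near: n; exact: nbhs_infty_ger.
have L0 : L = 0 by exact: (cvg_unique _ m1 m2).
have : sinh (2 * x) * (x^-1 - 2 * tail x 0) = 2 by apply/eqP; rewrite -subr_eq0; apply/eqP.
move: (tail x 0) => t E.
have -> : t = (x^-1 - (x^-1 - 2 * t)) / 2 by field; rewrite gt_eqF.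
have -> : x^-1 - 2 * t = 2 / sinh (2 * x) by apply: (mulfI (lt0r_neq0 s0)); rewrite E mulrC divfK// gt_eqF.
by field; rewrite !gt_eqF.
Unshelve. all: by end_near. Qed.

End hyperbolic_partial_fractions.

(** * The symbols and their kernels *)

Section symbols.
Context {R : realType}.
Notation mu := (@lebesgue_measure R).
Notation P := (pos_line R).
Notation L1 A f := (mu.-integrable A (EFin \o f)).
Implicit Types (x T e : R).

Definition lead_symbol T x : R := (Num.sqrt T)^-1 * (Num.sqrt x)^-1.

Lemma sqr_le_le (a b : R) : 0 <= b -> a ^+ 2 <= b ^+ 2 -> a <= b.
Proof. by move=> b0 h; rewrite leNgt; apply/negP => ba; nra. Qed.

(** From [s - a = s^2 q / (s + a)] and [s <= s + a <= 2 s]. It is applied with [s] the leading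
    symbol, [a] the square root symbol and [q = 1 / (1 + T x^2)]; the lower bound is what the
    optimality of the exponent rests on. *)
Lemma symbol_gap (a s q : R) : 0 < a -> 0 < s -> 0 <= q -> s ^+ 2 - a ^+ 2 = s ^+ 2 * q ->
  s * q / 2 <= s - a <= s * q.
Proof.
move=> a0 s0 q0 E.
have as_le : a <= s.
  apply: sqr_le_le; first exact: ltW.
  by rewrite -subr_ge0 E mulr_ge0 ?sqr_ge0.
have d0 : 0 < s + a by rewrite addr_gt0.
have -> : s - a = s ^+ 2 * q / (s + a).
  by rewrite -E; field; rewrite gt_eqF.
have sq : 0 <= s * q by rewrite mulr_ge0// ltW.
apply/andP; split; last by rewrite ler_pdivrMr//; nra.
by rewrite ler_pdivlMr//; nra.
Qed.

Section fixed_parameter.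
Variable T : R.
Hypothesis T_gt0 : 0 < T.

Let sT : 0 < Num.sqrt T. Proof. by rewrite sqrtr_gt0. Qed.

Lemma oneDT_gt0 x : 0 < 1 + T * x ^+ 2.
Proof. by rewrite ltr_pwDl// mulr_ge0 ?sqr_ge0// ltW. Qed.

Lemma lead_symbol_gt0 x : 0 < x -> 0 < lead_symbol T x.
Proof. by move=> x0; rewrite mulr_gt0 ?invr_gt0 ?sqrtr_gt0. Qed.

Lemma lead_symbolE x : 0 < x -> (Num.sqrt (T * `|x|))^-1 = lead_symbol T x.
Proof. by move=> x0; rewrite gtr0_norm// sqrtrM ?ltW// invfM. Qed.

Lemma sqrt_symbol_gt0 x : 0 < x -> 0 < sqrt_symbol T x.
Proof.
by move=> x0; rewrite sqrtr_gt0 divr_gt0 ?oneDT_gt0// normr_gt0 gt_eqF.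
Qed.

Lemma symbol_32_bounds x : 0 < x ->
  lead_symbol T x * (1 + T * x ^+ 2)^-1 / 2 <= - symbol_32 T x <=
  lead_symbol T x * (1 + T * x ^+ 2)^-1.
Proof.
move=> x0; rewrite /symbol_32 opprB lead_symbolE//.
have d0 := oneDT_gt0 x.
apply: symbol_gap; [exact: sqrt_symbol_gt0|exact: lead_symbol_gt0|by rewrite invr_ge0 ltW|].
rewrite /lead_symbol /sqrt_symbol exprMn !exprVn !sqr_sqrtr ?ltW//.
  by rewrite gtr0_norm//; field; rewrite !gt_eqF.
by rewrite divr_gt0// normr_gt0 gt_eqF.
Qed.

Lemma tanhE x : 0 < x -> 0 < tanh x <= 1.
Proof.
move=> x0; have s0 : 0 < expR x - expR (- x) by rewrite subr_gt0 ltr_expR; lra.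
have p0 : 0 < expR x + expR (- x) by rewrite addr_gt0 ?expR_gt0.
rewrite /tanh divr_gt0//= ler_pdivrMr// mul1r.
by have := expR_gt0 (- x); lra.
Qed.

(** With [a] the square root symbol, [l^2 = a^2 / tanh x] gives [l - a <= a (1 / tanh x - 1)]. The
    bracket is [2 e^(-x) / (e^x - e^(-x))], at most [2 e^(-x) / x], and [a <= sqrt x]. *)
Lemma symbol_omega_bounds x : 0 < x ->
  0 <= symbol_omega T x <= 2 * ((Num.sqrt x)^-1 * expR (- x)).
Proof.
move=> x0; have /andP[t0 t1] := tanhE x0.
have d0 := oneDT_gt0 x.
set a := sqrt_symbol T x; have a0 : 0 < a by exact: sqrt_symbol_gt0.
have a2 : a ^+ 2 = x / (1 + T * x ^+ 2).
  by rewrite sqr_sqrtr gtr0_norm// divr_ge0 ?ltW.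
rewrite /symbol_omega -/a /l_T gt_eqF//.
set l := Num.sqrt _.
have l2 : l ^+ 2 = a ^+ 2 * (tanh x)^-1.
  rewrite a2 /l sqr_sqrtr; first by field; rewrite !gt_eqF.
  by rewrite divr_ge0 ?ltW// mulr_gt0.
have al : a <= l.
  apply: sqr_le_le; first exact: sqrtr_ge0.
  by rewrite l2 ler_peMr ?sqr_ge0// invf_ge1.
rewrite subr_ge0 al/=.
have l0 : 0 < l by exact: lt_le_trans al.
have h1 : l - a <= a * ((tanh x)^-1 - 1).
  have -> : l - a = a ^+ 2 * ((tanh x)^-1 - 1) / (l + a).
    rewrite mulrBr mulr1 -l2; field; rewrite gt_eqF// addr_gt0//.
  have ti : 0 <= (tanh x)^-1 - 1 by rewrite subr_ge0 invf_ge1.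
  rewrite ler_pdivrMr ?addr_gt0//.
  have := mulr_ge0 (mulr_ge0 (ltW a0) ti) (ltW l0); nra.
apply: (le_trans h1).
have h2 : (tanh x)^-1 - 1 <= 2 * expR (- x) / x.
  have E1 : 1 + x <= expR x := expR_ge1Dx x.
  have E2 : expR (- x) <= 1 by rewrite -expR0 ler_expR oppr_le0 ltW.
  have s0 : 0 < expR x - expR (- x) by lra.
  have -> : (tanh x)^-1 - 1 = 2 * expR (- x) / (expR x - expR (- x)).
    rewrite /tanh; field.
    have p0 : 0 < expR x + expR (- x) by rewrite addr_gt0 ?expR_gt0.
    by rewrite !gt_eqF.
  rewrite ler_wpM2l ?mulr_ge0 ?expR_ge0// lef_pV2 ?posrE//.
  by lra.
have h3 : a <= Num.sqrt x.
  rewrite ler_wsqrtr// gtr0_norm// ler_pdivrMr// mulrDr mulr1 lerDl.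
  by rewrite mulr_ge0 ?ltW// mulr_gt0// exprn_gt0.
have x2 : Num.sqrt x / x = (Num.sqrt x)^-1.
  by rewrite -{2}(sqr_sqrtr (ltW x0)); field; rewrite gt_eqF// sqrtr_gt0.
apply: (@le_trans _ _ (Num.sqrt x * (2 * expR (- x) / x))).
  by apply: ler_pM => //; [exact: ltW|rewrite subr_ge0 invf_ge1].
by rewrite -x2 le_eqVlt; apply/orP; left; apply/eqP; ring.
Qed.

Lemma l_T_decomposition x : 0 < x ->
  l_T T x = lead_symbol T x + symbol_32 T x + symbol_omega T x.
Proof.
by move=> x0; rewrite /symbol_omega /symbol_32 lead_symbolE//; ring.
Qed.

Lemma l_T_le x : 0 < x -> 0 <= l_T T x <= ((Num.sqrt T)^-1 + 2) * (Num.sqrt x)^-1.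
Proof.
move=> x0; have sx : 0 < (Num.sqrt x)^-1 by rewrite invr_gt0 sqrtr_gt0.
apply/andP; split; first by rewrite /l_T gt_eqF// sqrtr_ge0.
have /andP[_ wb] := symbol_omega_bounds x0.
have /andP[+ _] := symbol_32_bounds x0.
have p0 : 0 <= lead_symbol T x * (1 + T * x ^+ 2)^-1 / 2.
  by rewrite divr_ge0// mulr_ge0 ?invr_ge0 ?ltW ?lead_symbol_gt0 ?oneDT_gt0.
rewrite l_T_decomposition// => h.
have E2 : expR (- x) <= 1 by rewrite -expR0 ler_expR oppr_le0 ltW.
by rewrite /lead_symbol mulrDl in p0 h *; nra.
Qed.

(** Minus the logarithmic derivative of [l_T], with the contributions of [1 + T x^2], of [x] and of
    [tanh x] in this order. *)
Definition log_slope x : R := T * x / (1 + T * x ^+ 2) - (2 * x)^-1 + (sinh (2 * x))^-1.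

Lemma is_derive_l_T x : 0 < x ->
  is_derive x 1 (fun x => Num.sqrt (x / ((1 + T * x ^+ 2) * tanh x)))
    (- (log_slope x * l_T T x)).
Proof.
move=> x0; have /andP[t0 t1] := tanhE x0.
have d0 := oneDT_gt0 x.
set h := fun x => x / ((1 + T * x ^+ 2) * tanh x).
have h0 : 0 < h x by rewrite /h divr_gt0// mulr_gt0.
have s0 : 0 < expR x - expR (- x) by rewrite subr_gt0 ltr_expR; lra.
have p0 : 0 < expR x + expR (- x) by rewrite addr_gt0 ?expR_gt0.
have XY : expR x * expR (- x) = 1 by exact: expRxMexpNx_1.
have e2 : sinh (2 * x) = (expR x ^+ 2 - expR (- x) ^+ 2) / 2.
  by rewrite /sinh -!expRM_natl; congr ((expR _ - expR _) / 2); ring.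
have dh : is_derive x 1 h (- 2 * log_slope x * h x).
  (* With [tanh] unfolded over a single denominator, the derivative is a rational expression in [x]
     and [expR x], within reach of [field]. *)
  pose B y := (1 + T * y ^+ 2) * (expR y - expR (- y)).
  have hE : h = (fun y => y * (expR y + expR (- y)) * (B y)^-1).
    apply/funext => y; rewrite /h /tanh /B !invfM invrK; ring.
  have B0 : 0 < B x by rewrite mulr_gt0.
  have dB : is_derive x 1 B (2 * T * x * (expR x - expR (- x)) +
      (1 + T * x ^+ 2) * (expR x + expR (- x))).
    by rewrite /B; apply: is_derive_eq; rewrite /GRing.scale/=; ring.
  have dV := is_deriveV (lt0r_neq0 B0) dB.
  rewrite hE; apply: is_derive_eq; rewrite /GRing.scale/= /log_slope e2.
  have -> : expR (- x) = (expR x)^-1 by rewrite expRN.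
  move: s0 p0; rewrite expRN; have := expR_gt0 x; rewrite /B expRN.
  set X := expR x => X0 s0 p0.
  have n2 : X * X - 1 != 0.
    rewrite (_ : _ - 1 = X * (X - X^-1)); last by field; rewrite gt_eqF.
    by rewrite mulf_neq0// gt_eqF.
  have n3 : (X * X) ^+ 2 - 1 != 0.
    rewrite (_ : _ - 1 = X ^+ 2 * (X - X^-1) * (X + X^-1)); last by field; rewrite gt_eqF.
    by rewrite !mulf_neq0 ?expf_neq0// gt_eqF.
  by field; rewrite n2 n3 !gt_eqF.
have ds := is_derive1_sqrt h0.
apply: (is_derive_eq (is_derive1_comp ds dh)); rewrite /GRing.scale/= /l_T gt_eqF// -/(h x).
have sh : 0 < Num.sqrt (h x) by rewrite sqrtr_gt0.
rewrite -{2}(sqr_sqrtr (ltW h0)); field; rewrite gt_eqF//.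
Qed.

Lemma continuous_l_T x : 0 < x ->
  {for x, continuous (fun x => Num.sqrt (x / ((1 + T * x ^+ 2) * tanh x)))}.
Proof. by move=> /is_derive_l_T/is_derive_continuous. Qed.

Lemma continuous_log_slope x : 0 < x -> {for x, continuous log_slope}.
Proof.
move=> x0; have s0 : 0 < sinh (2 * x) by rewrite sinh_gt0 ?mulr_gt0.
have m2 : 2 * y @[y --> x] --> 2 * x by exact: mulrl_continuous.
apply: cvgD; [apply: cvgB|].
- apply: cvgM; first exact: mulrl_continuous.
  apply: cvgV; first by rewrite gt_eqF ?oneDT_gt0.
  by apply: cvgD; [exact: cvg_cst|apply: cvgMl_tmp; exact: exprn_continuous].
- by apply: cvgV => //; rewrite gt_eqF// mulr_gt0.
- apply: cvgV; first by rewrite gt_eqF.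
  apply: cvgMr_tmp; apply: cvgB; (apply: continuous_cvg; first exact: continuous_expR) => //.
  exact: cvgN.
Qed.

Lemma measurable_l_T : measurable_fun P (l_T T).
Proof.
apply: (eq_measurable_fun (fun x => Num.sqrt (x / ((1 + T * x ^+ 2) * tanh x)))).
  by move=> x /set_mem; rewrite pos_lineE => x0; rewrite /l_T gt_eqF.
by apply: continuous_pos_measurable => x; exact: continuous_l_T.
Qed.

Lemma measurable_sqrt_symbol : measurable_fun setT (sqrt_symbol T).
Proof.
apply: continuous_measurable_fun => x; apply: continuous_cvg; first exact: sqrt_continuous.
apply: cvgM; first exact: norm_continuous.
apply: cvgV; first by rewrite gt_eqF ?oneDT_gt0.
by apply: cvgD; [exact: cvg_cst|apply: cvgMl_tmp; exact: exprn_continuous].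
Qed.

Lemma measurable_symbol_32 : measurable_fun setT (symbol_32 T).
Proof.
apply: measurable_funB; first exact: measurable_sqrt_symbol.
apply: measurable_funV; apply: continuous_measurable_fun => x.
apply: continuous_cvg; first exact: sqrt_continuous.
by apply: cvgMl_tmp; exact: norm_continuous.
Qed.

Lemma measurable_symbol_omega : measurable_fun P (symbol_omega T).
Proof.
apply: measurable_funB; first exact: measurable_l_T.
by apply: measurable_funTS; exact: measurable_sqrt_symbol.
Qed.

Lemma sqrt_weight_quadratic x : 0 <= x ->
  (Num.sqrt x)^-1 * (1 + T * x ^+ 2)^-1 <= 2 * sqrt_weight (Num.sqrt T) x.
Proof.
move=> x0; rewrite /sqrt_weight [leRHS]mulrCA ler_wpM2l ?invr_ge0//.
have d0 : 0 < 1 + Num.sqrt T * x by rewrite ltr_pwDl// mulr_ge0// ltW.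
have d1 := oneDT_gt0 x.
rewrite ler_pdivlMr// mulrC ler_pdivrMr//.
rewrite -{2}(sqr_sqrtr (ltW T_gt0)).
by have := sqr_ge0 (Num.sqrt T * x - 1); rewrite !expr2; nra.
Qed.

Lemma integrable_symbol_32 : L1 P (symbol_32 T).
Proof.
have [wi _] := integrable_sqrt_weight sT.
apply: (@integrable_le _ _ _ (fun x => (Num.sqrt T)^-1 * 2 * sqrt_weight (Num.sqrt T) x)) => //.
- by apply: measurable_funTS; exact: measurable_symbol_32.
- exact: integrable_scale.
move=> x; rewrite pos_lineE => x0; have /andP[h1 h2] := symbol_32_bounds x0.
rewrite -normrN ger0_norm; last first.
  apply: le_trans h1; rewrite divr_ge0// mulr_ge0 ?invr_ge0 ?ltW ?lead_symbol_gt0 ?oneDT_gt0//.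
apply: (le_trans h2); rewrite /lead_symbol -!mulrA ler_wpM2l ?invr_ge0//.
by apply: sqrt_weight_quadratic; exact: ltW.
Qed.

(** The extra factor leaves a decay of [x^(-3/2)] at infinity, still integrable; this makes
    [kernel_32] differentiable under the integral sign. *)
Lemma integrable_mul_symbol_32 : L1 P (fun x => x * symbol_32 T x).
Proof.
have [wi _] := integrable_sqrt_weight sT.
apply: (@integrable_le _ _ _ (fun x => T^-1 * 2 * sqrt_weight (Num.sqrt T) x)) => //.
- by apply: measurable_funM => //; apply: measurable_funTS; exact: measurable_symbol_32.
- exact: integrable_scale.
move=> x; rewrite pos_lineE => x0; have /andP[h1 h2] := symbol_32_bounds x0.
have d1 := oneDT_gt0 x.
have d0 : 0 < 1 + Num.sqrt T * x by rewrite addr_gt0// mulr_gt0.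
rewrite normrM -(normrN (symbol_32 _ _)) gtr0_norm// ger0_norm; last first.
  apply: le_trans h1; rewrite divr_ge0// mulr_ge0 ?invr_ge0 ?ltW ?lead_symbol_gt0//.
apply: (@le_trans _ _ (x * (lead_symbol T x * (1 + T * x ^+ 2)^-1))).
  by rewrite ler_wpM2l// ltW.
rewrite /lead_symbol /sqrt_weight.
rewrite (_ : x * _ = (Num.sqrt x)^-1 * (x * (Num.sqrt T)^-1 * (1 + T * x ^+ 2)^-1)); last by ring.
rewrite [leRHS]mulrCA ler_wpM2l ?invr_ge0//.
rewrite ler_pdivrMr// mulrAC ler_pdivlMr//.
rewrite -{3 4}(sqr_sqrtr (ltW T_gt0)).
move: sT; set b := Num.sqrt T => b0.
rewrite -(ler_pM2l (_ : 0 < b ^+ 2)) ?exprn_gt0//.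
have -> : b ^+ 2 * (x / b * (1 + b * x)) = b * x * (1 + b * x) by field; rewrite gt_eqF.
have -> : b ^+ 2 * ((b ^+ 2)^-1 * 2 * (1 + b ^+ 2 * x ^+ 2)) = 2 * (1 + (b * x) ^+ 2).
  by field; rewrite gt_eqF.
by have := sqr_ge0 (b * x - 1); rewrite !expr2; nra.
Qed.

(** Of the factor [e^(-x)], one half pays for [expR (x / 2)], which becomes the radius of
    convergence, and the other half is weakened to [1 / (1 + x / 2)] to give an integrable
    majorant. *)
Lemma symbol_omega_half_le x : 0 < x ->
  `|symbol_omega T x| * expR (x / 2) <= 2 * sqrt_weight 2^-1 x.
Proof.
move=> x0; have /andP[h1 h2] := symbol_omega_bounds x0.
rewrite ger0_norm//.
apply: (@le_trans _ _ (2 * ((Num.sqrt x)^-1 * expR (- x)) * expR (x / 2))).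
  by rewrite ler_wpM2r// expR_ge0.
rewrite -!mulrA -expRD ler_wpM2l// ler_wpM2l ?invr_ge0//.
rewrite (_ : - x + x / 2 = - (2^-1 * x)); last by field.
rewrite expRN lef_pV2 ?posrE ?expR_gt0 ?expR_ge1Dx//.
by rewrite addr_gt0// mulr_gt0.
Qed.

Lemma integrable_symbol_omega : L1 P (symbol_omega T).
Proof.
have half_gt0 : 0 < 2^-1 :> R by rewrite invr_gt0.
have [wi _] := integrable_sqrt_weight half_gt0.
apply: (@integrable_le _ _ _ (fun x => 2 * sqrt_weight 2^-1 x)) => //.
- exact: measurable_symbol_omega.
- exact: integrable_scale.
move=> x; rewrite pos_lineE => x0; apply: le_trans (symbol_omega_half_le x0).
by rewrite ler_peMr// -expR0 ler_expR divr_ge0// ltW.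
Qed.

End fixed_parameter.
End symbols.

(** * The Hölder part and the optimality of its exponent *)

Section kernel_32.
Context {R : realType}.
Notation mu := (@lebesgue_measure R).
Notation P := (pos_line R).
Notation L1 A f := (mu.-integrable A (EFin \o f)).
Implicit Types (x y t h p q a M : R).

Lemma sin_lipschitz x y : `|sin x - sin y| <= `|x - y|.
Proof.
have W (u v : R) : u < v -> `|sin v - sin u| <= `|v - u|.
  move=> uv; have [b _ ->] := @MVT R sin cos u v uv (fun x _ => is_derive_sin x)
    (continuous_subspaceT (@continuous_sin R)).
  by rewrite normrM ler_piMl// norm_cos_le1.
have [xy|yx|->] := ltgtP x y; [|exact: W|by rewrite !subrr].
by rewrite distrC [leRHS]distrC; exact: W.
Qed.

Lemma powR_le1D u a : 0 <= u -> 0 <= a <= 1 -> u `^ a <= 1 + u.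
Proof.
move=> u0 /andP[a0 a1]; have [u1|/ltW u1] := leP u 1.
  rewrite (@le_trans _ _ 1) ?lerDl//.
  have := @ge0_ler_powR R a a0 u 1; rewrite powR1 /=; apply => //; rewrite nnegrE//.
by rewrite (le_trans (ler1_powR u1 a1))// lerDr.
Qed.

Section fixed_parameter.
Variable T : R.
Hypothesis T_gt0 : 0 < T.

Let sT : 0 < Num.sqrt T. Proof. by rewrite sqrtr_gt0. Qed.

Definition kernel_32 x : R := pi^-1 * cos_tr (symbol_32 T) x.

Let g t : R := t * symbol_32 T t.

Let g_le0 t : 0 < t -> 0 <= - g t.
Proof.
move=> t0; have /andP[h _] := symbol_32_bounds T_gt0 t0; rewrite /g -mulrN mulr_ge0 ?ltW//.
apply: lt_le_trans h; rewrite divr_gt0// mulr_gt0 ?lead_symbol_gt0// invr_gt0.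
exact: oneDT_gt0.
Qed.

Let iK : L1 P (symbol_32 T) := integrable_symbol_32 T_gt0.
Let ig : L1 P g := integrable_mul_symbol_32 T_gt0.

Lemma is_derive_kernel_32 x : is_derive x 1 kernel_32 (- (pi^-1 * sin_tr g x)).
Proof.
have dc := is_derive_cos_tr x iK ig.
by rewrite /kernel_32; apply: is_derive_eq; rewrite /GRing.scale/= mulrN.
Qed.

Lemma derive1_kernel_32 : derive1 kernel_32 = (fun x => - (pi^-1 * sin_tr g x)).
Proof. by apply/funext => x; rewrite derive1E; have [_ ->] := is_derive_kernel_32 x. Qed.

Lemma kernel_32_bound x : `|kernel_32 x| <= pi^-1 * \int[mu]_(t in P) `|symbol_32 T t|.
Proof.
rewrite /kernel_32 normrM ger0_norm ?invr_ge0 ?pi_ge0//.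
by rewrite ler_wpM2l ?invr_ge0 ?pi_ge0// cos_tr_bound.
Qed.

Let g_decay t : 0 < t -> `|g t| <= (Num.sqrt T)^-1 * T^-1 * ((Num.sqrt t)^-1 * t^-1).
Proof.
move=> t0; have /andP[h1 h2] := symbol_32_bounds T_gt0 t0.
have d1 := oneDT_gt0 T_gt0 t.
have l0 := lead_symbol_gt0 T_gt0 t0.
rewrite -normrN ger0_norm; last exact: g_le0.
apply: (@le_trans _ _ (t * (lead_symbol T t * (1 + T * t ^+ 2)^-1))).
  by rewrite /g -mulrN ler_wpM2l// ltW.
apply: (@le_trans _ _ (t * (lead_symbol T t * (T * t ^+ 2)^-1))).
  have d2 : 0 < T * t ^+ 2 by rewrite mulr_gt0// exprn_gt0.
  by rewrite ler_wpM2l ?(ltW t0)// ler_wpM2l ?(ltW l0)// lef_pV2 ?posrE// lerDr.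
rewrite /lead_symbol le_eqVlt; apply/orP; left; apply/eqP; field.
by rewrite !gt_eqF// sqrtr_gt0.
Qed.

(** With [h = |x - y|], the difference of sines is at most [2] and at most [h t], hence at most
    [2 h t / (1 + h t / 2)]. Against the decay [t^(-3/2)] of [g] this is [h] times
    [sqrt_weight (h / 2)], whose integral is of order [h^(-1/2)]. *)
Lemma sin_tr_holder x y : `|sin_tr g x - sin_tr g y| <=
  (Num.sqrt T)^-1 * T^-1 * 2 * pi * Num.sqrt 2 * Num.sqrt `|x - y|.
Proof.
have [->|xy] := eqVneq x y; first by rewrite !subrr normr0 sqrtr0 mulr0.
set h := `|x - y|; have h0 : 0 < h by rewrite normr_gt0 subr_eq0.
have h2 : 0 < h / 2 by rewrite divr_gt0.
have [wi wE] := integrable_sqrt_weight h2.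
pose k := (Num.sqrt T)^-1 * T^-1 * 2 * h.
apply: (@le_trans _ _ (\int[mu]_(t in P) (k * sqrt_weight (h / 2) t))); last first.
  rewrite RintegralZl// wE /k le_eqVlt; apply/orP; left; apply/eqP.
  have s2 : 0 < Num.sqrt 2 :> R by rewrite sqrtr_gt0.
  have sh : 0 < Num.sqrt h by rewrite sqrtr_gt0.
  rewrite sqrtrM ?ltW// sqrtrV// -{1}(sqr_sqrtr (ltW h0)); field.
  by rewrite !gt_eqF.
rewrite -RintegralB//; [|exact: integrable_mul_sin..].
apply: le_integral_bound => //.
- by apply: measurable_funB; exact: (integrable_measurable (integrable_mul_sin _ _ ig)).
- exact: integrable_scale.
move=> t; rewrite pos_lineE => t0; rewrite -mulrBr normrM.
have D2 : `|sin (x * t) - sin (y * t)| <= 2.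
  by rewrite (le_trans (ler_normB _ _))// (_ : 2 = 1 + 1)// lerD// norm_sin_le1.
have Dh : `|sin (x * t) - sin (y * t)| <= h * t.
  by rewrite (le_trans (sin_lipschitz _ _))// -mulrBl normrM (gtr0_norm t0).
have ht : 0 < h * t by rewrite mulr_gt0.
have D4 : `|sin (x * t) - sin (y * t)| <= 2 * (h * t) * (1 + h / 2 * t)^-1.
  have d0 : 0 < 1 + h / 2 * t by rewrite addr_gt0// mulr_gt0.
  by rewrite ler_pdivlMr//; nra.
apply: (le_trans (ler_pM (normr_ge0 _) (normr_ge0 _) (g_decay t0) D4)).
rewrite /k /sqrt_weight le_eqVlt; apply/orP; left; apply/eqP; field.
have d0 : 0 < 2 + h * t by rewrite addr_gt0.
by rewrite !gt_eqF// sqrtr_gt0.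
Qed.

Lemma hoelder_space_kernel_32 : hoelder_space (3 / 2) kernel_32.
Proof.
have k1 : Num.truncn (3 / 2 : R) = 1%N by apply: truncn_def; apply/andP; split; lra.
have ip : 0 <= pi^-1 :> R by rewrite invr_ge0 pi_ge0.
rewrite /hoelder_space k1; split.
- by case=> // x _; have [] := is_derive_kernel_32 x.
- exists (Num.max (pi^-1 * \int[mu]_(t in P) `|symbol_32 T t|)
            (pi^-1 * \int[mu]_(t in P) `|g t|)) => -[|[|//]] x _.
    by rewrite derive1n0 le_max kernel_32_bound.
  rewrite derive1n1 derive1_kernel_32 normrN normrM (ger0_norm ip) le_max; apply/orP; right.
  by rewrite ler_wpM2l// sin_tr_bound.
- exists (pi^-1 * ((Num.sqrt T)^-1 * T^-1 * 2 * pi * Num.sqrt 2)) => x y.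
  rewrite derive1n1 derive1_kernel_32 (_ : 3 / 2 - 1%:R = 2^-1 :> R); last by field.
  rewrite powR12_sqrt// opprK addrC -mulrBr normrM (ger0_norm ip) distrC -[leRHS]mulrA.
  by rewrite ler_wpM2l// sin_tr_holder.
Qed.

Let laplace_sin_tr p : 0 < p ->
  \int[mu]_(x in P) (expR (- (p * x)) * sin_tr g x) =
  \int[mu]_(t in P) (g t * (t / (p ^+ 2 + t ^+ 2))).
Proof.
move=> p0; have [ei _] := integrable_expNM p0.
rewrite (@Fubini_kernel _ _ _ _ _ (fun z => sin (z.1 * z.2)))//.
- apply: integral_eq => t _; congr (_ * _); rewrite -laplace_sin//.
  by apply: integral_eq => x _; rewrite (mulrC x).
- apply: measurableT_comp; first by apply: continuous_measurable_fun; exact: continuous_sin.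
  by apply: measurable_funM; [exact: measurable_fst|exact: measurable_snd].
- by move=> z; exact: norm_sin_le1.
Qed.

(** The factor [1 / (2 sqrt T)] comes from the lower bound on [symbol_32]; on [[p, 2 p]] with
    [p >= 1], [1 + 4 T] comes from [1 + T t^2 <= (1 + 4 T) p^2] and [5] from
    [p^2 + t^2 <= 5 p t]. *)
Let c0 := (Num.sqrt T)^-1 / 2 / (1 + 4 * T) / 5.

Let c0_gt0 : 0 < c0.
Proof. by rewrite !divr_gt0 ?invr_gt0// addr_gt0// mulr_gt0. Qed.

(** The Laplace transform is taken at [p = q^2], so that [p^(1/2)] is the plain power [q]. The
    integrand [F] is nonnegative, hence the integral is at least its part over [[p, 2 p]], an
    interval of length [q^2] on which [F] is at least [c0 q^(-5)]. *)
Let laplace_lower q : 1 <= q ->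
  c0 * q ^- 3 <= `|\int[mu]_(x in P) (expR (- (q ^+ 2 * x)) * sin_tr g x)|.
Proof.
move=> q1; have q0 : 0 < q by exact: lt_le_trans q1.
set p := q ^+ 2; have p0 : 0 < p by rewrite exprn_gt0.
rewrite laplace_sin_tr// -normrN.
pose F (t : R) : R := - g t * (t / (p ^+ 2 + t ^+ 2)).
have gF : L1 P (fun t => g t * (t / (p ^+ 2 + t ^+ 2))).
  apply: (@integrable_le _ _ _ (fun t => p^-1 * `|g t|)) => //.
  - apply: measurable_funM; first exact: integrable_measurable ig.
    apply: measurable_funM => //; by apply: measurable_funV; apply: measurable_funD.
  - by apply: integrable_scale => //; exact: integrable_norm.
  - move=> t; rewrite pos_lineE => t0; rewrite normrM mulrC ler_wpM2r//.
    have d0 := den_gt0 t p0.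
    rewrite ger0_norm; last by rewrite divr_ge0// ltW.
    rewrite ler_pdivrMr// ler_pdivlMl//.
    by have := sqr_ge0 (p - t); have := mulr_gt0 p0 t0; rewrite !expr2; nra.
have iF : L1 P F.
  apply: (integrable_eq (@measurable_pos_line R) (integrable_scale (-1) (@measurable_pos_line R) gF)).
  by move=> t _; rewrite /F mulN1r mulNr.
have -> : - (\int[mu]_(t in P) (g t * (t / (p ^+ 2 + t ^+ 2)))) = \int[mu]_(t in P) F t.
  by rewrite -mulN1r -RintegralZl//; apply: integral_eq => t _; rewrite /F mulN1r mulNr.
have F0 t : 0 < t -> 0 <= F t.
  move=> t0; rewrite /F mulr_ge0 ?g_le0// divr_ge0 ?ltW// den_gt0//.
rewrite ger0_norm; last by apply: Rintegral_ge0 => t; rewrite pos_lineE; exact: F0.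
pose A : set R := `[p, 2 * p]%classic.
have AP : A `<=` P.
  by move=> t; rewrite /A pos_lineE/= in_itv/= => /andP[+ _]; exact: lt_le_trans.
have mA : measurable A by exact: measurable_itv.
have FA t : A t -> c0 * q ^- 5 <= F t.
  move=> At; have t0 : 0 < t by have := AP _ At; rewrite pos_lineE.
  move: At; rewrite /A/= in_itv/= => /andP[pt tp].
  have d1 := oneDT_gt0 T_gt0 t.
  have sq : q <= Num.sqrt t by rewrite -(ger0_norm (ltW q0)) -sqrtr_sqr ler_wsqrtr.
  have st : 0 < Num.sqrt t by rewrite sqrtr_gt0.
  have p1 : 1 <= p by rewrite /p exprn_ege1.
  have /andP[hb _] := symbol_32_bounds T_gt0 t0.
  have b1 : q / (1 + 4 * T) / p ^+ 2 * ((Num.sqrt T)^-1 / 2) <= - g t.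
    apply: (@le_trans _ _ (t * (lead_symbol T t * (1 + T * t ^+ 2)^-1 / 2))); last first.
      by rewrite /g -mulrN ler_wpM2l// ltW.
    have -> : t * (lead_symbol T t * (1 + T * t ^+ 2)^-1 / 2) =
        Num.sqrt t / (1 + T * t ^+ 2) * ((Num.sqrt T)^-1 / 2).
      rewrite /lead_symbol -{1}(sqr_sqrtr (ltW t0)); field.
      by rewrite !gt_eqF.
    rewrite ler_wpM2r ?divr_ge0 ?invr_ge0// -mulrA; apply: ler_pM => //.
    - exact: ltW.
    - by rewrite mulr_ge0 ?invr_ge0 ?sqr_ge0// addr_ge0// mulr_ge0// ltW.
    rewrite -invfM lef_pV2 ?posrE//; last first.
      by rewrite mulr_gt0 ?exprn_gt0// addr_gt0// mulr_gt0.
    have t2 : t ^+ 2 <= 4 * p ^+ 2 by rewrite !expr2; nra.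
    have p2 : 1 <= p ^+ 2 by rewrite exprn_ege1.
    by have := ler_wpM2l (ltW T_gt0) t2; lra.
  have b2 : (5 * p)^-1 <= t / (p ^+ 2 + t ^+ 2).
    have d0 := den_gt0 t p0.
    rewrite ler_pdivlMr// mulrC ler_pdivrMr ?mulr_gt0//.
    by rewrite !expr2; nra.
  have b3 : 0 <= q / (1 + 4 * T) / p ^+ 2 * ((Num.sqrt T)^-1 / 2).
    have t4 : 0 <= (1 + 4 * T)^-1 by rewrite invr_ge0 addr_ge0// mulr_ge0// ltW.
    apply: mulr_ge0; last by rewrite divr_ge0 ?invr_ge0.
    by apply: mulr_ge0; [exact: mulr_ge0 (ltW q0) t4|rewrite invr_ge0 sqr_ge0].
  have b4 : 0 <= (5 * p)^-1 by rewrite invr_ge0 mulr_ge0// ltW.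
  apply: le_trans (ler_pM b3 b4 b1 b2).
  have t4 : 0 < 1 + 4 * T by rewrite addr_gt0// mulr_gt0.
  rewrite /c0 /p le_eqVlt; apply/orP; left; apply/eqP; field.
  by rewrite !gt_eqF.
have iA : L1 P (cst (c0 * q ^- 5) \_ A).
  have : L1 A (cst (c0 * q ^- 5)).
    apply: continuous_compact_integrable; first exact: segment_compact.
    by apply: continuous_subspaceT => t; exact: cvg_cst.
  rewrite integrable_mkcond// restrict_EFin => i1.
  exact: integrableS i1.
apply: (@le_trans _ _ (\int[mu]_(t in P) (cst (c0 * q ^- 5) \_ A) t)); last first.
  apply: le_Rintegral => // t Pt; rewrite patchE; case: ifPn => [/set_mem|_]; first exact: FA.
  by move: Pt; rewrite pos_lineE; exact: F0.
rewrite -Rintegral_mkcondr setIidr// Rintegral_cst//.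
have muA : mu A = (q ^+ 2)%:E.
  rewrite /A lebesgue_measure_itv/= lte_fin ltr_pMl// ltr1n -EFinB.
  by congr EFin; rewrite /p; ring.
rewrite [X in fine X](_ : _ = (q ^+ 2)%:E)//=.
by rewrite le_eqVlt; apply/orP; left; apply/eqP; field; rewrite gt_eqF.
Qed.

(** No Gamma function: [(p x)^a <= 1 + p x <= 2 e^(p x / 2)], so half of the exponential absorbs the
    power. *)
Let laplace_upper a M q : 0 <= a <= 1 -> (forall x, 0 < x -> `|sin_tr g x| <= M * x `^ a) ->
  1 <= q ->
  `|\int[mu]_(x in P) (expR (- (q ^+ 2 * x)) * sin_tr g x)| <= 4 * M * q ^- 2 / (q ^+ 2) `^ a.
Proof.
move=> a01 HM q1; have q0 : 0 < q by exact: lt_le_trans q1.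
set p := q ^+ 2; have p0 : 0 < p by rewrite exprn_gt0.
have M0 : 0 <= M.
  by have := HM 1 ltr01; rewrite powR1 mulr1; apply: le_trans.
have pa : 0 < p `^ a by exact: powR_gt0.
have p2 : 0 < p / 2 by rewrite divr_gt0.
have [ei eE] := integrable_expNM p2.
apply: (@le_trans _ _ (\int[mu]_(x in P) (2 * M / p `^ a * expR (- (p / 2 * x))))).
  apply: le_integral_bound => //.
  - apply: measurable_funM; first exact: measurable_expNM.
    by apply: measurable_funTS; apply: continuous_measurable_fun; exact: continuous_sin_tr.
  - exact: integrable_scale.
  move=> x; rewrite pos_lineE => x0; rewrite normrM (ger0_norm (expR_ge0 _)).
  have px : 0 <= p * x by rewrite mulr_ge0// ltW.
  have h1 : x `^ a <= (2 * expR (p * x / 2)) / p `^ a.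
    rewrite ler_pdivlMr// mulrC -powRM ?(ltW p0) ?(ltW x0)//.
    apply: (le_trans (powR_le1D px a01)).
    by have := expR_ge1Dx (p * x / 2); lra.
  apply: (@le_trans _ _ (expR (- (p * x)) * (M * ((2 * expR (p * x / 2)) / p `^ a)))).
    rewrite ler_wpM2l ?expR_ge0//; apply: (le_trans (HM _ x0)).
    by rewrite ler_wpM2l.
  rewrite (_ : expR (- (p * x)) * _ = 2 * M / p `^ a * (expR (- (p * x)) * expR (p * x / 2))).
    by rewrite -expRD (_ : - (p * x) + p * x / 2 = - (p / 2 * x))//; field.
  by field; rewrite gt_eqF.
rewrite RintegralZl// eE le_eqVlt; apply/orP; left; apply/eqP.
rewrite -/p; field; by rewrite !gt_eqF.
Qed.

(** Comparing the two Laplace bounds leaves [q^(2 a - 1) <= 4 M / c0] for all [q >= 1], impossible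
    since [2 a > 1]. *)
Lemma sin_tr_not_hoelder a M : 2^-1 < a <= 1 ->
  ~ (forall x, 0 < x -> `|sin_tr g x| <= M * x `^ a).
Proof.
move=> /andP[a2 a1] HM; have a01 : 0 <= a <= 1 by apply/andP; split; lra.
pose b := 2 * a - 1; have b0 : 0 < b by rewrite /b; lra.
have key q : 1 <= q -> q `^ b <= 4 * M / c0.
  move=> q1; have q0 : 0 < q by exact: lt_le_trans q1.
  have := le_trans (laplace_lower q1) (laplace_upper a01 HM q1).
  have -> : (q ^+ 2) `^ a = q `^ b * q.
    rewrite -(powR_mulrn 2 (ltW q0)) -powRrM -{3}(powRr1 (ltW q0)) -powRD.
      by rewrite /b subrK.
    by rewrite (gt_eqF q0) implybT.
  have qb : 0 < q `^ b by exact: powR_gt0.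
  move=> h1; rewrite ler_pdivlMr ?mulr_gt0// in h1.
  rewrite (_ : c0 * q ^- 3 * (q `^ b * q) = q `^ b * c0 * q ^- 2) in h1; last first.
    by field; rewrite gt_eqF.
  by rewrite ler_pM2r ?invr_gt0 ?exprn_gt0// in h1; rewrite ler_pdivlMr.
have key1 := key 1 (lexx _); rewrite powR1 in key1.
(* Here [q^b] exceeds the bound of [key] by one. *)
pose q := (4 * M / c0 + 1) `^ b^-1.
have K1 : 1 <= 4 * M / c0 + 1 by lra.
have q1 : 1 <= q.
  by rewrite /q -[leLHS](powRr0 (4 * M / c0 + 1)) ler_powR// invr_ge0 ltW.
have := key q q1.
rewrite /q -powRrM mulVf ?gt_eqF// powRr1 ?(le_trans ler01)//.
by lra.
Qed.

Lemma not_hoelder_space_kernel_32 s : 3 / 2 < s -> s \isn't a Num.int -> ~ hoelder_space s kernel_32.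
Proof.
move=> s32 sZ []; set k := Num.truncn s => dK [M1 HM1] [M HM].
have k1 : (1 <= k)%N by rewrite /k truncn_ge_nat; lra.
have ip : 0 < pi^-1 :> R by rewrite invr_gt0 pi_gt0.
have g0 : sin_tr g 0 = 0.
  transitivity (\int[mu]_(t in P) (0 : R)); last by rewrite /Rintegral integral0.
  by apply: integral_eq => t _; rewrite mul0r sin0 mulr0.
have [a [M' [a12 H]]] : exists a M', 2^-1 < a <= 1 /\ (forall x, 0 < x -> `|sin_tr g x| <= M' * x `^ a).
  (* Both cases compare the derivative at [x] with its value [0] at the origin. For [k >= 2] the
     bounded second derivative makes it Lipschitz, so [a = 1]; for [k = 1] the exponent is
     [a = s - 1], above [1/2]. *)
  have [k2|k2] := leqP 2 k.
    exists 1, (pi * M1); split; first by apply/andP; split; lra.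
    move=> x x0; rewrite powRr1 ?(ltW x0)//.
    have d1 (z : R) : z \in `]0, x[ -> is_derive z 1 (derive1 kernel_32) (derive1n 2 kernel_32 z).
      by move=> _; apply: DeriveDef; [exact: (dK 1%N z k2)|rewrite -derive1E].
    have cd : {within `[0, x], continuous (derive1 kernel_32)}.
      apply: continuous_subspaceT => z; apply: differentiable_continuous.
      by apply/derivable1_diffP; exact: (dK 1%N z k2).
    have [z _] := MVT x0 d1 cd.
    rewrite derive1_kernel_32 g0 mulr0 oppr0 !addr0 => E.
    have E' : - (pi^-1 * sin_tr g x) = derive1n 2 kernel_32 z * x by move: E; lra.
    have -> : sin_tr g x = - (pi * (derive1n 2 kernel_32 z * x)).
      by rewrite -E' mulrN opprK mulrA divff ?mul1r// gt_eqF ?pi_gt0.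
    rewrite normrN !normrM (gtr0_norm x0) (ger0_norm (pi_ge0 R)) mulrA.
    by rewrite ler_wpM2r ?(ltW x0)// ler_wpM2l ?pi_ge0// HM1.
  have kE : k = 1%N by apply/eqP; rewrite eqn_leq k1 -ltnS k2.
  exists (s - 1), (pi * M); split.
    have s2 : s < 2 by have := truncnS_gt s; rewrite -/k kE.
    by apply/andP; split; lra.
  move=> x x0; have := HM x 0; rewrite kE derive1n1 derive1_kernel_32 g0 mulr0 !oppr0 !(addr0, subr0).
  rewrite normrN normrM (gtr0_norm ip) (gtr0_norm x0) ler_pdivrMl ?pi_gt0//.
  by rewrite mulrA.
exact: (sin_tr_not_hoelder a12 H).
Qed.

End fixed_parameter.
End kernel_32.

(** * Analyticity from exponential decay of the symbol *)

Section analytic_cos_transform.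
Context {R : realType}.
Notation mu := (@lebesgue_measure R).
Notation P := (pos_line R).
Notation L1 A f := (mu.-integrable A (EFin \o f)).
Implicit Types (x y t h r u : R) (m G : R -> R).

Lemma cvg_cos_coeff u : series (cos_coeff u) @ \oo --> cos u.
Proof. by rewrite cos.unlock; exact: is_cvg_series_cos_coeff. Qed.

Lemma cvg_sin_coeff u : series (sin_coeff u) @ \oo --> sin u.
Proof. by rewrite sin.unlock; exact: is_cvg_series_sin_coeff. Qed.

Lemma series_exp_coeff_le u n : 0 <= u -> series (exp_coeff u) n <= expR u.
Proof.
move=> u0; apply: nondecreasing_cvgn_le; last exact: is_cvg_series_exp_coeff.
apply/nondecreasing_seqP => k; rewrite /series /= big_nat_recr//= lerDl.
exact: exp_coeff_ge0.
Qed.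

Lemma exp_coeff_le u n : 0 <= u -> u ^+ n / n`!%:R <= expR u.
Proof.
move=> u0; apply: le_trans (series_exp_coeff_le n.+1 u0).
rewrite /series /= big_nat_recr//= lerDr sumr_ge0// => i _.
exact: exp_coeff_ge0.
Qed.

(* [t ^ n / n!] times the [n]-th derivative of [cos] at [x * t]. *)
Let tau x n t : R := (cos (x * t) * ((~~ odd n)%:R * (-1) ^+ n./2 / n`!%:R) -
  sin (x * t) * ((odd n)%:R * (-1) ^+ n.-1./2 / n`!%:R)) * t ^+ n.

Let tau_bound x n t : 0 <= t -> `|tau x n t| <= t ^+ n / n`!%:R.
Proof.
move=> t0; have f0 : 0 < n`!%:R :> R by rewrite ltr0n fact_gt0.
rewrite /tau normrM (ger0_norm (exprn_ge0 n t0)) mulrC ler_wpM2l ?exprn_ge0//.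
case: (odd n) => /=.
  rewrite !mul0r mulr0 sub0r normrN mul1r normrM normrM normrX normrN1 expr1n mul1r.
  by rewrite (gtr0_norm (_ : 0 < n`!%:R^-1)) ?invr_gt0// ler_piMl ?invr_ge0 ?(ltW f0)// norm_sin_le1.
rewrite !mul0r mulr0 subr0 mul1r normrM normrM normrX normrN1 expr1n mul1r.
by rewrite (gtr0_norm (_ : 0 < n`!%:R^-1)) ?invr_gt0// ler_piMl ?invr_ge0 ?(ltW f0)// norm_cos_le1.
Qed.

Let tau_series x h t n : \sum_(0 <= k < n) (tau x k t * h ^+ k) =
  cos (x * t) * series (cos_coeff (h * t)) n - sin (x * t) * series (sin_coeff (h * t)) n.
Proof.
rewrite /series /= !mulr_sumr -sumrB; apply: eq_bigr => k _.
rewrite /tau /cos_coeff /sin_coeff /= -exprnP !exprMn.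
move: (~~ odd k)%:R (odd k)%:R ((-1) ^+ k./2) ((-1) ^+ k.-1./2) (k`!%:R^-1) => a b c d f.
by move: (t ^+ k) (h ^+ k) => tk hk; ring.
Qed.

Let cvg_tau_series x h t :
  \sum_(0 <= k < n) (tau x k t * h ^+ k) @[n --> \oo] --> cos ((x + h) * t).
Proof.
rewrite mulrDl cosD; under eq_fun do rewrite tau_series.
by apply: cvgB; (apply: cvgM; first exact: cvg_cst); [exact: cvg_cos_coeff|exact: cvg_sin_coeff].
Qed.

Let tau_series_bound x h t n : 0 <= t ->
  `|\sum_(0 <= k < n) (tau x k t * h ^+ k)| <= expR (`|h| * t).
Proof.
move=> t0; apply: (le_trans (ler_norm_sum _ _ _)).
apply: le_trans (series_exp_coeff_le n (mulr_ge0 (normr_ge0 h) t0)).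
apply: ler_sum => k _; rewrite /exp_coeff/= normrM normrX exprMn mulrC -mulrA.
by rewrite ler_wpM2l ?exprn_ge0// tau_bound.
Qed.

Let measurable_tau x n : measurable_fun P (tau x n).
Proof.
apply: measurable_funM.
  by apply: measurable_funB; apply: measurable_funM => //;
    [exact: measurable_cos_mul|exact: measurable_sin_mul].
by apply: measurable_funTS; apply: continuous_measurable_fun; exact: exprn_continuous.
Qed.

(** The cosine is expanded in powers of [x - x0] under the integral. The partial sums are bounded by
    [e^(|x - x0| t)], so [G] dominates as long as [|x - x0| < r]; the same radius serves at every
    point [x0]. *)
Lemma real_analytic_cos_tr m G r : 0 < r -> measurable_fun P m -> L1 P G ->
  (forall t, 0 < t -> `|m t| * expR (r * t) <= G t) -> real_analytic (cos_tr m).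
Proof.
move=> r0 mm iG mG x0.
have itau n : L1 P (fun t => m t * tau x0 n t).
  apply: (@integrable_le _ _ _ (fun t => r ^- n * G t)) => //.
  - by apply: measurable_funM => //; exact: measurable_tau.
  - exact: integrable_scale.
  move=> t; rewrite pos_lineE => t0; rewrite normrM.
  have rt : 0 <= r * t by rewrite mulr_ge0// ltW.
  rewrite ler_pdivlMl ?exprn_gt0//; apply: le_trans (mG _ t0).
  rewrite mulrCA ler_wpM2l//; apply: le_trans (exp_coeff_le n rt).
  by rewrite exprMn -mulrA ler_wpM2l ?exprn_ge0 ?(ltW r0)// tau_bound// ltW.
exists (fun n => \int[mu]_(t in P) (m t * tau x0 n t)), r; split => // x xr.
pose h := x - x0.
(* Identity and integrability go through the induction together, since adding a term under the
   integral requires the integrability of the previous partial sum. *)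
have E n : pseries (fun n => \int[mu]_(t in P) (m t * tau x0 n t)) h n =
    \int[mu]_(t in P) (m t * \sum_(0 <= k < n) (tau x0 k t * h ^+ k)) /\
    L1 P (fun t => m t * \sum_(0 <= k < n) (tau x0 k t * h ^+ k)).
  elim: n => [|n [IHn IHi]].
    have e t : P t -> 0 = m t * \sum_(0 <= k < 0) (tau x0 k t * h ^+ k) :> R.
      by rewrite big_geq// mulr0.
    split; last by apply: (integrable_eq (@measurable_pos_line R) _ e); exact: integrable0.
    rewrite /pseries /series /= big_geq//; rewrite -(integral_eq e).
    by rewrite /Rintegral integral0.
  have e t : P t -> m t * \sum_(0 <= k < n) (tau x0 k t * h ^+ k) + h ^+ n * (m t * tau x0 n t) =
      m t * \sum_(0 <= k < n.+1) (tau x0 k t * h ^+ k).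
    by move=> _; rewrite big_nat_recr//=; ring.
  have ih : L1 P (fun t => h ^+ n * (m t * tau x0 n t)) by exact: integrable_scale.
  split; last by apply: (integrable_eq (@measurable_pos_line R) _ e); exact: integrable_sum.
  rewrite -(integral_eq e) RintegralD// RintegralZl// -IHn.
  by rewrite /pseries /series /= big_nat_recr//= mulrC.
have -> : cos_tr m x = \int[mu]_(t in P) (m t * cos ((x0 + h) * t)).
  by apply: integral_eq => t _; rewrite /h addrC subrK.
have [||||_ hcv] := @dominated_cvgn R P
  (fun n t => m t * \sum_(0 <= k < n) (tau x0 k t * h ^+ k))
  (fun t => m t * cos ((x0 + h) * t)) G (@measurable_pos_line R).
- by move=> n; exact: integrable_measurable (E n).2.
- by move=> t _; apply: cvgM; [exact: cvg_cst|exact: cvg_tau_series].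
- exact: iG.
- move=> n t; rewrite pos_lineE => t0; apply: le_trans (mG _ t0).
  rewrite normrM ler_wpM2l//; apply: (le_trans (tau_series_bound _ _ _ (ltW t0))).
  by rewrite ler_expR ler_wpM2r// ltW.
by rewrite (_ : pseries _ _ = (fun n => \int[mu]_(t in P)
    (m t * \sum_(0 <= k < n) (tau x0 k t * h ^+ k)))) //; apply/funext => n; exact: (E n).1.
Qed.

Lemma real_analytic_scale c f : real_analytic f -> real_analytic (fun x => c * f x).
Proof.
move=> fa x0; have [a [r [r0 H]]] := fa x0.
exists (fun n => c * a n), r; split => // x xr.
have -> : pseries (fun n => c * a n) (x - x0) = (fun n => c * pseries a (x - x0) n).
  apply/funext => n; rewrite /pseries /series /= mulr_sumr.
  by apply: eq_bigr => i _; rewrite mulrA.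
by apply: cvgM; [exact: cvg_cst|exact: H].
Qed.

Definition kernel_omega (T : R) x : R := pi^-1 * cos_tr (symbol_omega T) x.

Lemma real_analytic_kernel_omega (T : R) : 0 < T -> real_analytic (kernel_omega T).
Proof.
move=> T0; apply: real_analytic_scale.
have half_gt0 : 0 < 2^-1 :> R by rewrite invr_gt0.
have [wi _] := integrable_sqrt_weight half_gt0.
apply: (@real_analytic_cos_tr _ (fun x => 2 * sqrt_weight 2^-1 x) 2^-1) => //.
- exact: measurable_symbol_omega.
- exact: integrable_scale.
- by move=> t t0; rewrite (mulrC 2^-1); exact: symbol_omega_half_le.
Qed.

End analytic_cos_transform.

(** * Exponential decay *)

Section reflection.
Context {R : realType}.
Notation mu := (@lebesgue_measure R).
Notation P := (pos_line R).
Notation L1 A f := (mu.-integrable A (EFin \o f)).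
Implicit Types (f g : R -> R) (c x y : R).

Let refl c : R -> measurableTypeR R := fun x => c - x.

Let measurable_refl c : measurable_fun setT (refl c).
Proof. by apply: continuous_measurable_fun => x; apply: cvgB; [exact: cvg_cst|exact: cvg_id]. Qed.

(** By uniqueness it suffices to compare the measures on half-open intervals; reflection moves the
    closed end to the other side, which does not change the length. *)
Lemma lebesgue_measure_reflect c (A : set R) : measurable A ->
  pushforward mu (refl c) A = mu A.
Proof.
move=> mA; apply/esym/lebesgue_measure_unique => //=.
  exact: measurable_refl.
move=> _ _ [[a b]] _ <-.
rewrite /pushforward (_ : refl c @^-1` _ = `[c - b, c - a[%classic); last first.
  apply/seteqP; split=> x; rewrite /refl /= !in_itv/= => /andP[h1 h2];
    by apply/andP; split; lra.
rewrite !lebesgue_measure_itv/= !lte_fin ltrD2l ltrN2.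
by case: ifP => // _; rewrite -!EFinB; congr EFin; ring.
Qed.

Lemma integral_reflect c (D : set R) f : measurable D -> measurable_fun setT f ->
  L1 ((fun x => c - x) @^-1` D) (fun x => f (c - x)) ->
  L1 D f /\ \int[mu]_(x in D) f x = \int[mu]_(x in (fun x => c - x) @^-1` D) f (c - x).
Proof.
move=> mD mf fi.
have mf' : measurable_fun (setT : set (measurableTypeR R)) (EFin \o f) by exact/measurable_EFinP.
have E : forall A, measurable A -> A `<=` D -> mu A = pushforward mu (refl c) A.
  by move=> A mA _; rewrite lebesgue_measure_reflect.
have F (h : measurableTypeR R -> \bar R) : (\int[mu]_(x in D) h x = \int[pushforward mu (refl c)]_(x in D) h x)%E.
  apply: eq_measure_integral; first exact: measurable_refl.
  by move=> m A mA AD /=; exact: E.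
split.
  apply/integrableP; split; first exact: measurable_funTS.
  move/integrableP : fi => [_]; apply: le_lt_trans.
  rewrite F ge0_integral_pushforward//; first exact: measurable_refl.
  by apply: measurable_funTS; apply: (measurableT_comp (f := abse)) mf'.

rewrite /Rintegral; congr fine; rewrite F.
by apply: integral_pushforward => //; exact: measurable_refl.
Qed.

Lemma integrable_union (A B : set R) f : measurable A -> measurable B -> [disjoint A & B] ->
  measurable_fun setT f -> L1 A f -> L1 B f -> L1 (A `|` B) f.
Proof.
move=> mA mB AB mf fA fB.
have mf' : measurable_fun setT (EFin \o f) by exact/measurable_EFinP.
apply/integrableP; split; first exact: measurable_funTS.
rewrite ge0_integral_setU//.
  by apply: lte_add_pinfty; [exact: (integrableP _ _ _ fA).2|exact: (integrableP _ _ _ fB).2].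
by apply: measurable_funTS; apply: (measurableT_comp (f := abse)) mf'.
Qed.

Lemma integral_symmetrize f : measurable_fun setT f -> L1 P f -> L1 P (fun x => f (- x)) ->
  L1 setT f /\ \int[mu]_x f x = \int[mu]_(x in P) (f x + f (- x)).
Proof.
move=> mf fi fi'.
have mf' : measurable_fun setT (EFin \o f) by exact/measurable_EFinP.
pose N : set R := `]-oo, 0[%classic.
have mN : measurable N by exact: measurable_itv.
have pN : (fun x => 0 - x) @^-1` N = P.
  by apply/seteqP; split=> x; rewrite /N /= !in_itv/= andbT sub0r oppr_lt0.
have fE : (fun x => f (0 - x)) = (fun x => f (- x)) by apply/funext => x; rewrite sub0r.
have [iN EN] : L1 N f /\ \int[mu]_(x in N) f x = \int[mu]_(x in P) f (- x).
  by have := @integral_reflect 0 N f mN mf; rewrite pN fE; apply.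
have i0 : L1 `[0, +oo[ f.
  apply/integrableP; split; first exact: measurable_funTS.
  rewrite -integral_itv_obnd_cbnd; first exact: (integrableP _ _ _ fi).2.
  by apply: measurable_funTS; apply: (measurableT_comp (f := abse)) mf'.
have UE : setT = N `|` `[0, +oo[ :> set R.
  by apply/esym/seteqP; split=> // x _; rewrite /N/= !in_itv/= andbT; case: (ltP x 0); [left|right].
have dj : [disjoint N & `[0, +oo[%classic].
  apply/disj_setPS => x []; rewrite /N /= !in_itv/= andbT => x0.
  by rewrite leNgt x0.
have iT : L1 (N `|` `[0, +oo[) f by exact: integrable_union.
split; first by rewrite UE.
rewrite UE Rintegral_setU//.
by rewrite EN -Rintegral_itv_obnd_cbnd// addrC -RintegralD.
Qed.

(** Splits the singular function into a bounded part, which dominates for [|z| > 1], and an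
    integrable part, which dominates near [0] and whose integral is invariant under translation. *)
Lemma inv_sqrt_le (z : R) : (Num.sqrt `|z|)^-1 <= 1 + 2 * sqrt_weight 1 `|z|.
Proof.
have [->|z0] := eqVneq z 0; first by rewrite normr0 sqrtr0 invr0 /sqrt_weight sqrtr0 invr0 mul0r mulr0 addr0.
have a0 : 0 < `|z| by rewrite normr_gt0.
rewrite /sqrt_weight mul1r; move: `|z| a0 => a a0.
have sa : 0 < Num.sqrt a by rewrite sqrtr_gt0.
have [a1|/ltW a1] := leP 1 a.
  apply: (@le_trans _ _ 1).
    by rewrite invf_le1// -sqrtr1 ler_wsqrtr.
  by rewrite lerDl !mulr_ge0 ?invr_ge0// addr_ge0// ltW.
apply: (@le_trans _ _ (2 * ((Num.sqrt a)^-1 / (1 + a)))); last by rewrite lerDr.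
rewrite mulrCA ler_peMr ?invr_ge0// ler_pdivlMr ?addr_gt0//.
by lra.
Qed.

Let phi (z : R) := sqrt_weight 1 `|z|.

Let measurable_phi : measurable_fun setT phi.
Proof.
apply: measurable_funM.
  apply: measurable_funV; apply: continuous_measurable_fun => x.
  by apply: continuous_cvg; [exact: sqrt_continuous|exact: norm_continuous].
apply: measurable_funV; apply: continuous_measurable_fun => x.
by apply: cvgD; [exact: cvg_cst|apply: cvgMl_tmp; exact: norm_continuous].
Qed.

Let phi_ge0 z : 0 <= phi z.
Proof. by rewrite /phi /sqrt_weight mulr_ge0// invr_ge0// addr_ge0// mulr_ge0. Qed.

Let integrable_phi : L1 setT phi /\ \int[mu]_x phi x = 2 * pi.
Proof.
have [wi wE] := integrable_sqrt_weight (@ltr01 R).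
have e1 x : P x -> sqrt_weight 1 x = phi x.
  by rewrite pos_lineE => x0; rewrite /phi gtr0_norm.
have e2 x : P x -> sqrt_weight 1 x = phi (- x).
  by rewrite pos_lineE => x0; rewrite /phi normrN gtr0_norm.
have [i ->] := @integral_symmetrize phi measurable_phi
  (integrable_eq (@measurable_pos_line R) wi e1) (integrable_eq (@measurable_pos_line R) wi e2).
split => //.
rewrite (_ : \int[mu]_(x in P) _ = \int[mu]_(x in P) (2 * sqrt_weight 1 x)).
  by rewrite RintegralZl// wE sqrtr1 divr1.
by apply: integral_eq => x Px; rewrite -e1// -e2//; ring.
Qed.

Let phi_translate x : L1 setT (fun y => phi (x - y)) /\ \int[mu]_y phi (x - y) = 2 * pi.
Proof.
have [i <-] := integrable_phi.
have mphi : measurable_fun setT (fun y => phi (x - y)).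
  apply: measurableT_comp; first exact: measurable_phi.
  by apply: measurable_funB => //; exact: measurable_cst.
have fE : (fun y => phi (x - (x - y))) = phi.
  by apply/funext => y; congr phi; ring.
have := @integral_reflect x setT _ measurableT mphi.
rewrite preimage_setT fE; apply; exact: i.
Qed.

(** The bound does not depend on [x]. By [inv_sqrt_le] the integrand is at most
    [2 e^(- b y) + 2 phi (x - y)], the exponential in front of [phi] being at most [1]; the
    integrals are [2 / b] and at most [2 * (2 pi)]. *)
Lemma singular_convolution_bound b x : 0 < b ->
  L1 P (fun y => expR (- (b * y)) * (1 + (Num.sqrt `|x - y|)^-1)) /\
  \int[mu]_(y in P) (expR (- (b * y)) * (1 + (Num.sqrt `|x - y|)^-1)) <= 2 / b + 4 * pi.
Proof.
move=> b0; have [ei eE] := integrable_expNM b0.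
have [pi1 pE] := phi_translate x.
have pP : L1 P (fun y => phi (x - y)) by apply: integrableS pi1.
have pPle : \int[mu]_(y in P) phi (x - y) <= 2 * pi.
  rewrite -pE /Rintegral; apply: fine_le; [exact: integrable_fin_num..|].
  apply: ge0_subset_integral => //; first exact: (measurable_int mu).
  by move=> y _; rewrite lee_fin.
have iG : L1 P (fun y => 2 * expR (- (b * y)) + 2 * phi (x - y)).
  by apply: integrable_sum => //; exact: integrable_scale.
have ptw y : 0 < y -> `|expR (- (b * y)) * (1 + (Num.sqrt `|x - y|)^-1)| <=
    2 * expR (- (b * y)) + 2 * phi (x - y).
  move=> y0; have e0 := expR_ge0 (- (b * y)).
  have e1 : expR (- (b * y)) <= 1 by rewrite -expR0 ler_expR oppr_le0 mulr_ge0// ltW.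
  have s0 : 0 <= (Num.sqrt `|x - y|)^-1 by rewrite invr_ge0.
  rewrite ger0_norm ?mulr_ge0 ?addr_ge0//.
  have h := inv_sqrt_le (x - y); rewrite -/(phi (x - y)) in h.
  have p0 := phi_ge0 (x - y).
  by nra.
have mf : measurable_fun P (fun y => expR (- (b * y)) * (1 + (Num.sqrt `|x - y|)^-1)).
  apply: measurable_funM; first exact: measurable_expNM.
  apply: measurable_funD => //; apply: measurable_funV; apply: measurable_funTS.
  apply: continuous_measurable_fun => y.
  apply: continuous_cvg; first exact: sqrt_continuous.
  apply: continuous_cvg; first exact: norm_continuous.
  by apply: cvgB => //; exact: cvg_cst.
have i1 : L1 P (fun y => expR (- (b * y)) * (1 + (Num.sqrt `|x - y|)^-1)).
  by apply: (integrable_le _ mf iG) => // y; rewrite pos_lineE; exact: ptw.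
split => //; apply: (@le_trans _ _ (\int[mu]_(y in P) (2 * expR (- (b * y)) + 2 * phi (x - y)))).
  by apply: le_Rintegral => // y; rewrite pos_lineE => /ptw; apply: le_trans; exact: ler_norm.
rewrite RintegralD//; [|exact: integrable_scale..].
rewrite !RintegralZl// eE; lra.
Qed.

End reflection.

(** * The contraction in a weighted supremum norm *)

Section decay_bootstrap.
Context {R : realType}.
Notation mu := (@lebesgue_measure R).
Notation P := (pos_line R).
Notation L1 A f := (mu.-integrable A (EFin \o f)).
Implicit Types (f g G k : R -> R) (a x y z b d : R).

(** In the convolution [G (x - y)] is controlled by [|x - y|^(-1/2)] only for [y] different from
    [x]; this one point is removed as a null set. *)
Lemma le_integral_bound_off a f g : measurable_fun P f -> L1 P g ->
  (forall y, 0 < y -> y != a -> `|f y| <= g y) ->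
  `|\int[mu]_(y in P) f y| <= \int[mu]_(y in P) g y.
Proof.
move=> mf ig fg.
have mg := integrable_measurable ig.
have mP := @measurable_pos_line R.
have mD : measurable (P `\ a) by apply: measurableD.
have DP : P `\ a `<=` P by move=> ? [].
have E h : measurable_fun P h -> \int[mu]_(y in P) h y = \int[mu]_(y in P `\ a) h y.
  move=> mh; rewrite /Rintegral integral_setD1//.
  by apply/measurable_EFinP; exact: measurable_funS mh.
rewrite !E//; apply: le_integral_bound => //.
- exact: measurable_funS mf.
- exact: integrableS ig.
- by move=> y []; rewrite pos_lineE => y0 /eqP; exact: fg.
Qed.

Definition truncated_weight d n x := expR (d * Num.min `|x| n).

(** The truncation keeps [|x|] Lipschitz with constant [1], so the weight changes by at most
    [e^(d y)] under a shift by [y]. The kernel [k], of size [e^(- (b + d) y)], compensates this and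
    keeps [e^(- b y)]. *)
Lemma truncated_weight_shift d n x y : 0 <= d -> 0 <= y ->
  truncated_weight d n x <= truncated_weight d n (x - y) * expR (d * y) /\
  truncated_weight d n x <= truncated_weight d n (x + y) * expR (d * y).
Proof.
move=> d0 y0; rewrite /truncated_weight -!expRD !ler_expR -!mulrDr.
have h z : `|x| <= `|z| + y -> d * Num.min `|x| n <= d * (Num.min `|z| n + y).
  move=> xz; apply: ler_wpM2l => //; rewrite addr_minl le_min !ge_min xz/=.
  by rewrite lerDl y0 orbT.
split; apply: h.
  by have := ler_normD (x - y) y; rewrite subrK (ger0_norm y0).
by have := ler_normD (x + y) (- y); rewrite addrK normrN (ger0_norm y0).
Qed.

(* The weight is truncated at [n] so that the supremum below is finite; the
   bound obtained does not depend on [n] as soon as [eta] tends to [0]. *)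
Lemma decay_bootstrap G k b d (C eta n : R) : 0 <= d -> 0 < b -> 0 <= C -> 0 <= eta ->
  let S := 2 / b + 4 * pi in let A := 2 * S in
  continuous G -> measurable_fun P k ->
  (forall y, G (- y) = G y) ->
  (forall y, 0 < y -> `|k y| <= expR (- ((b + d) * y))) ->
  (forall z, z != 0 -> `|G z| <= C * (1 + (Num.sqrt `|z|)^-1)) ->
  (forall x, 0 < x ->
    `|x * G x| <= 2^-1 * `|\int[mu]_(y in P) (k y * (G (x - y) - G (x + y)))| + eta) ->
  forall x, A <= `|x| ->
  `|G x| * truncated_weight d n x <= C * expR (d * A) + 2 * (eta * expR (d * n)).
Proof.
move=> d0 b0 C0 eta0 S A cG mk Geven kle Gle GI.
have pi0 := @pi_gt0 R; have pi2 := @pi_ge2 R.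
have b10 : 0 < b^-1 by rewrite invr_gt0.
have S4 : 8 <= S by rewrite /S; lra.
have A1 : 1 <= A by rewrite /A; lra.
pose w := truncated_weight d n.
have w0 z : 0 < w z by exact: expR_gt0.
have wn z : w z <= expR (d * n).
  by rewrite ler_expR ler_wpM2l// ge_min lexx orbT.
pose B := C * expR (d * A).
have B0 : 0 <= B by rewrite mulr_ge0 ?expR_ge0.
pose E : set R := [set t | exists2 z, A <= `|z| & t = `|G z| * w z].
(* One application of the equation: a bound [M] for the weighted function outside the ball of radius
   [A] improves to [(M + B) / 2] plus the error. The choice [A = 2 S] produces the factor [1/2],
   since the two shifted terms contribute [(M + B) S] to [x * |G x| * w x]. *)
have step M : 0 <= M -> (forall z, A <= `|z| -> `|G z| * w z <= M) ->
    forall x, A <= x -> `|G x| * w x <= (M + B) / 2 + eta * expR (d * n).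
  move=> M0 hM x Ax; have x0 : 0 < x by lra.
  (* Outside the ball the assumed bound [M] applies; inside it the weight is at most [e^(d A)] and
     the a priori bound on [G] gives [B]. *)
  have GwM z : z != 0 -> `|G z| * w z <= (M + B) * (1 + (Num.sqrt `|z|)^-1).
    move=> z0; have s0 : 0 <= (Num.sqrt `|z|)^-1 by rewrite invr_ge0.
    have [Az|zA] := leP A `|z|; first by have := hM _ Az; nra.
    have h : w z <= expR (d * A).
      by rewrite ler_expR ler_wpM2l// ge_min (ltW zA).
    have h1 : `|G z| * w z <= C * (1 + (Num.sqrt `|z|)^-1) * expR (d * A).
      by apply: ler_pM => //; [exact: ltW|exact: Gle].
    apply: (le_trans h1); rewrite mulrAC -/B ler_wpM2r// ?addr_ge0// lerDr//.
  have [c1 c1le] := singular_convolution_bound x b0.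
  have [c2 c2le] := singular_convolution_bound (- x) b0.
  rewrite -/S in c1le c2le.
  set I := \int[mu]_(y in P) _ in c1le; set I2 := \int[mu]_(y in P) _ in c2le.
  set c := (M + B) / w x.
  have key : `|\int[mu]_(y in P) (k y * (G (x - y) - G (x + y)))| <= c * I + c * I2.
    rewrite -!RintegralZl// -RintegralD//; [|exact: integrable_scale..].
    apply: (@le_integral_bound_off x).
    - apply: measurable_funM => //; apply: measurable_funTS.
      apply: continuous_measurable_fun => y; apply: cvgB.
        apply: continuous_comp; last exact: cG.
        by apply: cvgB; [exact: cvg_cst|exact: cvg_id].
      apply: continuous_comp; last exact: cG.
      by apply: cvgD; [exact: cvg_cst|exact: cvg_id].
    - by apply: integrable_sum => //; exact: integrable_scale.
    - move=> y y0 yx.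
      have [w1 w2] := truncated_weight_shift n x d0 (ltW y0); rewrite -!/(w _) in w1 w2.
      have z1 : x - y != 0 by rewrite subr_eq0 eq_sym.
      have z2 : x + y != 0 by rewrite gt_eqF// addr_gt0.
      have g1 := GwM _ z1; have g2 := GwM _ z2.
      have -> : - x - y = - (x + y) by ring.
      rewrite normrN normrM !(mulrAC _ (w x)^-1) -mulrDl ler_pdivlMr// mulrC.
      have ke := kle _ y0.
      have eE : expR (- (b * y)) = expR (- ((b + d) * y)) * expR (d * y).
        by rewrite -expRD; congr expR; ring.
      have ed := expR_gt0 (d * y); have eb := expR_gt0 (- ((b + d) * y)).
      apply: (@le_trans _ _ (w x * (expR (- ((b + d) * y)) * (`|G (x - y)| + `|G (x + y)|)))).
        apply: ler_wpM2l; first exact: ltW.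
        apply: ler_pM => //; exact: ler_normB.
      rewrite eE; move: (expR (d * y)) (expR (- _)) ed eb w1 w2 {eE ke} => D F D0 F0 w1 w2.
      set p := `|G (x - y)| in g1 *; set q := `|G (x + y)| in g2 *.
      have p0 : 0 <= p by exact: normr_ge0.
      have q0 : 0 <= q by exact: normr_ge0.
      apply: (@le_trans _ _ (F * D * (p * w (x - y) + q * w (x + y)))).
        rewrite (_ : F * D * _ = F * (p * (w (x - y) * D) + q * (w (x + y) * D))); last by ring.
        rewrite mulrCA; apply: ler_wpM2l; first exact: ltW.
        by rewrite mulrDr ![w x * _]mulrC; apply: lerD; apply: ler_wpM2l.
      rewrite ![(M + B) * (_ * _)]mulrCA -mulrDr; apply: ler_wpM2l; last exact: lerD.
      by rewrite mulr_ge0// ltW.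
  have h := GI x x0.
  have {}key : w x * `|\int[mu]_(y in P) (k y * (G (x - y) - G (x + y)))| <=
      (M + B) * S + (M + B) * S.
    rewrite mulrC -ler_pdivlMr// mulrDl !(mulrAC _ S); apply: (le_trans key).
    by apply: lerD; apply: ler_wpM2l => //; rewrite divr_ge0 ?addr_ge0// ltW.
  move: (\int[mu]_(y in P) _) key h => J key h.
  rewrite normrM (gtr0_norm x0) in h.
  have h2 : x * `|G x| * w x <= (M + B) * S + eta * expR (d * n).
    apply: (@le_trans _ _ ((2^-1 * `|J| + eta) * w x)); first by rewrite ler_wpM2r// ltW.
    rewrite mulrDl; apply: lerD; last by rewrite ler_wpM2l.
    have -> : 2^-1 * `|J| * w x = 2^-1 * (w x * `|J|) by ring.
    by lra.
  have u0 : 0 <= `|G x| * w x by rewrite mulr_ge0// ltW.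
  have v0 : 0 <= eta * expR (d * n) by rewrite mulr_ge0// expR_ge0.
  have h3 : A * (`|G x| * w x) <= (M + B) * S + eta * expR (d * n).
    by apply: le_trans h2; rewrite -mulrA ler_wpM2r.
  rewrite /A in h3.
  move: (`|G x| * w x) (eta * expR (d * n)) u0 v0 h3 => u v u0 v0 h3.
  have S0 : 0 < 2 * S by lra.
  rewrite -(ler_pM2l S0); apply: (le_trans h3).
  have -> : 2 * S * ((M + B) / 2 + v) = (M + B) * S + 2 * S * v by field.
  by rewrite lerD2l ler_peMl//; lra.
have E0 : E !=set0 by exists (`|G A| * w A), A => //; exact: ler_norm.
(* Here the truncation enters: the weight is at most [e^(d n)], and [|G|] is at most [2 C] since
   [A >= 1]. *)
have Eub : has_ubound E.
  exists (C * 2 * expR (d * n)) => _ [z Az ->].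
  have z0 : z != 0 by apply/eqP => z0; move: Az; rewrite z0 normr0; lra.
  apply: ler_pM => //; first exact: ltW.
  apply: (le_trans (Gle _ z0)); rewrite ler_wpM2l// -[leRHS]/(1 + 1) lerD2l.
  by rewrite invf_le1 ?sqrtr_gt0 ?normr_gt0// -sqrtr1 ler_wsqrtr// (le_trans A1).
have hM z : A <= `|z| -> `|G z| * w z <= sup E.
  by move=> Az; apply: sup_upper_bound => //; exists z.
have M0 : 0 <= sup E.
  by apply: le_trans (hM A (ler_norm _)); rewrite mulr_ge0// ltW.
have stepE z : A <= `|z| -> `|G z| * w z <= (sup E + B) / 2 + eta * expR (d * n).
  move=> Az.
  have [z0|z0] := leP 0 z; first by apply: step => //; rewrite ger0_norm in Az.
  rewrite -Geven -[z in w z]opprK /w /truncated_weight normrN.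
  by apply: step => //; rewrite ltr0_norm in Az.
(* The improved bound holds for every element of [E], hence for its finite supremum, and can be
   solved for [sup E]. *)
have : sup E <= (sup E + B) / 2 + eta * expR (d * n).
  by apply: ge_sup => // _ [z Az ->]; exact: stepE.
move=> hs x Ax; have := hM x Ax; rewrite -/w -/B; lra.
Qed.

End decay_bootstrap.

(** * The convolution equation and the decay of the undamped transform *)

Section kernel_decay.
Context {R : realType}.
Notation mu := (@lebesgue_measure R).
Notation P := (pos_line R).
Notation L1 A f := (mu.-integrable A (EFin \o f)).
Implicit Types (x y z t e d : R).

Section fixed_parameter.
Variable T : R.
Hypothesis T_gt0 : 0 < T.
Let sT : 0 < Num.sqrt T. Proof. by rewrite sqrtr_gt0. Qed.

(** The exponential has sine transform [T x / (1 + T x^2)]; the subtracted term has sine transform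
    [1 / (2 x) - 1 / sinh (2 x)] by [integral_sin_fermi]. *)
Definition slope_density y : R := expR (- ((Num.sqrt T)^-1 * y)) - (expR (pi / 2 * y) + 1)^-1.

Lemma continuous_slope_density : continuous slope_density.
Proof.
move=> y; apply: cvgB; first exact: continuous_expNM.
apply: cvgV; first by rewrite gt_eqF// addr_gt0 ?expR_gt0.
apply: cvgD; last exact: cvg_cst.
apply: continuous_comp; last exact: continuous_expR.
by apply: cvgMl_tmp; exact: cvg_id.
Qed.

Lemma delta_star_gt0 : 0 < delta_star T.
Proof.
have p0 := @pi_gt0 R.
by rewrite /delta_star; case: ifP => // _; rewrite lt_min !divr_gt0.
Qed.

(** In general both terms are positive and each is below the majorant, hence so is the absolute
    value of their difference. If [T = 4 / pi^2] the first term is [1 / v] with [v = e^(pi y / 2)],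
    and [1 / v - 1 / (v + 1) = 1 / (v (v + 1))] is at most [e^(- pi y)]. *)
Lemma slope_density_le y : 0 < y -> `|slope_density y| <= expR (- (delta_star T * y)).
Proof.
move=> y0; have p0 := @pi_gt0 R.
have fe := fermi_le y0.
have f0 : 0 < (expR (pi / 2 * y) + 1)^-1 by rewrite invr_gt0 addr_gt0 ?expR_gt0.
rewrite /slope_density /delta_star; case: ifPn => [/eqP TE|_].
  have -> : (Num.sqrt T)^-1 = pi / 2.
    rewrite TE (_ : 4 / pi ^+ 2 = (2 / pi) ^+ 2); last by rewrite expr_div_n; congr (_ / _); ring.
    by rewrite sqrtr_sqr gtr0_norm ?divr_gt0// invf_div.
  have -> : expR (- (pi * y)) = expR (- (pi / 2 * y)) * expR (- (pi / 2 * y)).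
    by rewrite -expRD; congr expR; field.
  rewrite expRN; move: (expR_gt0 (pi / 2 * y)); set v := expR _ => v0.
  have v1 : 0 < v + 1 by lra.
  have -> : v^-1 - (v + 1)^-1 = v^-1 * (v + 1)^-1.
    by field; rewrite !gt_eqF.
  rewrite ger0_norm; last by rewrite mulr_ge0 ?invr_ge0// ltW.
  by rewrite ler_pM2l ?invr_gt0// lef_pV2 ?posrE// lerDl.
set ds := Num.min _ _.
have h1 : expR (- ((Num.sqrt T)^-1 * y)) <= expR (- (ds * y)).
  by rewrite ler_expR lerN2 ler_wpM2r ?(ltW y0)// ge_min div1r lexx.
have h2 : expR (- (pi / 2 * y)) <= expR (- (ds * y)).
  by rewrite ler_expR lerN2 ler_wpM2r ?(ltW y0)// ge_min lexx orbT.
have e0 := expR_gt0 (- ((Num.sqrt T)^-1 * y)).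
rewrite ler_norml; apply/andP; split; lra.
Qed.

Lemma integrable_slope_density : L1 P slope_density.
Proof.
have [ei _] := integrable_expNM delta_star_gt0.
apply: (integrable_le _ _ ei) => //.
  by apply: measurable_funTS; apply: continuous_measurable_fun; exact: continuous_slope_density.
by move=> y; rewrite pos_lineE; exact: slope_density_le.
Qed.

Lemma log_slopeE x : 0 < x -> log_slope T x = sin_tr slope_density x.
Proof.
move=> x0; rewrite /sin_tr /slope_density.
have sT' : 0 < (Num.sqrt T)^-1 by rewrite invr_gt0.
have [ei _] := integrable_expNM sT'.
have fi : L1 P (fun y => (expR (pi / 2 * y) + 1)^-1).
  have := integrable_diff (@measurable_pos_line R) ei integrable_slope_density.
  by move=> /integrable_eq; apply => // y _; rewrite /slope_density; ring.
rewrite (_ : \int[mu]_(y in P) _ = \int[mu]_(y in P) (expR (- ((Num.sqrt T)^-1 * y)) * sin (x * y)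
   - (expR (pi / 2 * y) + 1)^-1 * sin (x * y))); last first.
  by apply: integral_eq => y _; ring.
rewrite RintegralB//; [|exact: integrable_mul_sin..].
rewrite laplace_sin// integral_sin_fermi// /log_slope opprB addrA.
have -> : T * x / (1 + T * x ^+ 2) = x / ((Num.sqrt T)^-1 ^+ 2 + x ^+ 2).
  rewrite exprVn sqr_sqrtr ?(ltW T_gt0)//; have := oneDT_gt0 T_gt0 x => d0.
  have d1 : 0 < T^-1 + x ^+ 2 by rewrite ltr_pwDl ?invr_gt0// sqr_ge0.
  field; rewrite !gt_eqF//.
  by rewrite (_ : 1 + _ = 1 + T * x ^+ 2)//; ring.
ring.
Qed.

Definition l_abel e t : R := l_T T t * expR (- (e * t)).

Let c1 := (Num.sqrt T)^-1 + 2.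
Let c1_gt0 : 0 < c1. Proof. by rewrite addr_gt0 ?invr_gt0. Qed.

Let l_abel_le e t : 0 < t -> `|l_abel e t| <= c1 * sqrt_abel e t.
Proof.
move=> t0; have /andP[l0 l1] := l_T_le T_gt0 t0.
by rewrite /l_abel /sqrt_abel mulrA normrM !ger0_norm ?expR_ge0// ler_wpM2r ?expR_ge0.
Qed.

Let measurable_l_abel e : measurable_fun P (l_abel e).
Proof. by apply: measurable_funM; [exact: measurable_l_T|exact: measurable_expNM]. Qed.

Let integrable_l_abel e : 0 < e -> L1 P (l_abel e).
Proof.
move=> e0; apply: (@integrable_le _ _ _ (fun t => c1 * sqrt_abel e t)) => //.
  by apply: integrable_scale => //; exact: integrable_sqrt_abel.
by move=> t; rewrite pos_lineE; exact: l_abel_le.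
Qed.

(** The error caused by the damping. Its integrand is at most a multiple of [sqrt_weight e], with
    integral [pi / sqrt e], so the factor [e] leaves [sqrt e]. *)
Let sin_tr_l_abel_le e x : 0 < e -> `|e * sin_tr (l_abel e) x| <= c1 * pi * Num.sqrt e.
Proof.
move=> e0; rewrite normrM (gtr0_norm e0).
have [wi wE] := integrable_sqrt_weight e0.
have se : 0 < Num.sqrt e by rewrite sqrtr_gt0.
have -> : c1 * pi * Num.sqrt e = e * (c1 * (pi / Num.sqrt e)).
  by rewrite -{2}(sqr_sqrtr (ltW e0)); field; rewrite gt_eqF.
rewrite ler_pM2l// -wE -RintegralZl//.
apply: le_integral_bound => //.
- apply: measurable_funM => //; exact: measurable_sin_mul.
- by apply: integrable_scale => //.
move=> t; rewrite pos_lineE => t0; rewrite normrM.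
apply: (@le_trans _ _ (c1 * sqrt_abel e t)).
  by rewrite -[leRHS]mulr1; apply: ler_pM => //; [exact: l_abel_le|exact: norm_sin_le1].
rewrite ler_pM2l// /sqrt_abel /sqrt_weight ler_wpM2l ?invr_ge0//.
by rewrite expRN lef_pV2 ?posrE ?expR_gt0 ?expR_ge1Dx// addr_gt0 ?mulr_gt0.
Qed.

(** The formula of [l_T] without the case distinction at [0], for which the derivative is
    computed. *)
Let l_continuous t : R := Num.sqrt (t / ((1 + T * t ^+ 2) * tanh t)).
Let l_continuousE t : 0 < t -> l_continuous t = l_T T t.
Proof. by move=> t0; rewrite /l_T gt_eqF. Qed.

(* Integrating the derivative of [l_abel e t * sin (x * t)] over the half line. *)
Lemma mul_cos_tr_l_abel e x : 0 < e ->
  x * cos_tr (l_abel e) x =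
  \int[mu]_(t in P) (l_abel e t * sin (x * t) * log_slope T t) + e * sin_tr (l_abel e) x.
Proof.
move=> e0; have il := integrable_l_abel e0.
have iS := integrable_mul_sin x (@measurable_pos_line R) il.
have ic := integrable_mul_cos x (@measurable_pos_line R) il.
have mP := @measurable_pos_line R.
have kle t : 0 < t -> `|log_slope T t| <= \int[mu]_(y in P) `|slope_density y|.
  by move=> t0; rewrite log_slopeE//; apply: sin_tr_bound; exact: integrable_slope_density.
have iN : L1 P (fun t => l_abel e t * sin (x * t) * log_slope T t).
  apply: (@integrable_le _ _ _ (fun t => (\int[mu]_(y in P) `|slope_density y|) *
      `|l_abel e t * sin (x * t)|)) => //.
  - apply: measurable_funM; first exact: integrable_measurable iS.
    by apply: continuous_pos_measurable => t; exact: continuous_log_slope.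
  - by apply: integrable_scale => //; exact: integrable_norm.
  - by move=> t; rewrite pos_lineE => t0; rewrite normrM mulrC ler_wpM2r// kle.
pose F t := l_continuous t * (expR (- (e * t)) * sin (x * t)).
pose f t := - (log_slope T t * l_continuous t) * (expR (- (e * t)) * sin (x * t)) +
   l_continuous t * (expR (- (e * t)) * (x * cos (x * t) - e * sin (x * t))).
have fE t : P t -> f t = x * (l_abel e t * cos (x * t)) -
    (l_abel e t * sin (x * t) * log_slope T t + e * (l_abel e t * sin (x * t))).
  by rewrite pos_lineE => t0; rewrite /f l_continuousE// /l_abel; ring.
have iR : L1 P (fun t => x * (l_abel e t * cos (x * t)) -
    (l_abel e t * sin (x * t) * log_slope T t + e * (l_abel e t * sin (x * t)))).
  apply: integrable_diff => //; first exact: integrable_scale.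
  by apply: integrable_sum => //; exact: integrable_scale.
(* The boundary term at [0]: [l_T] may grow like [t^(-1/2)] in the bound used, while
   [|sin (x t)| <= |x| t], so the product is [O(sqrt t)]. *)
have sc : c1 * `|x| * Num.sqrt t @[t --> 0^'+] --> (0 : R).
  have s0 : Num.sqrt t @[t --> 0^'+] --> (0 : R).
    by rewrite -[X in _ --> X](@sqrtr0 R); apply: cvg_at_right_filter; exact: sqrt_continuous.
  by rewrite -[X in _ --> X](mulr0 (c1 * `|x|)); exact: cvgMl_tmp.
have : \int[mu]_(t in P) f t = 0 - 0.
  apply: (@FTC_oy R f F 0 0 0).
  - move=> t t0; have dl := is_derive_l_T T_gt0 t0; rewrite -l_continuousE// in dl.
    rewrite /F /f; apply: is_derive_eq.
    by rewrite /GRing.scale/=; ring.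
  - move=> t t0; have cl := continuous_l_T T_gt0 t0.
    have cE := @continuous_expNM R e t.
    have cs := @continuous_sin_mul R x t.
    apply: cvgD; apply: cvgM => //.
    + by apply: cvgN; apply: cvgM => //; exact: continuous_log_slope.
    + exact: cvgM.
    + apply: cvgM => //; apply: cvgB; apply: cvgMl_tmp => //.
      exact: continuous_cos_mul.
  - by apply: integrable_eq iR _ => // t Pt; rewrite fE.
  - apply: (@squeeze_cvgr _ _ _ _ (fun t => - (c1 * `|x| * Num.sqrt t)) (fun t => c1 * `|x| * Num.sqrt t)).
    + near=> t; rewrite -ler_norml /F.
      have t0 : 0 < t by near: t; exact: nbhs_right_gt.
      have /andP[l0 l1] := l_T_le T_gt0 t0.
      rewrite l_continuousE// normrM (ger0_norm l0).
      have h : `|expR (- (e * t)) * sin (x * t)| <= `|x| * t.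
        rewrite normrM (ger0_norm (expR_ge0 _)) -[leRHS]mul1r; apply: ler_pM => //.
          by rewrite -expR0 ler_expR oppr_le0 mulr_ge0// ltW.
        have := sin_lipschitz (x * t) 0; rewrite sin0 !subr0 => /le_trans; apply.
        by rewrite normrM (gtr0_norm t0).
      apply: (le_trans (ler_pM l0 (normr_ge0 _) l1 h)).
      rewrite -/c1 -{2}(sqr_sqrtr (ltW t0)) le_eqVlt; apply/orP; left; apply/eqP.
      by field; rewrite gt_eqF// sqrtr_gt0.
    + by rewrite -[X in _ --> X]oppr0; exact: (cvgN sc).
    + exact: sc.
  - have cb : F t @[t --> +oo] --> (0 : R).
      rewrite (_ : F = fun t => expR (- (e * t)) * (l_continuous t * sin (x * t))); last first.
        by apply/funext => t; rewrite /F; ring.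
      apply: (@cvgy_expNM _ e c1) => // t t1.
      have t0 : 0 < t by lra.
      have /andP[l0 l1] := l_T_le T_gt0 t0.
      rewrite l_continuousE// normrM (ger0_norm l0) -[leRHS]mulr1.
      apply: ler_pM => //; last exact: norm_sin_le1.
      apply: (le_trans l1); rewrite ler_piMr ?(ltW c1_gt0)//.
      by rewrite invf_le1 ?sqrtr_gt0// -sqrtr1 ler_wsqrtr.
    exact: cb.
rewrite (integral_eq fE) subrr => /eqP.
rewrite RintegralB//; first last.
- by apply: integrable_sum => //; exact: integrable_scale.
- exact: integrable_scale.
rewrite RintegralD//; last exact: integrable_scale.
by rewrite !RintegralZl// subr_eq0 => /eqP.
Unshelve. all: end_near.
Qed.

(** Inserting [log_slope = sin_tr slope_density] and exchanging the integrals leaves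
    [sin (x t) sin (t y)], half the difference of [cos ((x - y) t)] and [cos ((x + y) t)]. *)
Lemma convolution_identity e x : 0 < e ->
  x * cos_tr (l_abel e) x =
  2^-1 * \int[mu]_(y in P) (slope_density y *
     (cos_tr (l_abel e) (x - y) - cos_tr (l_abel e) (x + y))) + e * sin_tr (l_abel e) x.
Proof.
move=> e0; rewrite mul_cos_tr_l_abel//; congr (_ + _).
have il := integrable_l_abel e0; have ik := integrable_slope_density.
have mP := @measurable_pos_line R.
transitivity (\int[mu]_(t in P) (l_abel e t *
    \int[mu]_(y in P) (slope_density y * (sin (x * t) * sin (t * y))))).
  apply: integral_eq => t; rewrite pos_lineE => t0.
  rewrite log_slopeE// -mulrA; congr (_ * _).
  rewrite -RintegralZl//; last exact: integrable_mul_sin.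
  by apply: integral_eq => y _; ring.
rewrite (@Fubini_kernel _ _ _ _ _ (fun z : R * R => sin (x * z.1) * sin (z.1 * z.2)))//; first last.
- move=> z /=; rewrite normrM -[leRHS]mulr1.
  by apply: ler_pM => //; exact: norm_sin_le1.
- apply: measurable_funM; (apply: measurableT_comp;
    first by apply: continuous_measurable_fun; exact: continuous_sin).
    by apply: measurable_funM => //; exact: measurable_fst.
  by apply: measurable_funM; [exact: measurable_fst|exact: measurable_snd].
have cG := continuous_cos_tr il.
rewrite -RintegralZl//; last first.
  have cD : continuous (fun y => cos_tr (l_abel e) (x - y) - cos_tr (l_abel e) (x + y)).
    move=> y; apply: cvgB.
      apply: (@continuous_comp _ _ _ (fun y => x - y) (cos_tr (l_abel e))); last exact: cG.
      by apply: cvgB; [exact: cvg_cst|exact: cvg_id].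
    apply: (@continuous_comp _ _ _ (fun y => x + y) (cos_tr (l_abel e))); last exact: cG.
    by apply: cvgD; [exact: cvg_cst|exact: cvg_id].
  apply: (@integrable_le _ _ _ (fun y =>
      (2 * \int[mu]_(t in P) `|l_abel e t|) * `|slope_density y|)) => //.
  - apply: measurable_funM; first exact: integrable_measurable ik.
    by apply: measurable_funTS; apply: continuous_measurable_fun.
  - by apply: integrable_scale => //; exact: integrable_norm.
  move=> y _; rewrite normrM mulrC ler_wpM2r// (le_trans (ler_normB _ _))//.
  by rewrite mulr_natl mulr2n; apply: lerD; exact: cos_tr_bound.
apply: integral_eq => y _; rewrite mulrCA; congr (_ * _).
rewrite /cos_tr -RintegralB//; [|exact: integrable_mul_cos..].
rewrite -RintegralZl//; last by apply: integrable_diff => //; exact: integrable_mul_cos.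
apply: integral_eq => t _ /=; rewrite (mulrC t y) mulrBl mulrDl cosB cosD.
by field.
Qed.

(** The pointwise limit, off [0], of [cos_tr (l_abel e)] as [e] tends to [0]; it is [pi] times the
    kernel. *)
Definition abel_limit x : R :=
  (Num.sqrt T)^-1 * (Num.sqrt pi / Num.sqrt (2 * `|x|)) +
  cos_tr (symbol_32 T) x + cos_tr (symbol_omega T) x.

Let damped_integrable m e : 0 < e -> L1 P m -> L1 P (fun t => m t * expR (- (e * t))).
Proof.
move=> e0 im; apply: (@integrable_le _ _ _ (fun t => `|m t|)) => //.
- by apply: measurable_funM; [exact: integrable_measurable im|exact: measurable_expNM].
- exact: integrable_norm.
move=> t; rewrite pos_lineE => t0; rewrite normrM ler_piMr// ger0_norm ?expR_ge0//.
by rewrite -expR0 ler_expR oppr_le0 mulr_ge0// ltW.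
Qed.

Let damped_bound m e x : 0 < e -> L1 P m ->
  `|cos_tr (fun t => m t * expR (- (e * t))) x| <= \int[mu]_(t in P) `|m t|.
Proof.
move=> e0 im; apply: (le_trans (cos_tr_bound _ (damped_integrable e0 im))).
have mP := @measurable_pos_line R.
apply: le_Rintegral => //; [exact/integrable_norm/damped_integrable|exact: integrable_norm|].
move=> t; rewrite pos_lineE => t0; rewrite normrM ler_piMr// ger0_norm ?expR_ge0//.
by rewrite -expR0 ler_expR oppr_le0 mulr_ge0// ltW.
Qed.

Lemma cvg_damped_cos_tr m x : L1 P m ->
  cos_tr (fun t => m t * expR (- (n.+1%:R^-1 * t))) x @[n --> \oo] --> cos_tr m x.
Proof.
move=> im; have mP := @measurable_pos_line R.
suff : L1 P (fun t => m t * cos (x * t)) /\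
    cos_tr (fun t => m t * expR (- (n.+1%:R^-1 * t))) x @[n --> \oo] --> cos_tr m x by case.
apply: (@dominated_cvgn R P (fun n t => m t * expR (- (n.+1%:R^-1 * t)) * cos (x * t))
  _ (fun t => `|m t|)) => //; last 2 first.
- exact: integrable_norm.
- move=> n t; rewrite pos_lineE => t0; rewrite normrM -[leRHS]mulr1.
  apply: ler_pM => //; last exact: norm_cos_le1.
  rewrite normrM ler_piMr// ger0_norm ?expR_ge0//.
  by rewrite -expR0 ler_expR oppr_le0 mulr_ge0// ltW.
- move=> n; apply: measurable_funM; last exact: measurable_cos_mul.
  by apply: measurable_funM; [exact: integrable_measurable im|exact: measurable_expNM].
- move=> t _; apply: cvgMr_tmp; rewrite -[X in _ --> X]mulr1; apply: cvgMl_tmp.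
  rewrite -[X in _ --> X]expR0; apply: continuous_cvg; first exact: continuous_expR.
  rewrite -[X in _ --> X]oppr0 -[X in _ --> - X](mul0r t); apply: cvgN; apply: cvgMr_tmp.
  exact: cvg_harmonic.
Qed.

Let cos_tr_l_abelE e x : 0 < e -> cos_tr (l_abel e) x =
  (Num.sqrt T)^-1 * cos_tr (sqrt_abel e) x +
  cos_tr (fun t => symbol_32 T t * expR (- (e * t))) x +
  cos_tr (fun t => symbol_omega T t * expR (- (e * t))) x.
Proof.
move=> e0; have mP := @measurable_pos_line R.
have i1 := integrable_sqrt_abel e0.
have i2 := damped_integrable e0 (integrable_symbol_32 T_gt0).
have i3 := damped_integrable e0 (integrable_symbol_omega T_gt0).
have i4 := integrable_scale ((Num.sqrt T)^-1) mP i1.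
have -> : (Num.sqrt T)^-1 * cos_tr (sqrt_abel e) x =
    cos_tr (fun t => (Num.sqrt T)^-1 * sqrt_abel e t) x.
  rewrite /cos_tr -RintegralZl//; last exact: integrable_mul_cos.
  by apply: integral_eq => t _; ring.
rewrite -!cos_trD//; last exact: integrable_sum.
apply: integral_eq => t; rewrite pos_lineE => t0.
by rewrite /l_abel l_T_decomposition// /lead_symbol /sqrt_abel; ring.
Qed.

Let c2 := (Num.sqrt T)^-1 * (2 * Num.sqrt pi) + \int[mu]_(t in P) `|symbol_32 T t| +
  \int[mu]_(t in P) `|symbol_omega T t|.
Let c2_ge0 : 0 <= c2.
Proof.
have p0 := @pi_gt0 R.
rewrite /c2 !addr_ge0 ?mulr_ge0 ?invr_ge0 ?Rintegral_ge0//.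
Qed.

(** [c2] is independent of [e], so it survives the limit and can serve as the constant [C] of
    [decay_bootstrap] for every [e]. *)
Let cos_tr_l_abel_bound e x : 0 < e -> x != 0 ->
  `|cos_tr (l_abel e) x| <= c2 * (1 + (Num.sqrt `|x|)^-1).
Proof.
move=> e0 x0; rewrite cos_tr_l_abelE//.
have h1 := cos_tr_sqrt_abel_bound e0 x0.
have h2 := damped_bound x e0 (integrable_symbol_32 T_gt0).
have h3 := damped_bound x e0 (integrable_symbol_omega T_gt0).
have s0 : 0 <= (Num.sqrt `|x|)^-1 by rewrite invr_ge0.
have i2 : 0 <= \int[mu]_(t in P) `|symbol_32 T t| by exact: Rintegral_ge0.
have i3 : 0 <= \int[mu]_(t in P) `|symbol_omega T t| by exact: Rintegral_ge0.
have k0 : 0 <= (Num.sqrt T)^-1 * (2 * Num.sqrt pi) by rewrite !mulr_ge0// invr_ge0.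
apply: (le_trans (ler_normD _ _)); apply: (le_trans (lerD (ler_normD _ _) h3)).
rewrite normrM (gtr0_norm (x := (Num.sqrt T)^-1)) ?invr_gt0//.
have {}h1 : (Num.sqrt T)^-1 * `|cos_tr (sqrt_abel e) x| <=
    (Num.sqrt T)^-1 * (2 * Num.sqrt pi) * (Num.sqrt `|x|)^-1.
  by rewrite -mulrA ler_pM2l ?invr_gt0.
rewrite /c2; move: ((Num.sqrt T)^-1 * (2 * _)) (\int[mu]_(t in P) `|symbol_32 T t|)
  (\int[mu]_(t in P) `|symbol_omega T t|) ((Num.sqrt `|x|)^-1) i2 i3 k0 s0 h1 h2 h3.
by move=> a p q r p0 q0 a0 r0; nra.
Qed.

Let cvg_cos_tr_l_abel x : x != 0 ->
  cos_tr (l_abel n.+1%:R^-1) x @[n --> \oo] --> abel_limit x.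
Proof.
move=> x0; rewrite (_ : (fun n => _) = (fun n => (Num.sqrt T)^-1 * cos_tr (sqrt_abel n.+1%:R^-1) x +
  cos_tr (fun t => symbol_32 T t * expR (- (n.+1%:R^-1 * t))) x +
  cos_tr (fun t => symbol_omega T t * expR (- (n.+1%:R^-1 * t))) x)); last first.
  by apply/funext => n; rewrite cos_tr_l_abelE.
apply: cvgD; last exact/cvg_damped_cos_tr/integrable_symbol_omega.
apply: cvgD; last exact/cvg_damped_cos_tr/integrable_symbol_32.
by apply: cvgMl_tmp; exact: cvg_cos_tr_sqrt_abel.
Qed.

Let abel_limit_le x : x != 0 -> `|abel_limit x| <= c2 * (1 + (Num.sqrt `|x|)^-1).
Proof.
move=> x0; set B := c2 * _.
have h : `|cos_tr (l_abel n.+1%:R^-1) x| @[n --> \oo] --> `|abel_limit x|.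
  by apply: cvg_norm; exact: cvg_cos_tr_l_abel.
have h2 : (fun=> B) n @[n --> \oo] --> B by exact: cvg_cst.
by apply: (ler_cvg_to h h2); apply: nearW => n; exact: cos_tr_l_abel_bound.
Qed.

Lemma abel_limit_bound : exists2 C, 0 <= C &
  forall x, x != 0 -> `|abel_limit x| <= C * (1 + (Num.sqrt `|x|)^-1).
Proof. by exists c2 => // x; exact: abel_limit_le. Qed.

(** The bootstrap is applied to each damped transform with the margin [b = delta_star T - d] and
    with the truncation height equal to [|x|], at which the weight at [x] is the full
    exponential. *)
Lemma abel_limit_decay d : d < delta_star T ->
  exists C, forall x, 1 < `|x| -> `|abel_limit x| <= C * expR (- d * `|x|).
Proof.
(* For negative [d] the claim follows from boundedness, the case [d = 0]. *)
wlog d0 : d / 0 <= d.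
  move=> H dd; have [/H|dn] := leP 0 d; first exact.
  have [C hC] := H 0 (lexx _) delta_star_gt0; exists C => x x1.
  have {}hC := hC x x1; rewrite oppr0 mul0r expR0 mulr1 in hC.
  have C0 : 0 <= C by exact: le_trans hC.
  apply: (le_trans hC); rewrite ler_peMr// -expR0 ler_expR mulr_ge0//.
  by rewrite oppr_ge0 ltW.
move=> dd; pose b := delta_star T - d.
have b0 : 0 < b by rewrite subr_gt0.
pose A := 2 * (2 / b + 4 * pi).
exists (2 * (c2 * expR (d * A))) => x x1.
have x0 : x != 0 by rewrite -normr_gt0; lra.
rewrite mulNr expRN ler_pdivlMr ?expR_gt0//.
have sx : (Num.sqrt `|x|)^-1 <= 1.
  by rewrite invf_le1 ?sqrtr_gt0 ?normr_gt0// -sqrtr1 ler_wsqrtr// ltW.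
(* For [1 < |x| < A] the a priori bound suffices; it costs the factor [2], from
   [1 + |x|^(-1/2) <= 2]. *)
have [Ax|xA] := leP A `|x|; last first.
  rewrite [leRHS]mulrA (mulrC 2); apply: ler_pM => //.
    apply: (le_trans (abel_limit_le x0)).
    by rewrite ler_wpM2l// -[leRHS]/(1 + 1) lerD2l.
  by rewrite ler_expR ler_wpM2l// ltW.
(* The damping error at [e = 1 / (n + 1)]. With [x] fixed it tends to [0] even after multiplication
   by [e^(d |x|)]. *)
pose eta n : R := c1 * pi * Num.sqrt n.+1%:R^-1.
have eta0 n : 0 <= eta n by rewrite !mulr_ge0// ?pi_ge0// ltW.
have key n : `|cos_tr (l_abel n.+1%:R^-1) x| * expR (d * `|x|) <=
    c2 * expR (d * A) + 2 * (eta n * expR (d * `|x|)).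
  have e0 : 0 < n.+1%:R^-1 :> R by [].
  have := @decay_bootstrap R (cos_tr (l_abel n.+1%:R^-1)) slope_density b d c2 (eta n) `|x|
    d0 b0 c2_ge0 (eta0 n).
  have wE : truncated_weight d `|x| x = expR (d * `|x|) by rewrite /truncated_weight minxx.
  rewrite -wE; apply => //.
  - exact/continuous_cos_tr/integrable_l_abel.
  - by apply: measurable_funTS; apply: continuous_measurable_fun; exact: continuous_slope_density.
  - by move=> y; exact: cos_trN.
  - by move=> y y0; rewrite /b subrK; exact: slope_density_le.
  - by move=> z z0; exact: cos_tr_l_abel_bound.
  - move=> y y0; rewrite convolution_identity//.
    apply: (le_trans (ler_normD _ _)); apply: lerD; last exact: sin_tr_l_abel_le.
    by rewrite normrM ger0_norm.
have c0 : 0 <= c2 * expR (d * A) by rewrite mulr_ge0 ?expR_ge0.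
have lim1 : `|cos_tr (l_abel n.+1%:R^-1) x| * expR (d * `|x|) @[n --> \oo] -->
    `|abel_limit x| * expR (d * `|x|).
  by apply: cvgMr_tmp; apply: cvg_norm; exact: cvg_cos_tr_l_abel.
have lim2 : c2 * expR (d * A) + 2 * (eta n * expR (d * `|x|)) @[n --> \oo] -->
    c2 * expR (d * A) + 2 * (c1 * pi * Num.sqrt 0 * expR (d * `|x|)).
  apply: cvgD; first exact: cvg_cst.
  apply: cvgMl_tmp; apply: cvgMr_tmp; apply: cvgMl_tmp.
  apply: continuous_cvg; first exact: sqrt_continuous.
  exact: cvg_harmonic.
rewrite sqrtr0 mulr0 mul0r mulr0 addr0 in lim2.
apply: (@le_trans _ _ (c2 * expR (d * A))); last by lra.
apply: (ler_cvg_to lim1 lim2); apply: nearW => n; exact: key.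
Qed.

End fixed_parameter.
End kernel_decay.

(** * The kernel: singularity, decay and integrability *)

Section kernel.
Context {R : realType}.
Notation mu := (@lebesgue_measure R).
Notation P := (pos_line R).
Notation L1 A f := (mu.-integrable A (EFin \o f)).
Implicit Types (x y z t e d : R) (f m u K : R -> R).

Lemma measurable_inv_sqrt_norm c : measurable_fun setT (fun x : R => (Num.sqrt (c * `|x|))^-1).
Proof.
apply: measurable_funV; apply: continuous_measurable_fun => x.
apply: continuous_cvg; first exact: sqrt_continuous.
by apply: cvgMl_tmp; exact: norm_continuous.
Qed.

Section fixed_parameter.
Variable T : R.
Hypothesis T_gt0 : 0 < T.

Definition kernel x : R :=
  1 / Num.sqrt (2 * pi * T * `|x|) + kernel_32 T x + kernel_omega T x.

Lemma kernelE x : kernel x = pi^-1 * abel_limit T x.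
Proof.
have p0 := @pi_gt0 R.
rewrite /kernel /abel_limit !(mulrDr pi^-1) -/(kernel_32 T x) -/(kernel_omega T x).
congr (_ + _ + _).
rewrite (_ : 2 * pi * T * `|x| = pi * (T * (2 * `|x|))); last by ring.
rewrite div1r !sqrtrM ?ltW// !invfM.
rewrite -[in pi^-1](sqr_sqrtr (ltW p0)) expr2 invfM.
have s0 : Num.sqrt pi != 0 :> R by rewrite gt_eqF// sqrtr_gt0.
(* At the origin both singular terms are [0], the inverse of [0] being [0]. *)
have [->|x0] := eqVneq `|x| 0; first by rewrite !(sqrtr0, mulr0, invr0).
have x1 : 0 < `|x| by rewrite lt_def x0 normr_ge0.
by field; rewrite s0 !gt_eqF ?sqrtr_gt0.
Qed.

Lemma kernelN x : kernel (- x) = kernel x.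
Proof. by rewrite !kernelE /abel_limit normrN !cos_trN. Qed.

Lemma measurable_kernel : measurable_fun setT kernel.
Proof.
have cm m : L1 P m -> measurable_fun setT (cos_tr m).
  by move=> im; apply: continuous_measurable_fun; exact: continuous_cos_tr.
apply: (eq_measurable_fun (fun x => pi^-1 * ((Num.sqrt T)^-1 * (Num.sqrt pi * (Num.sqrt (2 * `|x|))^-1) +
  cos_tr (symbol_32 T) x + cos_tr (symbol_omega T) x))).
  by move=> x _; rewrite kernelE.
apply: measurable_funM => //; apply: measurable_funD; last exact: (cm _ (integrable_symbol_omega T_gt0)).
apply: measurable_funD; last exact: (cm _ (integrable_symbol_32 T_gt0)).
by do 2! (apply: measurable_funM => //); exact: measurable_inv_sqrt_norm.
Qed.

Lemma kernel_bound : exists2 C, 0 <= C &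
  forall x, x != 0 -> `|kernel x| <= C * (1 + (Num.sqrt `|x|)^-1).
Proof.
have [C C0 HC] := abel_limit_bound T_gt0.
have p0 : 0 < pi^-1 :> R by rewrite invr_gt0 pi_gt0.
exists (pi^-1 * C) => [|x x0]; first by rewrite mulr_ge0// ltW.
by rewrite kernelE normrM (gtr0_norm p0) -mulrA ler_pM2l// HC.
Qed.

Lemma kernel_decay d : d < delta_star T ->
  exists C, forall x, 1 < `|x| -> `|kernel x| <= C * expR (- d * `|x|).
Proof.
have p0 : 0 < pi^-1 :> R by rewrite invr_gt0 pi_gt0.
move=> /(abel_limit_decay T_gt0)[C HC]; exists (pi^-1 * C) => x x1.
by rewrite kernelE normrM (gtr0_norm p0) -mulrA ler_pM2l// HC.
Qed.

(** The singular bound is used up to [1], the exponential decay at rate [delta_star T / 2] beyond.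
    For [x <= 1], [1 + x^(-1/2) <= 2 x^(-1/2)] and [1 + x <= 2] give the factor [4]. *)
Lemma integrable_kernel : L1 setT kernel.
Proof.
have mP := @measurable_pos_line R.
suff iP : L1 P kernel.
  apply: (integral_symmetrize measurable_kernel iP _).1.
  by apply: integrable_eq iP _ => // x _; rewrite kernelN.
have [C C0 HC] := kernel_bound.
pose d := delta_star T / 2.
have ds := delta_star_gt0 T_gt0.
have d0 : 0 < d by rewrite divr_gt0.
have [C' HC'] : exists C', forall x, 1 < `|x| -> `|kernel x| <= C' * expR (- d * `|x|).
  by apply: kernel_decay; rewrite /d ltr_pdivrMr// ltr_pMr// ltr1n.
have C'0 : 0 <= C'.
  have h2 : 1 < `|2| :> R by rewrite ger0_norm ?ltr1n.
  by have := HC' 2 h2; rewrite -(pmulr_lge0 _ (expR_gt0 (- d * `|2|))) mulrC; apply: le_trans.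
have [wi _] := integrable_sqrt_weight (@ltr01 R).
have [ei _] := integrable_expNM d0.
apply: (@integrable_le _ _ _ (fun x => 4 * C * sqrt_weight 1 x + C' * expR (- (d * x)))) => //.
- exact: measurable_funTS measurable_kernel.
- by apply: integrable_sum => //; exact: integrable_scale.
move=> x; rewrite pos_lineE => x0.
have s0 : 0 < Num.sqrt x by rewrite sqrtr_gt0.
have w0 : 0 <= sqrt_weight 1 x.
  by rewrite /sqrt_weight mulr_ge0// invr_ge0// ?(ltW s0)// addr_ge0// mulr_ge0// ltW.
have [x1|x1] := ltP 1 x.
  have := HC' x; rewrite gtr0_norm// mulNr => /(_ x1) h; apply: (le_trans h).
  by rewrite lerDr mulr_ge0// mulr_ge0.
have := HC x (lt0r_neq0 x0); rewrite (gtr0_norm x0) => h; apply: (le_trans h).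
apply: (@le_trans _ _ (4 * C * sqrt_weight 1 x)); last by rewrite lerDl mulr_ge0 ?expR_ge0.
rewrite mulrAC [leRHS]mulrC; apply: ler_wpM2l => //.
rewrite /sqrt_weight mul1r.
have s1 : Num.sqrt x <= 1 by rewrite -sqrtr1 ler_wsqrtr.
have -> : 4 * ((Num.sqrt x)^-1 * (1 + x)^-1) = 4 / (1 + x) / Num.sqrt x.
  by field; rewrite !gt_eqF// addr_gt0.
rewrite ler_pdivlMr// mulrDl mul1r mulVf ?gt_eqF//.
by rewrite ler_pdivlMr ?addr_gt0//; nra.
Qed.

(** Off [0] the function is the constant plus [sqrt |x|] times a continuous function, and the latter
    product tends to [0]. *)
Lemma cvg_sqrt_kernel :
  Num.sqrt `|x| * kernel x @[x --> 0^'] --> 1 / Num.sqrt (2 * pi * T).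
Proof.
have p0 := @pi_gt0 R.
have h : 1 / Num.sqrt (2 * pi * T) + Num.sqrt `|x| * (kernel_32 T x + kernel_omega T x)
    @[x --> 0^'] --> 1 / Num.sqrt (2 * pi * T) + Num.sqrt `|0 : R| * (kernel_32 T 0 + kernel_omega T 0).
    apply: cvgD; first exact: cvg_cst.
  apply: cvg_within_filter; apply: cvgM.
    apply: continuous_cvg; first exact: sqrt_continuous.
    exact: norm_continuous.
  by apply: cvgD; apply: cvgMl_tmp; apply: continuous_cos_tr;
    [exact: integrable_symbol_32|exact: integrable_symbol_omega].
rewrite normr0 sqrtr0 mul0r addr0 in h.
apply: cvg_trans h; apply: near_eq_cvg; near=> x.
have x0 : x != 0 by near: x; exact: nbhs_dnbhs_neq.
rewrite /kernel -addrA [RHS](mulrDr (Num.sqrt `|x|)) (mulrDr (Num.sqrt _) (kernel_32 T x)).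
congr (_ + _).
have a0 : 0 < Num.sqrt `|x| by rewrite sqrtr_gt0 normr_gt0.
have b0 : 0 < Num.sqrt (2 * pi * T) by rewrite sqrtr_gt0 !mulr_gt0.
rewrite (@sqrtrM R (2 * pi * T) `|x|); last by rewrite !mulr_ge0 ?(ltW T_gt0) ?pi_ge0.
move: (Num.sqrt (2 * pi * T)) b0 => b b0.
by field; rewrite !gt_eqF.
Unshelve. all: by end_near. Qed.

End fixed_parameter.
End kernel.

(** * Pairing with Schwartz functions *)

Section schwartz_pairing.
Context {R : realType}.
Notation mu := (@lebesgue_measure R).
Notation P := (pos_line R).
Notation L1 A f := (mu.-integrable A (EFin \o f)).
Implicit Types (x y z t e d C c : R) (f g m u v w K U V : R -> R).

(** The part of Schwartz decay that is used: it is stable under the cosine and sine transforms below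
    and makes products with [inv_sqrt_bounded] functions integrable, a class containing the symbols
    as well as the kernels. *)
Definition inv_quad_bounded u := exists2 C, 0 <= C & forall x, `|u x| <= C * (1 + x ^+ 2)^-1.

Definition inv_sqrt_bounded f :=
  exists2 C, 0 <= C & forall x, x != 0 -> `|f x| <= C * (1 + (Num.sqrt `|x|)^-1).

Lemma inv_quad_boundedN u : inv_quad_bounded u -> inv_quad_bounded (fun x => u (- x)).
Proof. by move=> [C C0 HC]; exists C => // x; rewrite -(sqrrN x). Qed.

Lemma inv_quad_boundedD u v : inv_quad_bounded u -> inv_quad_bounded v ->
  inv_quad_bounded (fun x => u x + v x).
Proof.
move=> [C C0 HC] [D D0 HD]; exists (C + D) => [|x]; first exact: addr_ge0.
by rewrite mulrDl (le_trans (ler_normD _ _))// lerD.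
Qed.

Lemma inv_quad_boundedZ c u : inv_quad_bounded u -> inv_quad_bounded (fun x => c * u x).
Proof.
move=> [C C0 HC]; exists (`|c| * C) => [|x]; first exact: mulr_ge0.
by rewrite normrM -mulrA ler_wpM2l.
Qed.

Lemma integrable_inv_quad u : measurable_fun P u -> inv_quad_bounded u -> L1 P u.
Proof.
move=> mu' [C C0 HC]; have mP := @measurable_pos_line R.
apply: (@integrable_le _ _ _ (fun x => C * (1 + x ^+ 2)^-1)) => //.
by apply: integrable_scale => //; exact: integrable_inv1D2.
Qed.

Lemma cvgy0_inv_quad u : inv_quad_bounded u -> u x @[x --> +oo] --> 0.
Proof.
move=> [C C0 HC]; apply: (@cvgy0_le_inv _ _ C) => x x1.
apply: (le_trans (HC x)); apply: ler_wpM2l => //.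
have x0 : 0 < x by lra.
by rewrite lef_pV2 ?posrE//; nra.
Qed.

Lemma integrable_half_tempered f u : measurable_fun P f -> measurable_fun P u ->
  inv_sqrt_bounded f -> inv_quad_bounded u -> L1 P (fun x => f x * u x).
Proof.
move=> mf mu' [C C0 HC] [D D0 HD].
have mP := @measurable_pos_line R.
have [wi _] := integrable_sqrt_weight (@ltr01 R).
apply: (@integrable_le _ _ _ (fun x => C * D * ((1 + x ^+ 2)^-1 + 2 * sqrt_weight 1 x))) => //.
- exact: measurable_funM.
- apply: integrable_scale => //; apply: integrable_sum => //; first exact: integrable_inv1D2.
  exact: integrable_scale.
move=> x; rewrite pos_lineE => x0; rewrite normrM.
have h1 := HC x (lt0r_neq0 x0); rewrite (gtr0_norm x0) in h1.
apply: (le_trans (ler_pM (normr_ge0 _) (normr_ge0 _) h1 (HD x))).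
rewrite mulrACA; apply: ler_wpM2l; first exact: mulr_ge0.
by rewrite mulrDl mul1r lerD2l; apply: sqrt_weight1_ge; exact: ltW.
Qed.

(** Only the even part of [u] is seen by an even [f]; pairings on the line thereby reduce to the
    half line, where the profiles live. *)
Lemma integral_even_mul f u : measurable_fun setT f -> measurable_fun setT u ->
  (forall x, f (- x) = f x) -> inv_sqrt_bounded f -> inv_quad_bounded u ->
  L1 setT (fun x => f x * u x) /\
  \int[mu]_x (f x * u x) = \int[mu]_(x in P) (f x * (u x + u (- x))).
Proof.
move=> mf mu' fN bf bu.
have mu'' : measurable_fun setT (fun x => u (- x)).
  by apply: (measurableT_comp mu'); apply: continuous_measurable_fun; exact: opp_continuous.
have [||i E] := @integral_symmetrize R (fun x => f x * u x) (measurable_funM mf mu').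
- by apply: integrable_half_tempered => //; exact: measurable_funTS.
- apply: (@integrable_eq _ _ (fun x => f x * u (- x))) => // [|x _]; last by rewrite fN.
  by apply: integrable_half_tempered => //;
    [exact: measurable_funTS|exact: measurable_funTS|exact: inv_quad_boundedN].
by split => //; rewrite E; apply: integral_eq => x _; rewrite fN; ring.
Qed.

Lemma is_derive_schwartz u n y : real_schwartz u ->
  is_derive y 1 (derive1n n u) (derive1n n.+1 u y).
Proof.
move=> [du _]; apply: DeriveDef; first exact: du.
by rewrite derive1nS derive1E.
Qed.

Lemma continuous_schwartz u n : real_schwartz u -> continuous (derive1n n u).
Proof. by move=> su y; exact: is_derive_continuous (is_derive_schwartz n y su). Qed.

Lemma inv_quad_bounded_schwartz u n : real_schwartz u -> inv_quad_bounded (derive1n n u).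
Proof.
move=> [_ bu]; have [C HC] := bu 0 n; have [D HD] := bu 2%N n.
exists (C + D) => [|x].
  by apply: addr_ge0; [exact: le_trans (HC 0)|exact: le_trans (HD 0)].
have x0 : 0 < 1 + x ^+ 2 by rewrite ltr_pwDl// sqr_ge0.
rewrite ler_pdivlMr// mulrDr mulr1; apply: lerD.
  by have := HC x; rewrite expr0 mul1r.
by have := HD x; rewrite normrM (ger0_norm (sqr_ge0 x)) mulrC.
Qed.

Let dN u n y : real_schwartz u ->
  is_derive y 1 (fun y => derive1n n u (- y)) (- derive1n n.+1 u (- y)).
Proof.
move=> su; have dn : is_derive y 1 (fun y : R => - y) (- 1) by apply: is_derive_eq.
have := is_derive1_comp (is_derive_schwartz n (- y) su) dn.
by rewrite mulrN1.
Qed.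

Definition even_sum u y : R := u y + u (- y).
Definition odd_diff u y : R := u y - u (- y).

Let continuousN u : continuous u -> continuous (fun y => u (- y)).
Proof. by move=> cu y; apply: continuous_comp; [exact: opp_continuous|exact: cu]. Qed.

Lemma continuous_even_sum u : continuous u -> continuous (even_sum u).
Proof. by move=> cu y; apply: cvgD; [exact: cu|exact: continuousN]. Qed.

Lemma continuous_odd_diff u : continuous u -> continuous (odd_diff u).
Proof. by move=> cu y; apply: cvgB; [exact: cu|exact: continuousN]. Qed.

Lemma inv_quad_bounded_even_sum u : inv_quad_bounded u -> inv_quad_bounded (even_sum u).
Proof. by move=> bu; apply: inv_quad_boundedD => //; exact: inv_quad_boundedN. Qed.

Lemma inv_quad_bounded_odd_diff u : inv_quad_bounded u -> inv_quad_bounded (odd_diff u).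
Proof.
move=> bu; rewrite (_ : odd_diff u = fun x => u x + -1 * u (- x)).
  by apply: inv_quad_boundedD => //; apply: inv_quad_boundedZ; exact: inv_quad_boundedN.
by apply/funext => x; rewrite mulN1r.
Qed.

Let measurable_continuous u : continuous u -> measurable_fun P u.
Proof. by move=> cu; apply: continuous_pos_measurable => x _; exact: cu. Qed.

Let integrable_even_sum u n : real_schwartz u -> L1 P (even_sum (derive1n n u)).
Proof.
move=> su; apply: integrable_inv_quad.
  by apply: measurable_continuous; apply: continuous_even_sum; exact: continuous_schwartz.
exact/inv_quad_bounded_even_sum/inv_quad_bounded_schwartz.
Qed.

Let integrable_odd_diff u n : real_schwartz u -> L1 P (odd_diff (derive1n n u)).
Proof.
move=> su; apply: integrable_inv_quad.
  by apply: measurable_continuous; apply: continuous_odd_diff; exact: continuous_schwartz.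
exact/inv_quad_bounded_odd_diff/inv_quad_bounded_schwartz.
Qed.

Let is_derive_even_sum u n y : real_schwartz u ->
  is_derive y 1 (even_sum (derive1n n u)) (odd_diff (derive1n n.+1 u) y).
Proof. by move=> su; exact: is_deriveD (is_derive_schwartz n y su) (dN n y su). Qed.

Let is_derive_odd_diff u n y : real_schwartz u ->
  is_derive y 1 (odd_diff (derive1n n u)) (even_sum (derive1n n.+1 u) y).
Proof.
move=> su; have := is_deriveB (is_derive_schwartz n y su) (dN n y su).
by rewrite opprK.
Qed.

Lemma even_profile_schwartz u : real_schwartz u ->
  even_profile (even_sum u) (odd_diff (derive1n 1 u)) (even_sum (derive1n 2 u)).
Proof.
move=> su; split.
- by move=> y; exact: (is_derive_even_sum 0).
- by move=> y; exact: is_derive_odd_diff.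
- exact/continuous_even_sum/continuous_schwartz.
- by rewrite /odd_diff oppr0 subrr.
- exact: (integrable_even_sum 0).
- exact: integrable_odd_diff.
- exact: integrable_even_sum.
- exact/cvgy0_inv_quad/inv_quad_bounded_even_sum/(inv_quad_bounded_schwartz 0).
- exact/cvgy0_inv_quad/inv_quad_bounded_odd_diff/inv_quad_bounded_schwartz.
Qed.

Lemma inv_quad_bounded_sin_tr u : real_schwartz u -> inv_quad_bounded (sin_tr (odd_diff u)).
Proof.
move=> su; set V := odd_diff u; set V2 := odd_diff (derive1n 2 u).
have iV : L1 P V by exact: (integrable_odd_diff 0).
have iV1 : L1 P (even_sum (derive1n 1 u)) by exact: integrable_even_sum.
have iV2 : L1 P V2 by exact: integrable_odd_diff.
have h1 x : x * sin_tr V x = cos_tr (even_sum (derive1n 1 u)) x.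
  apply: mul_sin_tr => //.
  - by move=> y; exact: (is_derive_odd_diff 0).
  - exact/continuous_even_sum/continuous_schwartz.
  - by rewrite /V /odd_diff oppr0 subrr.
  - exact/cvgy0_inv_quad/inv_quad_bounded_odd_diff/(inv_quad_bounded_schwartz 0).
have h2 x : x * cos_tr (even_sum (derive1n 1 u)) x = - sin_tr V2 x.
  apply: mul_cos_tr => //.
  - by move=> y; exact: is_derive_even_sum.
  - exact/continuous_odd_diff/continuous_schwartz.
  - exact/cvgy0_inv_quad/inv_quad_bounded_even_sum/inv_quad_bounded_schwartz.
exists (\int[mu]_(y in P) `|V y| + \int[mu]_(y in P) `|V2 y|).
  by rewrite addr_ge0// Rintegral_ge0.
move=> x; have x0 : 0 < 1 + x ^+ 2 by rewrite ltr_pwDl// sqr_ge0.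
rewrite ler_pdivlMr// -(ger0_norm (ltW x0)) -normrM mulrDr mulr1.
rewrite (le_trans (ler_normD _ _))// lerD//; first exact: sin_tr_bound.
rewrite (_ : sin_tr V x * x ^+ 2 = - sin_tr V2 x) ?normrN ?sin_tr_bound//.
by rewrite -h2 -h1; ring.
Qed.

Lemma sin_trN m x : L1 P m -> sin_tr m (- x) = - sin_tr m x.
Proof.
move=> im; rewrite /sin_tr -[RHS]mulN1r -RintegralZl//; last exact: integrable_mul_sin.
by apply: integral_eq => y _; rewrite mulNr sinN; ring.
Qed.

(** With [c = 1] and [c = -1] this covers the real and the imaginary part of a Fourier transform. *)
Let frequency u v c x := cos_tr (even_sum u) x + c * sin_tr (odd_diff v) x.

Let frequencyP u v c : real_schwartz u -> real_schwartz v ->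
  measurable_fun setT (frequency u v c) /\ inv_quad_bounded (frequency u v c).
Proof.
move=> su sv; split.
  apply: continuous_measurable_fun => x; apply: cvgD.
    by apply: continuous_cos_tr; exact: (integrable_even_sum 0).
  by apply: cvgMl_tmp; apply: continuous_sin_tr; exact: (integrable_odd_diff 0).
apply: inv_quad_boundedD; first exact: cos_tr_profile_decay (even_profile_schwartz su).
by apply: inv_quad_boundedZ; exact: inv_quad_bounded_sin_tr.
Qed.

(** The sine transform is odd in [x], so it disappears against the even [K]. The cosine part is
    counted on both half lines, and this [2] cancels the [2^-1] of the hypothesis on profiles. *)
Lemma pairing_frequency m K u v c :
  measurable_fun setT m -> measurable_fun setT K ->
  (forall x, m (- x) = m x) -> (forall x, K (- x) = K x) ->
  inv_sqrt_bounded m -> inv_sqrt_bounded K ->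
  (forall U U1 U2, even_profile U U1 U2 -> L1 P (fun y => (Num.sqrt y)^-1 * U y) ->
     \int[mu]_(x in P) (K x * cos_tr U x) = 2^-1 * \int[mu]_(y in P) (m y * U y)) ->
  real_schwartz u -> real_schwartz v ->
  \int[mu]_x (K x * (cos_tr (even_sum u) x + c * sin_tr (odd_diff v) x)) =
  \int[mu]_x (m x * u x).
Proof.
move=> mm mK mN KN bm bK H su sv.
have [mF bF] := frequencyP c su sv.
have [_ ->] := integral_even_mul mK mF KN bK bF.
have cu : continuous u := continuous_schwartz (n := 0) su.
have bu : inv_quad_bounded u by exact: (inv_quad_bounded_schwartz 0).
have [_ ->] := integral_even_mul mm (continuous_measurable_fun cu) mN bm bu.
have pU := even_profile_schwartz su.
have iK : L1 P (fun x => K x * cos_tr (even_sum u) x).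
  apply: integrable_half_tempered => //; first exact: measurable_funTS.
    by apply: measurable_continuous; apply: continuous_cos_tr; exact: (integrable_even_sum 0).
  exact: cos_tr_profile_decay pU.
transitivity (2 * \int[mu]_(x in P) (K x * cos_tr (even_sum u) x)).
  rewrite -RintegralZl//; apply: integral_eq => x _.
  rewrite /frequency cos_trN sin_trN; last exact: (integrable_odd_diff 0).
  by ring.
rewrite (H _ _ _ pU) ?mulrA ?divff ?mul1r//.
apply: integrable_half_tempered.
- exact: measurable_inv_sqrt.
- by apply: measurable_continuous; exact: continuous_even_sum.
- exists 1 => // x x0; rewrite mul1r ger0_norm ?invr_ge0//.
  have [xn|xp] := ltP 0 x; first by rewrite gtr0_norm// lerDr.
  rewrite ler0_sqrtr// invr0 addr_ge0// invr_ge0//.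
- exact: inv_quad_bounded_even_sum.
Qed.

Lemma integral_cos_sin u v c x : real_schwartz u -> real_schwartz v ->
  \int[mu]_t (u t * cos (t * x) + c * (v t * sin (t * x))) =
  cos_tr (even_sum u) x + c * sin_tr (odd_diff v) x.
Proof.
move=> su sv.
set f := fun t => _.
have cu : continuous u := continuous_schwartz (n := 0) su.
have cv : continuous v := continuous_schwartz (n := 0) sv.
have cf : continuous f.
  move=> t; rewrite /f; under eq_fun do rewrite (mulrC _ x).
  apply: cvgD; last apply: cvgMl_tmp; apply: cvgM.
  - exact: cu.
  - exact: continuous_cos_mul.
  - exact: cv.
  - exact: continuous_sin_mul.
have bf : inv_quad_bounded f.
  apply: inv_quad_boundedD; last apply: inv_quad_boundedZ.
    have [C C0 HC] := inv_quad_bounded_schwartz 0 su; exists C => // t.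
    by apply: le_trans (HC t); rewrite normrM ler_piMr// norm_cos_le1.
  have [C C0 HC] := inv_quad_bounded_schwartz 0 sv; exists C => // t.
  by apply: le_trans (HC t); rewrite normrM ler_piMr// norm_sin_le1.
have [||_ ->] := @integral_symmetrize R f (continuous_measurable_fun cf).
- by apply: integrable_inv_quad => //; exact: measurable_continuous.
- apply: integrable_inv_quad; last exact: inv_quad_boundedN.
  by apply: measurable_continuous; exact: continuousN.
have iu := integrable_even_sum 0 su; have iv := integrable_odd_diff 0 sv.
have mP := @measurable_pos_line R.
rewrite /sin_tr -RintegralZl//; last exact: integrable_mul_sin.
rewrite /cos_tr -RintegralD//.
- by apply: integral_eq => t _; rewrite /f /even_sum /odd_diff mulNr cosN sinN (mulrC t); ring.
- exact: integrable_mul_cos.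
- by apply: integrable_scale => //; exact: integrable_mul_sin.
Qed.

Lemma Re_fourier (phi : R -> R[i]) x : schwartz phi ->
  complex.Re (fourier phi x) = cos_tr (even_sum (fun y => complex.Re (phi y))) x +
    1 * sin_tr (odd_diff (fun y => complex.Im (phi y))) x.
Proof.
move=> [su sv]; rewrite -integral_cos_sin//=; apply: integral_eq => t _.
by case: (phi t) => p q /=; ring.
Qed.

Lemma Im_fourier (phi : R -> R[i]) x : schwartz phi ->
  complex.Im (fourier phi x) = cos_tr (even_sum (fun y => complex.Im (phi y))) x +
    -1 * sin_tr (odd_diff (fun y => complex.Re (phi y))) x.
Proof.
move=> [su sv]; rewrite -integral_cos_sin//=; apply: integral_eq => t _.
by case: (phi t) => p q /=; ring.
Qed.

(** Reduces the identity of distributions to one on the half line. Profiles come with the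
    integrability of [y^(-1/2) * U y], as required by the leading term of [l_T]. *)
Lemma inverse_fourier_isP m K :
  measurable_fun setT m -> measurable_fun setT K ->
  (forall x, m (- x) = m x) -> (forall x, K (- x) = K x) ->
  inv_sqrt_bounded m -> inv_sqrt_bounded K ->
  (forall U U1 U2, even_profile U U1 U2 -> L1 P (fun y => (Num.sqrt y)^-1 * U y) ->
     \int[mu]_(x in P) (K x * cos_tr U x) = 2^-1 * \int[mu]_(y in P) (m y * U y)) ->
  inverse_fourier_is (fun xi => ((m xi)%:C)%C) (fun x => ((K x)%:C)%C).
Proof.
move=> mm mK mN KN bm bK H.
have ReM (a : R) (z : R[i]) : complex.Re (a%:C%C * z) = a * complex.Re z.
  by case: z => p q /=; rewrite mul0r subr0.
have ImM (a : R) (z : R[i]) : complex.Im (a%:C%C * z) = a * complex.Im z.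
  by case: z => p q /=; rewrite mul0r addr0.
have tempered f : measurable_fun setT f -> (forall x, f (- x) = f x) -> inv_sqrt_bounded f ->
    tempered_fun (fun x => (f x)%:C%C).
  move=> mf fN bf phi [su sv]; split.
    under eq_fun do rewrite ReM.
    apply: (integral_even_mul _ _ fN bf (inv_quad_bounded_schwartz 0 su)).1 => //.
    exact: continuous_measurable_fun (continuous_schwartz (n := 0) su).
  under eq_fun do rewrite ImM.
  apply: (integral_even_mul _ _ fN bf (inv_quad_bounded_schwartz 0 sv)).1 => //.
  exact: continuous_measurable_fun (continuous_schwartz (n := 0) sv).
split; [exact: tempered|exact: tempered|].
move=> phi sphi; have [su sv] := sphi; rewrite /pairing /Cintegral.
congr (Complex _ _).
  under eq_Rintegral do rewrite ReM Re_fourier//.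
  under [RHS]eq_Rintegral do rewrite ReM.
  exact: pairing_frequency.
under eq_Rintegral do rewrite ImM Im_fourier//.
under [RHS]eq_Rintegral do rewrite ImM.
exact: pairing_frequency.
Qed.

End schwartz_pairing.

(** * The three pairs of symbol and kernel *)

Section symbol_kernel_pairs.
Context {R : realType}.
Notation mu := (@lebesgue_measure R).
Notation P := (pos_line R).
Notation L1 A f := (mu.-integrable A (EFin \o f)).
Implicit Types (x y z t C c : R) (f m U : R -> R).

Lemma inv_sqrt_bounded_even f C : 0 <= C -> (forall x, f (- x) = f x) ->
  (forall x, 0 < x -> `|f x| <= C * (Num.sqrt x)^-1) -> inv_sqrt_bounded f.
Proof.
move=> C0 fN HC; exists C => // x x0.
have -> : f x = f `|x| by have [h|h] := leP 0 x; [rewrite ger0_norm|rewrite ltr0_norm// fN].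
by rewrite (le_trans (HC _ _)) ?normr_gt0// ler_wpM2l// lerDr.
Qed.

Lemma pairing_cos_tr m U U1 U2 : even_profile U U1 U2 -> L1 P m ->
  L1 P (fun x => pi^-1 * cos_tr m x * cos_tr U x) /\
  \int[mu]_(x in P) (pi^-1 * cos_tr m x * cos_tr U x) =
  2^-1 * \int[mu]_(y in P) (m y * U y).
Proof.
move=> pU im; have mP := @measurable_pos_line R.
have iU := integrable_cos_tr_profile pU.
have i : L1 P (fun x => cos_tr m x * cos_tr U x).
  apply: (@integrable_le _ _ _ (fun x => (\int[mu]_(y in P) `|m y|) * `|cos_tr U x|)) => //.
  - apply: measurable_funM; last exact: integrable_measurable iU.
    by apply: continuous_pos_measurable => x _; exact: continuous_cos_tr.
  - by apply: integrable_scale => //; exact: integrable_norm.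
  - by move=> x _; rewrite normrM ler_wpM2r// cos_tr_bound.
have E x : P x -> pi^-1 * (cos_tr m x * cos_tr U x) = pi^-1 * cos_tr m x * cos_tr U x.
  by rewrite mulrA.
split; first by apply: integrable_eq (integrable_scale _ mP i) E.
rewrite -(integral_eq E) RintegralZl// (pairing_profile pU im).
by rewrite !mulrA mulVf ?mul1r// gt_eqF// pi_gt0.
Qed.

Section fixed_parameter.
Variable T : R.
Hypothesis T_gt0 : 0 < T.
Let sT : 0 < Num.sqrt T. Proof. by rewrite sqrtr_gt0. Qed.

Lemma l_TN x : l_T T (- x) = l_T T x.
Proof.
rewrite /l_T oppr_eq0 sqrrN /tanh opprK (addrC (expR (- x)) (expR x)).
have -> : expR (- x) - expR x = - (expR x - expR (- x)) by rewrite opprB.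
by case: eqP => // _; rewrite (mulNr _ (_ + _)^-1) mulrN invrN mulrNN.
Qed.

Lemma sqrt_symbolN x : sqrt_symbol T (- x) = sqrt_symbol T x.
Proof. by rewrite /sqrt_symbol normrN sqrrN. Qed.

Lemma symbol_32N x : symbol_32 T (- x) = symbol_32 T x.
Proof. by rewrite /symbol_32 sqrt_symbolN normrN. Qed.

Lemma symbol_omegaN x : symbol_omega T (- x) = symbol_omega T x.
Proof. by rewrite /symbol_omega l_TN sqrt_symbolN. Qed.

(** At [0] the closed formula gives [0]; adding the indicator of the origin restores the value [1]
    and leaves a sum of measurable functions. *)
Lemma measurable_l_T_setT : measurable_fun setT (l_T T).
Proof.
apply: (eq_measurable_fun (fun x : R =>
  Num.sqrt (x * ((1 + T * x ^+ 2) * ((expR x - expR (- x)) * (expR x + expR (- x))^-1))^-1) +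
  \1_[set 0] x)).
  move=> x _; rewrite /l_T /tanh indicE; have [->|x0] := eqVneq x 0.
    by rewrite mul0r sqrtr0 add0r mem_set.
  by rewrite memNset ?addr0//; exact/eqP.
have mE : measurable_fun setT (@expR R).
  by apply: continuous_measurable_fun; exact: continuous_expR.
have mE' : measurable_fun setT (fun x : R => expR (- x)).
  by apply: (measurableT_comp mE); apply: continuous_measurable_fun; exact: opp_continuous.
apply: measurable_funD; last exact: measurable_indic.
apply: (measurableT_comp (continuous_measurable_fun (@sqrt_continuous R))).
apply: measurable_funM => //; apply: measurable_funV; apply: measurable_funM.
  by apply: measurable_funD => //; apply: measurable_funM => //; exact: measurable_funX.
apply: measurable_funM; first exact: measurable_funB.
by apply: measurable_funV; exact: measurable_funD.
Qed.

Lemma inv_sqrt_bounded_l_T : inv_sqrt_bounded (l_T T).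
Proof.
apply: (@inv_sqrt_bounded_even _ ((Num.sqrt T)^-1 + 2)) => [||x x0]; last 1 first.
- by have /andP[l0 l1] := l_T_le T_gt0 x0; rewrite ger0_norm.
- by rewrite addr_ge0// invr_ge0 ltW.
- exact: l_TN.
Qed.

Lemma inv_sqrt_bounded_symbol_32 : inv_sqrt_bounded (symbol_32 T).
Proof.
apply: (@inv_sqrt_bounded_even _ (Num.sqrt T)^-1) => [||x x0]; last 1 first.
- have /andP[l0 l1] := symbol_32_bounds T_gt0 x0.
  have a0 := lead_symbol_gt0 T_gt0 x0; have d0 := oneDT_gt0 T_gt0 x.
  have i0 : 0 < (1 + T * x ^+ 2)^-1 by rewrite invr_gt0.
  rewrite -normrN ger0_norm; last by apply: le_trans l0; rewrite divr_ge0// mulr_ge0// ltW.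
  apply: (le_trans l1); rewrite ler_piMr ?(ltW a0)// invf_le1// lerDl.
  by rewrite mulr_ge0 ?sqr_ge0// ltW.
- by rewrite invr_ge0 ltW.
- exact: symbol_32N.
Qed.

Lemma inv_sqrt_bounded_symbol_omega : inv_sqrt_bounded (symbol_omega T).
Proof.
apply: (@inv_sqrt_bounded_even _ 2) => [||x x0]; last 1 first.
- have /andP[l0 l1] := symbol_omega_bounds T_gt0 x0.
  rewrite ger0_norm//; apply: (le_trans l1); rewrite ler_pM2l//.
  by rewrite ler_piMr ?invr_ge0// -expR0 ler_expR oppr_le0 ltW.
- by [].
- exact: symbol_omegaN.
Qed.

Let inv_sqrt_bounded_cos_tr m : L1 P m -> inv_sqrt_bounded (fun x => pi^-1 * cos_tr m x).
Proof.
move=> im; have p0 : 0 < pi^-1 :> R by rewrite invr_gt0 pi_gt0.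
have i0 : 0 <= \int[mu]_(y in P) `|m y| by exact: Rintegral_ge0.
exists (pi^-1 * \int[mu]_(y in P) `|m y|) => [|x x0]; first by rewrite mulr_ge0// ltW.
rewrite normrM (gtr0_norm p0) -mulrA ler_pM2l//.
by rewrite (le_trans (cos_tr_bound _ im))// ler_peMr// lerDl invr_ge0.
Qed.

Let measurable_scaled_cos_tr m : L1 P m -> measurable_fun setT (fun x => pi^-1 * cos_tr m x).
Proof.
move=> im; apply: measurable_funM => //; apply: continuous_measurable_fun.
exact: continuous_cos_tr.
Qed.

Lemma inverse_fourier_symbol_32 :
  inverse_fourier_is (fun xi => ((symbol_32 T xi)%:C)%C) (fun x => ((kernel_32 T x)%:C)%C).
Proof.
have im := integrable_symbol_32 T_gt0.
apply: inverse_fourier_isP.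
- exact: measurable_symbol_32.
- exact: measurable_scaled_cos_tr.
- exact: symbol_32N.
- by move=> x; rewrite /kernel_32 cos_trN.
- exact: inv_sqrt_bounded_symbol_32.
- exact: inv_sqrt_bounded_cos_tr.
- by move=> U U1 U2 pU _; have [_ <-] := pairing_cos_tr pU im.
Qed.

Lemma inverse_fourier_symbol_omega :
  inverse_fourier_is (fun xi => ((symbol_omega T xi)%:C)%C) (fun x => ((kernel_omega T x)%:C)%C).
Proof.
have im := integrable_symbol_omega T_gt0.
apply: inverse_fourier_isP.
- by apply: measurable_funB; [exact: measurable_l_T_setT|exact: measurable_sqrt_symbol].
- exact: measurable_scaled_cos_tr.
- exact: symbol_omegaN.
- by move=> x; rewrite /kernel_omega cos_trN.
- exact: inv_sqrt_bounded_symbol_omega.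
- exact: inv_sqrt_bounded_cos_tr.
- by move=> U U1 U2 pU _; have [_ <-] := pairing_cos_tr pU im.
Qed.

(** The symbol is not integrable, so it is paired term by term: the leading part by
    [pairing_inv_sqrt], the two remainders by [pairing_cos_tr]. Each product is shown to be
    integrable beforehand so that the integral of the sum splits. *)
Lemma inverse_fourier_l_T :
  inverse_fourier_is (fun xi => ((l_T T xi)%:C)%C) (fun x => ((kernel T x)%:C)%C).
Proof.
have i32 := integrable_symbol_32 T_gt0; have iw := integrable_symbol_omega T_gt0.
apply: inverse_fourier_isP.
- exact: measurable_l_T_setT.
- exact: measurable_kernel.
- exact: l_TN.
- exact: kernelN.
- exact: inv_sqrt_bounded_l_T.
- exact: kernel_bound.
move=> U U1 U2 pU iU; have mP := @measurable_pos_line R.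
have [j32 E32] := pairing_cos_tr pU i32; have [jw Ew] := pairing_cos_tr pU iw.
have iUP := profile_integrable pU.
have cU : measurable_fun P U by exact: integrable_measurable iUP.
have mul_integrable m : measurable_fun P m -> inv_sqrt_bounded m -> L1 P (fun y => m y * U y).
  move=> mm [C C0 HC].
  apply: (@integrable_le _ _ _ (fun y => C * (`|U y| + `|(Num.sqrt y)^-1 * U y|))) => //.
  - exact: measurable_funM.
  - by apply: integrable_scale => //; apply: integrable_sum => //; exact: integrable_norm.
  move=> y; rewrite pos_lineE => y0; rewrite !normrM.
  have := HC y (lt0r_neq0 y0); rewrite (gtr0_norm y0) => h.
  rewrite (ger0_norm (x := (Num.sqrt y)^-1)) ?invr_ge0// -{2}[`|U y|]mul1r -mulrDl mulrA.
  exact: ler_wpM2r.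
have lead0 := pairing_inv_sqrt pU iU.
pose a x := Num.sqrt pi / Num.sqrt (2 * `|x|) * cos_tr U x.
have ja : L1 P a.
  apply: integrable_half_tempered.
  - by apply: measurable_funM => //; apply: measurable_funTS; exact: measurable_inv_sqrt_norm.
  - by apply: continuous_pos_measurable => x _; exact: continuous_cos_tr.
  - exists (Num.sqrt pi) => // x x0; rewrite ger0_norm ?divr_ge0// ler_wpM2l//.
    have s0 : 0 < Num.sqrt `|x| by rewrite sqrtr_gt0 normr_gt0.
    apply: (@le_trans _ _ (Num.sqrt `|x|)^-1); last by rewrite lerDr.
    rewrite lef_pV2 ?posrE//; last by rewrite sqrtr_gt0 mulr_gt0// normr_gt0.
    by rewrite ler_wsqrtr// ler_peMl// ler1n.
  - exact: cos_tr_profile_decay pU.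
have KE x : P x -> kernel T x * cos_tr U x =
    pi^-1 * (Num.sqrt T)^-1 * a x + pi^-1 * cos_tr (symbol_32 T) x * cos_tr U x +
    pi^-1 * cos_tr (symbol_omega T) x * cos_tr U x.
  by rewrite (kernelE T_gt0) /abel_limit /a => _; ring.
rewrite (integral_eq KE) RintegralD//; last first.
  by apply: integrable_sum => //; exact: integrable_scale.
rewrite RintegralD//; last exact: integrable_scale.
rewrite RintegralZl// lead0 E32 Ew.
have k32 : L1 P (fun y => symbol_32 T y * U y).
  apply: mul_integrable inv_sqrt_bounded_symbol_32; exact: integrable_measurable i32.
have kw : L1 P (fun y => symbol_omega T y * U y).
  apply: mul_integrable inv_sqrt_bounded_symbol_omega; exact: integrable_measurable iw.
have mE y : P y -> l_T T y * U y =
    (Num.sqrt T)^-1 * ((Num.sqrt y)^-1 * U y) + symbol_32 T y * U y + symbol_omega T y * U y.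
  by rewrite pos_lineE => y0; rewrite l_T_decomposition// /lead_symbol; ring.
rewrite (integral_eq mE) RintegralD//; last first.
  by apply: integrable_sum => //; exact: integrable_scale.
rewrite RintegralD//; last exact: integrable_scale.
rewrite RintegralZl// !mulrDr; congr (_ + _ + _).
have p0 : pi != 0 :> R by rewrite gt_eqF// pi_gt0.
by move: (\int[mu]_(y in P) _) p0; generalize (@pi R) => p I p0; field; rewrite p0 gt_eqF.
Qed.

End fixed_parameter.
End symbol_kernel_pairs.

Unset Implicit Arguments.
Set Strict Implicit.

Local Open Scope complex_scope.

Theorem theorem2p7 (R : realType) (T : R) (hT : 0 < T) :
  exists K K32 Komega : R -> R,
    inverse_fourier_is (fun xi => (l_T T xi)%:C) (fun x => (K x)%:C) /\
    inverse_fourier_is (fun xi => (symbol_32 T xi)%:C) (fun x => (K32 x)%:C) /\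
    inverse_fourier_is (fun xi => (symbol_omega T xi)%:C)
                       (fun x => (Komega x)%:C) /\
    (forall x : R, x != 0 ->
       K x = 1 / Num.sqrt (2 * pi * T * `|x|) + K32 x + Komega x) /\
    hoelder_space (3 / 2) K32 /\
    (forall s : R, 3 / 2 < s -> s \isn't a Num.int -> ~ hoelder_space s K32) /\
    real_analytic Komega /\
    (Num.sqrt `|x| * K x @[x --> 0^'] --> 1 / Num.sqrt (2 * pi * T)) /\
    (forall delta : R, delta < delta_star T ->
       exists C : R, forall x : R, 1 < `|x| ->
         `|K x| <= C * expR (- delta * `|x|)) /\
    (@lebesgue_measure R).-integrable [set: R] (EFin \o K).
Proof.
(* A distribution determines its function only up to a null set; [kernel] is the representative
   defined by the decomposition, for which the pointwise claims hold. *)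
exists (kernel T), (kernel_32 T), (kernel_omega T).
split; first exact: inverse_fourier_l_T.
split; first exact: inverse_fourier_symbol_32.
split; first exact: inverse_fourier_symbol_omega.
split; first by [].
split; first exact: hoelder_space_kernel_32.
split; first exact: not_hoelder_space_kernel_32.
split; first exact: real_analytic_kernel_omega.
split; first exact: cvg_sqrt_kernel.
split; last exact: integrable_kernel.
exact: kernel_decay.
Qed.
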